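(* Let $M\in\mathbb{R}^{d\times d}$ be a symmetric matrix with eigenvalues $1\ge\lambda_1\ge\cdots\ge\lambda_d\ge 0$ and corresponding orthonormal eigenvectors $u_1,\dots,u_d$. Let $k\in\{1,\dots,d\}$ and $\delta_\times,\varepsilon_{\mathsf{pca}},p\in(0,1)$. Then $\mathrm{LazySVD}(\mathcal A,M,k,\delta_\times,\varepsilon_{\mathsf{pca}},p)$ outputs a column-orthonormal matrix $V_k=(v_1,\dots,v_k)\in\mathbb{R}^{d\times k}$ which, with probability at least $1-p$, satisfies all of the following properties, where $M_k=(I-V_kV_k^\top)M(I-V_kV_k^\top)$ and $M_{k-1}=(I-V_{k-1}V_{k-1}^\top)M(I-V_{k-1}V_{k-1}^\top)$ with $V_{k-1}=(v_1,\dots,v_{k-1})$: (a) For $\varepsilon>0$, if $\varepsilon_{\mathsf{pca}}\le\frac{\varepsilon^4\delta_\times^2}{2^{12}k^4(\lambda_1/\lambda_k)^2}$, then $\|V_k^\top U\|_2\le\varepsilon$, where $U=(u_j,\dots,u_d)$ and $j$ is the smallest index satisfying $\lambda_j\le(1-\delta_\times)\|M_{k-1}\|_2$. (b) If $\varepsilon_{\mathsf{pca}}\le\frac{\delta_\times^6}{2^{28}k^4(\lambda_1/\lambda_{k+1})^6}$, then $\lambda_{k+1}\le\|M_k\|_2\le\frac{\lambda_{k+1}}{1-\delta_\times}$. (c) If $\varepsilon_{\mathsf{pca}}\le\frac{\delta_\times^6}{2^{28}k^4(\lambda_1/\lambda_{k+1})^6}$, then $(1-\delta_\times)\lambda_k\le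 v_k^\top Mv_k\le\frac{1}{1-\delta_\times}\lambda_k$. (d) For every $q\ge1$, if $\varepsilon_{\mathsf{pca}}\le\frac{\delta_\times^6}{2^{28}k^4d^{4/q}(\lambda_1/\lambda_{k+1})^6}$, then $\|M_k\|_{S_q}\le\frac{(1+\delta_\times)^2}{(1-\delta_\times)^2}\Big(\sum_{i=k+1}^d\lambda_i^q\Big)^{1/q}$.
   Context: $\|\cdot\|_2$ is the spectral norm of a matrix (Euclidean norm of a vector); $\|\cdot\|_{S_q}$ is the Schatten $q$-norm. Ratios with zero denominator are read as $+\infty$ (so the corresponding condition on $\varepsilon_{\mathsf{pca}}$ fails); $\lambda_{d+1}:=0$. If no index $j$ as in (a) exists, $U$ is empty. $\mathcal A$ denotes any approximate matrix inversion method: given $\lambda I-M\succ0$, a vector $b$ and an accuracy $\eta>0$, it returns $x$ with $\|x-(\lambda I-M)^{-1}b\|\le\eta$. Algorithm $\mathrm{AppxPCA}(\mathcal A,M,\delta_\times,\varepsilon,p)$, for symmetric $M\in\mathbb{R}^{d\times d}$ with $0\preceq M\preceq I$, $\delta_\times\in(0,0.5]$, $\varepsilon,p\in(0,1)$: 1. $m_1\leftarrow\lceil4\log(288d/p^2)\rceil$, $m_2\leftarrow\lceil\log(36d/(p^2\varepsilon))\rceil$; $\widetilde\varepsilon_1\leftarrow\frac{1}{64m_1}(\delta_\times/6)^{m_1}$, $\widetilde\varepsilon_2\leftarrow\frac{\varepsilon}{8m_2}(\delta_\times/6)^{m_2}$. 2. $\widehat w_0\leftarrow$ a uniformly random unit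 vector; $s\leftarrow0$; $\lambda^{(0)}\leftarrow1+\delta_\times$. 3. Repeat: $s\leftarrow s+1$; for $t=1,\dots,m_1$ apply $\mathcal A$ to find $\widehat w_t$ with $\|\widehat w_t-(\lambda^{(s-1)}I-M)^{-1}\widehat w_{t-1}\|\le\widetilde\varepsilon_1$; set $w\leftarrow\widehat w_{m_1}/\|\widehat w_{m_1}\|$; apply $\mathcal A$ to find $v$ with $\|v-(\lambda^{(s-1)}I-M)^{-1}w\|\le\widetilde\varepsilon_1$; set $\Delta^{(s)}\leftarrow\frac12\cdot\frac{1}{w^\top v-\widetilde\varepsilon_1}$ and $\lambda^{(s)}\leftarrow\lambda^{(s-1)}-\Delta^{(s)}/2$; until $\Delta^{(s)}\le\delta_\times\lambda^{(s)}/3$. 4. $f\leftarrow s$; for $t=1,\dots,m_2$ apply $\mathcal A$ to find $\widehat w_t$ with $\|\widehat w_t-(\lambda^{(f)}I-M)^{-1}\widehat w_{t-1}\|\le\widetilde\varepsilon_2$ (starting again from $\widehat w_0$). Return $w=\widehat w_{m_2}/\|\widehat w_{m_2}\|$. Algorithm $\mathrm{LazySVD}(\mathcal A,M,k,\delta_\times,\varepsilon_{\mathsf{pca}},p)$, for $0\preceq M\preceq I$, $k\in\{1,\dots,d\}$, $\delta_\times,\varepsilon_{\mathsf{pca}},p\in(0,1)$: set $M_0=M$ and $V_0=[\,]$ (empty). For $s=1,\dots,k$: $v_s'\leftarrow\mathrm{AppxPCA}(\mathcal A,M_{s-1},\delta_\times/2,\varepsilon_{\mathsf{pca}},p/k)$;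 $v_s\leftarrow(I-V_{s-1}V_{s-1}^\top)v_s'/\|(I-V_{s-1}V_{s-1}^\top)v_s'\|$; $V_s\leftarrow[V_{s-1},v_s]$; $M_s\leftarrow(I-v_sv_s^\top)M_{s-1}(I-v_sv_s^\top)$. Return $V_k$.
   Formalization: That LazySVD produces an output is claimed only with probability at least 1-p and when λ_k>0 (for M=0 the repeat loop never stops); every output is column-orthonormal, and when λ_k=0 the conditions in (a)-(d) all fail. *)

(* Defs.v *)
From mathcomp Require Export all_boot all_order all_algebra.
From mathcomp Require Export all_classical all_reals all_analysis.

Set Implicit Arguments.
Unset Strict Implicit.
Unset Printing Implicit Defensive.
Import Order.TTheory GRing.Theory Num.Theory.
Import numFieldNormedType.Exports.

#[global] Open Scope classical_set_scope.
#[global] Open Scope ring_scope.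

Section Norms.
Context {R : realType}.

Definition dotv {n} (x y : 'cV[R]_n) : R := (x^T *m y) 0 0.

Definition norm2 {n} (x : 'cV[R]_n) : R := Num.sqrt (\sum_i x i 0 ^+ 2).

Definition normalize {n} (x : 'cV[R]_n) : 'cV[R]_n := (norm2 x)^-1 *: x.

(* Also meaningful for n = 0, where its value is 0. *)
Definition spectral_norm {m n} (A : 'M[R]_(m, n)) : R :=
  sup [set norm2 (A *m x) | x in [set x : 'cV[R]_n | norm2 x <= 1]].

Definition posdef {n} (A : 'M[R]_n) : Prop :=
  A^T = A /\ forall x : 'cV[R]_n, x != 0 -> 0 < dotv x (A *m x).

(* The square roots of the eigenvalues of A^T A, with multiplicity.  The
   default [::] is never used, since the characteristic polynomial of a
   symmetric real matrix splits. *)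
Definition singular_values {m n} (A : 'M[R]_(m, n)) : seq R :=
  [seq Num.sqrt x |
    x <- xget [::] [set s | char_poly (A^T *m A) = \prod_(x <- s) ('X - x%:P)]].

Definition schatten_norm {m n} (q : R) (A : 'M[R]_(m, n)) : R :=
  (\sum_(x <- singular_values A) x `^ q) `^ q^-1.

(* The matrix whose columns are the first n entries of s (padded with 0). *)
Definition colmx {d} (n : nat) (s : seq 'cV[R]_d) : 'M[R]_(d, n) :=
  \matrix_(i < d, j < n) (nth 0 s j) i 0.

Definition compress {d n} (M : 'M[R]_d) (V : 'M[R]_(d, n)) : 'M[R]_d :=
  (1%:M - V *m V^T) *m M *m (1%:M - V *m V^T).

End Norms.

Section Algorithms.
Context {R : realType} {d : nat}.

(* Arguments: the shift l, the matrix M, the vector b and the accuracy eta of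
   the query (l I - M)^-1 b. *)
Definition inv_method := R -> 'M[R]_d -> 'cV[R]_d -> R -> 'cV[R]_d.

(* Nothing is assumed about the answers to queries outside the range
   l I - M > 0, eta > 0. *)
Definition approx_inversion (A : inv_method) : Prop :=
  forall l M b eta, posdef (l%:M - M) -> 0 < eta ->
    norm2 (A l M b eta - invmx (l%:M - M) *m b) <= eta.

Section AppxPCA.
Variables (A : inv_method) (M : 'M[R]_d) (delta eps p : R) (w0 : 'cV[R]_d).

Definition pca_m1 : nat :=
  absz (Num.ceil (4 * ln (288 * d%:R / p ^+ 2))).

Definition pca_m2 : nat :=
  absz (Num.ceil (ln (36 * d%:R / (p ^+ 2 * eps)))).

Definition pca_eps1 : R := (64 * pca_m1%:R)^-1 * (delta / 6) ^+ pca_m1.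

Definition pca_eps2 : R := eps / (8 * pca_m2%:R) * (delta / 6) ^+ pca_m2.

Definition inv_power (l eta : R) (t : nat) : 'cV[R]_d :=
  iter t (fun w => A l M w eta) w0.

(* One pass through the body of the repeat loop, at the current shift l. *)
Definition pca_w (l : R) : 'cV[R]_d := normalize (inv_power l pca_eps1 pca_m1).

Definition pca_v (l : R) : 'cV[R]_d := A l M (pca_w l) pca_eps1.

Definition pca_gap (l : R) : R :=
  2^-1 * (dotv (pca_w l) (pca_v l) - pca_eps1)^-1.

(* pca_shift s and pca_Delta s are lambda^(s) and Delta^(s); the latter is
   meant for 0 < s only. *)
Definition pca_shift (s : nat) : R :=
  iter s (fun l => l - pca_gap l / 2) (1 + delta).

Definition pca_Delta (s : nat) : R := pca_gap (pca_shift s.-1).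

Definition pca_stop (s : nat) : bool :=
  pca_Delta s <= delta * pca_shift s / 3.

(* The two divisions performed in pass s are by nonzero numbers. *)
Definition pca_defined (s : nat) : Prop :=
  inv_power (pca_shift s.-1) pca_eps1 pca_m1 != 0 /\
  dotv (pca_w (pca_shift s.-1)) (pca_v (pca_shift s.-1)) != pca_eps1.

(* A relation rather than a function, because the loop need not terminate
   (e.g. for M = 0) and a run may meet a division by zero. *)
Definition AppxPCA_returns (w : 'cV[R]_d) : Prop :=
  exists f : nat,
    [/\ (0 < f)%N,
        forall s, (0 < s <= f)%N -> pca_defined s /\ pca_stop s = (s == f),
        inv_power (pca_shift f) pca_eps2 pca_m2 != 0 &
        w = normalize (inv_power (pca_shift f) pca_eps2 pca_m2)].

End AppxPCA.

Definition deflate (M : 'M[R]_d) (vs : seq 'cV[R]_d) : 'M[R]_d :=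
  foldl (fun N v => (1%:M - v *m v^T) *m N *m (1%:M - v *m v^T)) M vs.

(* vs = [:: v_1; ...; v_k], and w0 s is the random unit vector drawn by the
   call of AppxPCA that produces v_(s+1). *)
Definition LazySVD_returns (A : inv_method) (M : 'M[R]_d) (k : nat)
    (delta eps p : R) (w0 : 'I_k -> 'cV[R]_d) (vs : seq 'cV[R]_d) : Prop :=
  size vs = k /\
  forall s : 'I_k, exists v' : 'cV[R]_d,
    let V := colmx s vs in
    let r := (1%:M - V *m V^T) *m v' in
    [/\ AppxPCA_returns A (deflate M (take s vs)) (delta / 2) eps (p / k%:R)
          (w0 s) v',
        r != 0 &
        nth 0 vs s = normalize r].

End Algorithms.
Arguments inv_method : clear implicits.

Section Randomness.
Context {R : realType}.

(* Matrices with the Borel sigma-algebra, generated by the entries. *)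
Definition entry_sets (m n : nat) : set (set 'M[R]_(m, n)) :=
  [set C | exists i j, exists2 B : set R, measurable B &
     C = [set N : 'M[R]_(m, n) | B (N i j)]].

Definition borelM (m n : nat) := g_sigma_algebraType (@entry_sets m n).

(* Joint measurability in the internal randomness z and in the query. *)
Definition measurable_method {d dZ} {Z : measurableType dZ}
    (A : Z -> inv_method R d) : Prop :=
  measurable_fun setT
    (fun x : Z * R * borelM d d * borelM d 1 * R =>
       let: (z, l, M, b, eta) := x in A z l M b eta : borelM d 1).

(* The uniform distribution on the unit sphere is the only one that is
   invariant under all orthogonal transformations. *)
Definition uniform_unit_vector {d dT} {T : measurableType dT}
    (P : probability T R) (X : T -> 'cV[R]_d) : Prop :=
  [/\ measurable_fun setT (X : T -> borelM d 1),
      forall t, norm2 (X t) = 1 &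
      forall Q : 'M[R]_d, Q^T *m Q = 1%:M ->
        forall B : set (borelM d 1), measurable B ->
          P [set t | B (Q *m X t)] = P [set t | B (X t)]].

(* Mutual independence of xi, X_0, ..., X_(k-1); the product rule for
   subfamilies is the case where some of the sets are everything. *)
Definition mutually_independent {d k dT dZ} {T : measurableType dT}
    {Z : measurableType dZ} (P : probability T R) (xi : T -> Z)
    (X : 'I_k -> T -> 'cV[R]_d) : Prop :=
  forall (C : set Z) (B : 'I_k -> set (borelM d 1)),
    measurable C -> (forall s, measurable (B s)) ->
    P [set t | C (xi t) /\ forall s, B s (X s t)] =
      (P [set t | C (xi t)] * \prod_(s < k) P [set t | B s (X s t)])%E.

End Randomness.
Arguments borelM : clear implicits.

(* Main.v *)
(* A call of AppxPCA on N >= 0 is exact up to errors amplified by at most (3/2)^m,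
   because multiplying the m-th power iterate by (l - |N|)^m fixes its top
   eigencomponent.  So as soon as |<w_0, q>| >= c := p' / (2d) for a unit top
   eigenvector q of N, where p' is the failure probability given to the call,
   the shift converges geometrically to |N| and the output
   has mass at most epca on the eigenvalues below (1 - 3 delta / 4)|N|.

   Deflating by such a vector moves low and high eigenspaces little: a gap-free
   Wedin estimate, chained over a slowly increasing sequence of k thresholds,
   shows that V_k is almost orthogonal to all eigenvectors of M with
   eigenvalue <= (1 - delta)|M_(k-1)|, which is (a).  Hence an eigenspace of M_k
   above theta together with V_k cannot be too large, by comparison with the
   eigenvectors of M; counting the eigenvalues of M_k above each theta gives
   (b), (c) and, after summation, (d).

   For the probability, |<X, q>| < c has probability at most 2cd for X uniform
   on the sphere: by invariance it does not depend on q, and averaging over the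
   directions q of a fine grid in the cube [0, 1]^d one only needs that a fixed
   unit vector is almost orthogonal to few grid points, which is clear along a
   coordinate where it is largest.  The s-th deflated matrix depends on xi and
   w_0, ..., w_(s-1) only, so Fubini and a union bound conclude. *)

From HB Require Import structures.
Require Import Defs.
From mathcomp Require Import all_boot all_order all_algebra.
From mathcomp Require Import all_classical all_reals all_analysis.
From mathcomp Require Import complex measurable_realfun zify ring lra.
Import Order.TTheory GRing.Theory Num.Theory.
Set Implicit Arguments.
Unset Strict Implicit.
Unset Printing Implicit Defensive.

(** * Euclidean vectors and the spectral theorem *)

(** Two obstacles shape the proof. First, neither M nor the deflated matrices need have a spectral
    gap. Each call runs with delta/2 and loses three halves of it, so v_s is controlled below (1 -
    3/4 delta) times the current norm, while (a) asks only about eigenvalues below (1 - delta) times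
    the last norm. The remaining delta/4 is cut into k slices; each deflation spends one slice as an
    artificial gap. This yields an angle of order k^2 epca (lambda_1/lambda_k)/delta, and the bounds
    on epca make it small even after multiplication by the ratio of eigenvalues. Second, the good
    event must be measurable, although the deflated matrices are random, their eigenvectors come
    with no measurable choice, and a run may fail to exist. Hence the event speaks of traces and
    powers only, and of a total functional version of the algorithm that coincides with every actual
    run. Constants: c = p'/(2d) makes the slab bound 2cd equal to the failure probability p' = p/k
    of one call; 3/2 bounds the distance from a shift to the top eigenvalue, since the first shift
    exceeds 1 by at most 1/2. *)

Section Euclidean.
Context {R : realType}.
Implicit Types (m n : nat) (a : R).

Lemma dotvE n (x y : 'cV[R]_n) : dotv x y = \sum_i x i 0 * y i 0.
Proof. by rewrite /dotv mxE; apply: eq_bigr => i _; rewrite mxE. Qed.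

Lemma dotvC n (x y : 'cV[R]_n) : dotv x y = dotv y x.
Proof. by rewrite !dotvE; apply: eq_bigr => i _; rewrite mulrC. Qed.

Lemma dotvDr n (x y z : 'cV[R]_n) : dotv x (y + z) = dotv x y + dotv x z.
Proof. by rewrite /dotv mulmxDr mxE. Qed.

Lemma dotvZr n a (x y : 'cV[R]_n) : dotv x (a *: y) = a * dotv x y.
Proof. by rewrite /dotv -scalemxAr mxE. Qed.

Lemma dotvNr n (x y : 'cV[R]_n) : dotv x (- y) = - dotv x y.
Proof. by rewrite /dotv mulmxN mxE. Qed.

Lemma dotvBr n (x y z : 'cV[R]_n) : dotv x (y - z) = dotv x y - dotv x z.
Proof. by rewrite dotvDr dotvNr. Qed.

Lemma dotvDl n (x y z : 'cV[R]_n) : dotv (y + z) x = dotv y x + dotv z x.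
Proof. by rewrite dotvC dotvDr ![dotv x _]dotvC. Qed.

Lemma dotvZl n a (x y : 'cV[R]_n) : dotv (a *: x) y = a * dotv x y.
Proof. by rewrite dotvC dotvZr dotvC. Qed.

Lemma dotvBl n (x y z : 'cV[R]_n) : dotv (y - z) x = dotv y x - dotv z x.
Proof. by rewrite dotvC dotvBr ![dotv x _]dotvC. Qed.

Lemma dotv0r n (x : 'cV[R]_n) : dotv x 0 = 0.
Proof. by rewrite /dotv mulmx0 mxE. Qed.

Lemma dotv0l n (x : 'cV[R]_n) : dotv 0 x = 0.
Proof. by rewrite dotvC dotv0r. Qed.

Lemma dotv_mulr m n (A : 'M[R]_(m, n)) x y :
  dotv x (A *m y) = dotv (A^T *m x) y.
Proof. by rewrite /dotv trmx_mul trmxK mulmxA. Qed.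

Lemma dotv_ge0 n (x : 'cV[R]_n) : 0 <= dotv x x.
Proof. by rewrite dotvE sumr_ge0 // => i _; rewrite -expr2 sqr_ge0. Qed.

Lemma norm2_sqE n (x : 'cV[R]_n) : norm2 x ^+ 2 = \sum_i x i 0 ^+ 2.
Proof. by rewrite /norm2 sqr_sqrtr // sumr_ge0 // => i _; rewrite sqr_ge0. Qed.

Lemma norm2_sq n (x : 'cV[R]_n) : norm2 x ^+ 2 = dotv x x.
Proof. by rewrite norm2_sqE dotvE; apply: eq_bigr => i _; rewrite expr2. Qed.

Lemma norm2_ge0 n (x : 'cV[R]_n) : 0 <= norm2 x.
Proof. exact: sqrtr_ge0. Qed.

Lemma norm2Z n a (x : 'cV[R]_n) : norm2 (a *: x) = `|a| * norm2 x.
Proof.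
apply/eqP; rewrite -(@eqrXn2 _ 2) ?norm2_ge0 ?mulr_ge0 ?norm2_ge0 ?normr_ge0//.
by rewrite exprMn !norm2_sq dotvZl dotvZr real_normK ?num_real// expr2 mulrA.
Qed.

Lemma norm2N n (x : 'cV[R]_n) : norm2 (- x) = norm2 x.
Proof. by rewrite -scaleN1r norm2Z normrN1 mul1r. Qed.

Lemma norm2_0 n : norm2 (0 : 'cV[R]_n) = 0.
Proof. by rewrite -(scale0r (0 : 'cV[R]_n)) norm2Z normr0 mul0r. Qed.

Lemma norm2_coord n (x : 'cV[R]_n) i : `|x i 0| <= norm2 x.
Proof.
rewrite -(@ler_pXn2r _ 2) ?nnegrE ?norm2_ge0 ?normr_ge0//.
rewrite norm2_sqE real_normK ?num_real// (bigD1 i)//= lerDl.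
by rewrite sumr_ge0 // => j _; rewrite sqr_ge0.
Qed.

Lemma norm2_eq0 n (x : 'cV[R]_n) : (norm2 x == 0) = (x == 0).
Proof.
apply/eqP/eqP => [x0|->]; last exact: norm2_0.
apply/colP => i; rewrite mxE; apply/eqP; rewrite -normr_le0 -x0.
exact: norm2_coord.
Qed.

Lemma norm2_gt0 n (x : 'cV[R]_n) : (0 < norm2 x) = (x != 0).
Proof. by rewrite lt_def norm2_eq0 norm2_ge0 andbT. Qed.

Lemma dotv_eq0 n (x : 'cV[R]_n) : (dotv x x == 0) = (x == 0).
Proof. by rewrite -norm2_sq sqrf_eq0 norm2_eq0. Qed.

Lemma norm2_normalize n (x : 'cV[R]_n) : x != 0 -> norm2 (normalize x) = 1.
Proof.
move=> x0; rewrite /normalize norm2Z ger0_norm ?invr_ge0 ?norm2_ge0//.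
by rewrite mulVf// norm2_eq0.
Qed.

Lemma cauchy_schwarz n (x y : 'cV[R]_n) : `|dotv x y| <= norm2 x * norm2 y.
Proof.
rewrite -(@ler_pXn2r _ 2) ?nnegrE ?mulr_ge0 ?norm2_ge0 ?normr_ge0//.
rewrite exprMn !norm2_sq real_normK ?num_real//.
have [->|y0] := eqVneq y 0; first by rewrite !dotv0r expr0n mulr0.
have yy : 0 < dotv y y by rewrite lt_def dotv_eq0 y0 dotv_ge0.
have := dotv_ge0 (dotv y y *: x - dotv x y *: y).
rewrite dotvBl !dotvBr !dotvZl !dotvZr (dotvC y x).
set a := dotv x y; set b := dotv y y; set e := dotv x x => h.
have : 0 <= b * (e * b - a ^+ 2) by apply: le_trans h _; rewrite le_eqVlt; apply/orP; left; apply/eqP; ring.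
by rewrite pmulr_rge0// subr_ge0.
Qed.

Lemma dotv_le n (x y : 'cV[R]_n) : dotv x y <= norm2 x * norm2 y.
Proof. exact: le_trans (ler_norm _) (cauchy_schwarz _ _). Qed.

Lemma norm2D n (x y : 'cV[R]_n) : norm2 (x + y) <= norm2 x + norm2 y.
Proof.
rewrite -(@ler_pXn2r _ 2) ?nnegrE ?addr_ge0 ?norm2_ge0//.
rewrite norm2_sq dotvDl !dotvDr (dotvC y x) sqrrD !norm2_sq.
have := dotv_le x y; lra.
Qed.

Lemma norm2B n (x y : 'cV[R]_n) : norm2 (x - y) <= norm2 x + norm2 y.
Proof. by rewrite -(norm2N y) norm2D. Qed.

Lemma norm2_lower n (x y : 'cV[R]_n) : norm2 x - norm2 y <= norm2 (x + y).
Proof. by rewrite lerBlDr -{1}[x](addrK y) norm2B. Qed.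

Lemma norm2_isometry m n (Q : 'M[R]_(m, n)) x :
  Q^T *m Q = 1%:M -> norm2 (Q *m x) = norm2 x.
Proof.
move=> QQ; apply/eqP; rewrite -(@eqrXn2 _ 2) ?norm2_ge0//.
by rewrite !norm2_sq dotv_mulr mulmxA QQ mul1mx.
Qed.

Lemma orthogonal_left n (Q : 'M[R]_n) : Q^T *m Q = 1%:M -> Q *m Q^T = 1%:M.
Proof. exact: mulmx1C. Qed.

Lemma dotv_isometry m n (Q : 'M[R]_(m, n)) x y :
  Q^T *m Q = 1%:M -> dotv (Q *m x) (Q *m y) = dotv x y.
Proof. by move=> QQ; rewrite dotv_mulr mulmxA QQ mul1mx dotvC. Qed.

Lemma mulmx_dotv n (x y z : 'cV[R]_n) : x *m y^T *m z = dotv y z *: x.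
Proof. by rewrite -mulmxA [y^T *m z]mx11_scalar -/(dotv y z) mul_mx_scalar. Qed.

Lemma sym_mxP n (N : 'M[R]_n) x y :
  N^T = N -> dotv x (N *m y) = dotv (N *m x) y.
Proof. by move=> NT; rewrite dotv_mulr NT. Qed.

Lemma mxP_dotv m n (A B : 'M[R]_(m, n)) :
  (forall x : 'cV[R]_n, A *m x = B *m x) -> A = B.
Proof.
move=> AB; apply/trmx_inj/row_matrixP => i.
rewrite -!tr_col !colE; congr (_^T); exact: AB.
Qed.

(** The reflection exchanging x and y: equal norms give |x - y|^2 = 2 <x - y, x>. It serves to split
    off an eigenvector in the spectral theorem and to carry one direction to another under the
    rotation-invariant law. *)
Lemma householder n (x y : 'cV[R]_n) : norm2 x = norm2 y ->
  exists H : 'M[R]_n, [/\ H^T *m H = 1%:M, H^T = H & H *m x = y].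
Proof.
move=> xy; have [->|neq] := eqVneq x y.
  by exists 1%:M; rewrite trmx1 !mul1mx.
pose v := x - y; pose b := dotv v v.
have b0 : b != 0 by rewrite /b dotv_eq0 subr_eq0.
have bE : b = 2 * dotv v x.
  have yy : dotv y y = dotv x x by rewrite -!norm2_sq xy.
  rewrite /b /v !(dotvBl, dotvBr) yy (dotvC y x); ring.
pose H := 1%:M - (2 / b) *: (v *m v^T).
have Hx z : H *m z = z - (2 / b * dotv v z) *: v.
  by rewrite /H mulmxBl mul1mx -scalemxAl mulmx_dotv scalerA.
have HT : H^T = H by rewrite /H linearB /= linearZ /= trmx_mul trmxK trmx1.
exists H; split => //; last first.
  by rewrite Hx mulrAC -bE divff// scale1r /v opprB addrC subrK.
rewrite HT; apply: mxP_dotv => z; rewrite -mulmxA mul1mx Hx Hx dotvBr dotvZr -/b.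
rewrite -addrA -opprD -scalerDl -[RHS]subr0; congr (_ - _).
apply/eqP; rewrite scaler_eq0; apply/orP; left; apply/eqP; field.
exact: b0.
Qed.

End Euclidean.

Section Spectral.
Context {R : realType}.

(** Over the complex numbers the matrix is Hermitian, so it has a real eigenvalue; being a root of
    the characteristic polynomial is insensitive to the field extension, which gives a real
    eigenvector. Eigenvectors are rows here, so symmetry is used once more to transpose. *)
Lemma sym_eigenvector n (N : 'M[R]_n.+1) : N^T = N ->
  exists a (x : 'cV[R]_n.+1), norm2 x = 1 /\ N *m x = a *: x.
Proof.
move=> NT.
pose f : {rmorphism R -> R[i]} := real_complex R.
pose A : 'M[R[i]]_n.+1 := map_mx f N.
have Areal : A \is hermsymmx.
  apply: realsym_hermsym.
    apply/is_hermitianmxP; rewrite expr0 scale1r.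
    by apply/matrixP => i j; rewrite /A !mxE -{1}NT mxE.
  apply/mxOverP => i j; rewrite mxE; apply/complex_realP; by exists (N i j).
have /orthomx_spectralP Asp := hermitian_normalmx Areal.
have /mxOverP/(_ 0 0)/complex_realP [a ea] := hermitian_spectral_diag_real Areal.
set P := spectralmx A in Asp; set sp := spectral_diag A in Asp ea.
have Pu : P \in unitmx := spectral_unit A.
have PA : row 0 P *m A = sp 0 0 *: row 0 P.
  rewrite {1}Asp -row_mul !mulmxA mulmxV// mul1mx.
  by apply/rowP => j; rewrite !mxE (bigD1 0)//= mxE eqxx mulr1n big1 ?addr0// => k k0;
    rewrite mxE eq_sym (negbTE k0) mulr0n mul0r.
have P0 : row 0 P != 0.
  apply/negP => /eqP r0; have := mulmxV Pu => /(congr1 (row 0)).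
  rewrite row_mul r0 mul0mx => /rowP/(_ 0); rewrite !mxE eqxx => /eqP.
  by rewrite eq_sym oner_eq0.
have : eigenvalue A (f a) by apply/eigenvalueP; exists (row 0 P) => //; rewrite PA ea.
rewrite eigenvalue_root_char -map_char_poly fmorph_root -eigenvalue_root_char.
case/eigenvalueP => r rN r0; exists a, (normalize r^T).
have rT0 : r^T != 0 by apply: contra_neq r0 => /(congr1 trmx); rewrite trmxK trmx0.
split; first exact: norm2_normalize.
by rewrite /normalize -scalemxAr -{1}NT -trmx_mul rN linearZ /= !scalerA mulrC.
Qed.

(** The eigenvalues in [D] come in no particular order. [(Q^T *m x) i 0] is the coordinate of x
    along the i-th eigenvector, and most arguments below are carried out in these coordinates. *)
Definition sdec n (N Q : 'M[R]_n) (D : 'rV[R]_n) :=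
  Q^T *m Q = 1%:M /\ N = Q *m diag_mx D *m Q^T.

(** Induction on the dimension: a reflection [H] moves a unit eigenvector to the first basis vector,
    and by symmetry [H *m N *m H] is then block diagonal, with a smaller symmetric block. *)
Theorem spectral_theorem n (N : 'M[R]_n) : N^T = N -> exists Q D, sdec N Q D.
Proof.
elim: n N => [|n IH] N NT.
  by exists 1%:M, 0; split; apply/matrixP => -[].
have [a [x [x1 Nx]]] := sym_eigenvector NT.
pose e0 : 'cV[R]_n.+1 := delta_mx 0 0.
have e01 : norm2 e0 = 1.
  apply/eqP; rewrite -(@eqrXn2 _ 2) ?norm2_ge0// norm2_sqE expr1n (bigD1 0)//= mxE eqxx.
  by rewrite expr1n big1 ?addr0// => i i0; rewrite mxE (negbTE i0) expr0n.
have [H [HH HT He]] : exists H : 'M[R]_n.+1, [/\ H^T *m H = 1%:M, H^T = H & H *m e0 = x].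
  by apply: householder; rewrite e01.
have HH' : H *m H = 1%:M by rewrite -{1}HT.
have [N' N'D] : exists N' : 'M[R]_(1 + n), N' = H *m N *m H by eexists.
have N'T : N'^T = N' by rewrite N'D !trmx_mul HT NT mulmxA.
have N'e : N' *m e0 = a *: e0.
  rewrite N'D -!mulmxA He Nx -scalemxAr; congr (_ *: _).
  by rewrite -He mulmxA HH' mul1mx.
have c0 : col 0 N' = a *: e0 by rewrite colE N'e.
pose B : 'M[R]_n := drsubmx N'.
have dl0 : dlsubmx N' = 0.
  apply/matrixP => i j; rewrite ord1 !mxE.
  have /colP/(_ (rshift 1 i)) := c0; rewrite !mxE => E.
  have -> : lshift n 0 = 0 :> 'I_(1 + n) by apply: val_inj.
  by rewrite E; have -> : (rshift 1 i == 0 :> 'I_(1 + n)) = false by []; rewrite mulr0.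
have N'E : N' = block_mx a%:M 0 0 B.
  rewrite -[LHS]submxK dl0 -/B; congr block_mx.
    apply/matrixP => i j; rewrite !ord1 !mxE eqxx mulr1n.
    have /colP/(_ 0) := c0; rewrite !mxE eqxx mulr1 => <-.
    by congr (N' _ _); apply: val_inj.
  by apply: trmx_inj; rewrite trmx_ursub N'T dl0 trmx0.
have BT : B^T = B by rewrite /B trmx_drsub N'T.
have [Q1 [D1 [Q1o BE]]] := IH _ BT.
pose K : 'M[R]_(1 + n) := block_mx 1%:M 0 0 Q1.
have KK : K^T *m K = 1%:M.
  rewrite /K tr_block_mx mulmx_block !trmx0 !trmx1 !mulmx0 !mul0mx !addr0 !add0r Q1o mulmx1.
  by rewrite -scalar_mx_block.
pose D : 'rV[R]_(1 + n) := row_mx a%:M D1.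
have KD : N' = K *m diag_mx D *m K^T.
  rewrite N'E BE /D diag_mx_row /K tr_block_mx !mulmx_block.
  rewrite ?(trmx0, trmx1, mulmx0, mul0mx, addr0, add0r, mulmx1, mul1mx).
  by congr block_mx; apply/matrixP => i j; rewrite !ord1 !mxE eqxx.
exists (H *m K), D; split.
  by rewrite trmx_mul -!mulmxA (mulmxA H^T) HH mul1mx KK.
have -> : N = H *m N' *m H.
  by rewrite N'D !mulmxA HH' mul1mx -mulmxA HH' mulmx1.
by rewrite trmx_mul HT !mulmxA; congr (_ *m _); rewrite -!mulmxA; congr (_ *m _); rewrite mulmxA.
Qed.

End Spectral.

(** * Positive semidefinite matrices in eigencoordinates, and the spectral norm *)

Section Psd.
Context {R : realType}.

Definition psd n (N : 'M[R]_n) :=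
  N^T = N /\ forall x : 'cV[R]_n, 0 <= dotv x (N *m x).

Section Decomposition.
Variables (n : nat) (N Q : 'M[R]_n) (D : 'rV[R]_n).
Hypothesis ND : sdec N Q D.

Let QQ : Q^T *m Q = 1%:M := ND.1.
Let QQT : Q *m Q^T = 1%:M := orthogonal_left QQ.

Lemma sdec_mulE (x : 'cV[R]_n) i : (Q^T *m (N *m x)) i 0 = D 0 i * (Q^T *m x) i 0.
Proof.
rewrite ND.2 !mulmxA QQ mul1mx -mulmxA mul_diag_mx mxE. by [].
Qed.

Lemma sdec_sym : N^T = N.
Proof. by rewrite ND.2 !trmx_mul trmxK tr_diag_mx mulmxA. Qed.

Lemma sdec_norm2 (x : 'cV[R]_n) : norm2 (Q^T *m x) = norm2 x.
Proof. by apply: norm2_isometry; rewrite trmxK. Qed.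

Lemma sdec_dotv (x y : 'cV[R]_n) : dotv (Q^T *m x) (Q^T *m y) = dotv x y.
Proof. by apply: dotv_isometry; rewrite trmxK. Qed.

Lemma sdec_quad (x : 'cV[R]_n) :
  dotv x (N *m x) = \sum_i D 0 i * (Q^T *m x) i 0 ^+ 2.
Proof.
rewrite -sdec_dotv dotvE; apply: eq_bigr => i _.
by rewrite sdec_mulE mulrCA expr2.
Qed.

Lemma sdec_col_coord i j : (Q^T *m col i Q) j 0 = (j == i)%:R.
Proof. by rewrite colE mulmxA QQ mul1mx mxE eqxx andbT. Qed.

Lemma sdec_col_norm i : norm2 (col i Q) = 1.
Proof.
apply/eqP; rewrite -(@eqrXn2 _ 2) ?norm2_ge0// -sdec_norm2 norm2_sqE expr1n.
rewrite (bigD1 i)//= sdec_col_coord eqxx expr1n big1 ?addr0// => j ji.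
by rewrite sdec_col_coord (negbTE ji) expr0n.
Qed.

Lemma sdec_col_quad i : dotv (col i Q) (N *m col i Q) = D 0 i.
Proof.
rewrite sdec_quad (bigD1 i)//= sdec_col_coord eqxx expr1n mulr1 big1 ?addr0// => j ji.
by rewrite sdec_col_coord (negbTE ji) expr0n mulr0.
Qed.

Lemma sdec_ge0 : psd N -> forall i, 0 <= D 0 i.
Proof. by move=> [_ N0] i; rewrite -sdec_col_quad. Qed.

Lemma sdec_inj (x y : 'cV[R]_n) : Q^T *m x = Q^T *m y -> x = y.
Proof. by move=> xy; rewrite -[x]mul1mx -QQT -mulmxA xy mulmxA QQT mul1mx. Qed.

Lemma sdec_mulQ (z : 'cV[R]_n) : Q^T *m (Q *m z) = z.
Proof. by rewrite mulmxA QQ mul1mx. Qed.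

Lemma sdec_col_eigen i : N *m col i Q = D 0 i *: col i Q.
Proof.
apply: sdec_inj; apply/colP => j.
rewrite sdec_mulE -scalemxAr [RHS]mxE sdec_col_coord.
by have [->//|_] := eqVneq j i; rewrite !mulr0.
Qed.

End Decomposition.

Section SpectralNorm.
Variables m n : nat.
Implicit Types A : 'M[R]_(m, n).

(** The crude constant does not matter: finiteness makes the supremum in [spectral_norm] a genuine
    one. *)
Lemma norm2_mulmx_bounded A :
  exists2 C, 0 <= C & forall x : 'cV[R]_n, norm2 (A *m x) <= C * norm2 x.
Proof.
exists (\sum_i norm2 ((row i A)^T)); first by apply: sumr_ge0 => i _; exact: norm2_ge0.
move=> x; rewrite -(@ler_pXn2r _ 2) ?nnegrE ?mulr_ge0 ?norm2_ge0 ?sumr_ge0//; last first.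
  by move=> i _; exact: norm2_ge0.
have coordE i : (A *m x) i 0 = dotv (row i A)^T x.
  by rewrite dotvE mxE; apply: eq_bigr => j _; rewrite !mxE.
rewrite norm2_sqE exprMn expr2 big_distrlr /=.
apply: (@le_trans _ _ ((\sum_i norm2 ((row i A)^T) ^+ 2) * norm2 x ^+ 2)).
  rewrite big_distrl /=; apply: ler_sum => i _; rewrite coordE -exprMn.
  rewrite -[leLHS]real_normK ?num_real// ler_pXn2r ?nnegrE ?mulr_ge0 ?norm2_ge0//.
  exact: cauchy_schwarz.
rewrite ler_wpM2r ?sqr_ge0//; apply: ler_sum => i _.
rewrite (bigD1 i)//= -expr2 lerDl sumr_ge0// => j _.
by rewrite mulr_ge0 ?norm2_ge0.
Qed.

Let values A := [set norm2 (A *m x) | x in [set x : 'cV[R]_n | norm2 x <= 1]]%classic.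

Lemma spectral_norm_has_sup A : has_sup (values A).
Proof.
split; first by exists (norm2 (A *m 0)); exists 0 => //=; rewrite norm2_0 ler01.
have [C C0 CA] := norm2_mulmx_bounded A; exists C => _ [x x1 <-].
by apply: le_trans (CA x) _; rewrite ler_piMr.
Qed.

Lemma spectral_norm_ge0 A : 0 <= spectral_norm A.
Proof.
apply: le_trans (norm2_ge0 (A *m 0)) _; apply: (sup_upper_bound (spectral_norm_has_sup A)).
by exists 0 => //=; rewrite norm2_0 ler01.
Qed.

Lemma spectral_norm_ub A x : norm2 (A *m x) <= spectral_norm A * norm2 x.
Proof.
have [->|x0] := eqVneq x 0; first by rewrite mulmx0 !norm2_0 mulr0.
rewrite -ler_pdivrMr ?norm2_gt0//.
apply: (sup_upper_bound (spectral_norm_has_sup A)).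
exists (normalize x); first by rewrite /= norm2_normalize.
by rewrite /normalize -scalemxAr norm2Z ger0_norm ?invr_ge0 ?norm2_ge0// mulrC.
Qed.

Lemma spectral_norm_le A c : 0 <= c ->
  (forall x, norm2 (A *m x) <= c * norm2 x) -> spectral_norm A <= c.
Proof.
move=> c0 Ac; apply: ge_sup; first exact: (spectral_norm_has_sup A).1.
by move=> _ [x x1 <-]; apply: le_trans (Ac x) _; rewrite ler_piMr.
Qed.

End SpectralNorm.

Lemma sdec_mul_norm n (N Q : 'M[R]_n) D c x : sdec N Q D -> psd N ->
  0 <= c -> (forall i, D 0 i <= c) -> norm2 (N *m x) <= c * norm2 x.
Proof.
move=> ND Np c0 Dc.
rewrite -(@ler_pXn2r _ 2) ?nnegrE ?mulr_ge0 ?norm2_ge0// exprMn.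
rewrite -(sdec_norm2 ND) -(sdec_norm2 ND x) !norm2_sqE big_distrr /=.
apply: ler_sum => i _; rewrite (sdec_mulE ND) exprMn ler_wpM2r ?sqr_ge0//.
by rewrite ler_pXn2r ?nnegrE ?(sdec_ge0 ND Np).
Qed.

Lemma sdec_le_norm n (N Q : 'M[R]_n) D i : sdec N Q D -> D 0 i <= spectral_norm N.
Proof.
move=> ND; have := spectral_norm_ub N (col i Q).
rewrite (sdec_col_norm ND) mulr1; apply: le_trans.
have := dotv_le (col i Q) (N *m col i Q).
by rewrite (sdec_col_quad ND) (sdec_col_norm ND) mul1r.
Qed.

Lemma sdec_norm_attained n (N Q : 'M[R]_n) D : sdec N Q D -> psd N -> (0 < n)%N ->
  exists i, D 0 i = spectral_norm N.
Proof.
move=> ND Np n0; pose i0 : 'I_n := Ordinal n0.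
have [i iM] : exists i, forall j, D 0 j <= D 0 i.
  by case: (arg_maxP (P := predT) (fun i => D 0 i) (erefl : predT i0)) => i _ iM; exists i => j; exact: iM.
exists i; apply/eqP; rewrite eq_le (sdec_le_norm i ND) /=.
have Di : 0 <= D 0 i by exact: (sdec_ge0 ND Np).
by apply: spectral_norm_le => // x; exact: (sdec_mul_norm _ ND).
Qed.

Lemma psd_quad_le n (N : 'M[R]_n) x : dotv x (N *m x) <= spectral_norm N * norm2 x ^+ 2.
Proof.
apply: le_trans (dotv_le _ _) _; rewrite expr2 mulrCA ler_wpM2l ?norm2_ge0//.
exact: spectral_norm_ub.
Qed.

(** Applied to [Q^T *m x], this represents the orthogonal projection of x on the eigenvectors
    selected by [S]; its squared norm is the mass of x on them. *)
Definition part n (S : pred 'I_n) (x : 'cV[R]_n) : 'cV[R]_n :=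
  \col_i (if S i then x i 0 else 0).

Lemma part_norm2_sq n (S : pred 'I_n) x :
  norm2 (part S x) ^+ 2 = \sum_(i | S i) x i 0 ^+ 2.
Proof.
rewrite norm2_sqE [RHS]big_mkcond; apply: eq_bigr => i _; rewrite mxE.
by case: (S i); rewrite ?expr0n.
Qed.

Lemma part_norm2 n (S : pred 'I_n) x : norm2 (part S x) <= norm2 x.
Proof.
rewrite -(@ler_pXn2r _ 2) ?nnegrE ?norm2_ge0// part_norm2_sq norm2_sqE.
by rewrite big_mkcond; apply: ler_sum => i _; case: (S i); rewrite ?sqr_ge0.
Qed.

Lemma partD n (S : pred 'I_n) x y : part S (x + y) = part S x + part S y.
Proof. by apply/colP => i; rewrite !mxE; case: (S i); rewrite ?addr0. Qed.

Lemma partZ n (S : pred 'I_n) a x : part S (a *: x) = a *: part S x.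
Proof. by apply/colP => i; rewrite !mxE; case: (S i); rewrite ?mulr0. Qed.

Lemma part_split n (S : pred 'I_n) x :
  norm2 (part S x) ^+ 2 + norm2 (part (predC S) x) ^+ 2 = norm2 x ^+ 2.
Proof. by rewrite !part_norm2_sq norm2_sqE [RHS](bigID S). Qed.

End Psd.

(** * Inexact inverse power iterations and AppxPCA *)

Section Numeric.
Local Open Scope ring_scope.
Context {R : realType}.

Lemma ler_exp (m : nat) (x y : R) : 0 <= x -> x <= y -> x ^+ m <= y ^+ m.
Proof. by move=> x0 xy; rewrite lerXn2r ?nnegrE// (le_trans x0). Qed.

Lemma le_absz_ceil (x : R) : x <= (absz (Num.ceil x))%:R.
Proof.
apply: le_trans (Num.Theory.ceil_ge x) _.
by rewrite pmulrn ler_int lez_abs.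
Qed.

Lemma absz_ceil_gt0 (x : R) : 0 < x -> (0 < absz (Num.ceil x))%N.
Proof. by move=> x0; rewrite absz_gt0 gt_eqF// ceil_gt0. Qed.

Lemma expR_ge_quarter : 3 / 4 <= expR (- (1 / 4)) :> R.
Proof. by apply: le_trans (expR_ge1Dx _); lra. Qed.

Lemma expRN1_ge_third : 1 / 3 <= expR (- 1) :> R.
Proof.
(* The bound 1 + x <= exp x is vacuous at x = -1; at x = -1/6 it gives (5/6)^6, which is just above
   1/3. *)
have -> : - 1 = 6%:R * (- (1 / 6)) :> R by lra.
rewrite expRM_natl; apply: (@le_trans _ _ ((5 / 6) ^+ 6)); first by lra.
by apply: ler_exp; [lra|apply: le_trans (expR_ge1Dx _); lra].
Qed.

(** Since 3/4 <= exp (-1/4), the factor 4 in m_1 is the price of a contraction by 3/4 only. For m_2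
    the contraction is 1/3 <= exp (-1), and no factor appears. *)
Lemma pow34_le (m : nat) (X : R) : 0 < X -> 4 * ln X <= m%:R -> (3 / 4) ^+ m <= X^-1.
Proof.
move=> X0 h; apply: (@le_trans _ _ (expR (- (1 / 4)) ^+ m)).
  by apply: ler_exp; [lra|exact: expR_ge_quarter].
have -> : X^-1 = expR (- ln X) by rewrite expRN lnK ?posrE.
rewrite -expRM_natr ler_expR; lra.
Qed.

Lemma pow13_le (m : nat) (X : R) : 0 < X -> ln X <= m%:R -> (1 / 3) ^+ m <= X^-1.
Proof.
move=> X0 h; apply: (@le_trans _ _ (expR (- 1) ^+ m)).
  by apply: ler_exp; [lra|exact: expRN1_ge_third].
have -> : X^-1 = expR (- ln X) by rewrite expRN lnK ?posrE.
rewrite -expRM_natr ler_expR; lra.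
Qed.

Lemma expn_small (a e : R) : 0 <= a < 1 -> 0 < e -> exists n : nat, a ^+ n <= e.
Proof.
move=> /andP[a0 a1] e0; have b0 : 0 < 1 - a by lra.
exists (absz (Num.ceil (ln e^-1 / (1 - a)))); set n := absz _.
have nE : ln e^-1 / (1 - a) <= n%:R := le_absz_ceil _.
apply: (@le_trans _ _ (expR (a - 1) ^+ n)).
  by apply: ler_exp => //; apply: le_trans (expR_ge1Dx _); lra.
rewrite -expRM_natr -[leRHS]lnK ?posrE// ler_expR.
move: nE; rewrite ler_pdivrMr// lnV ?posrE//; lra.
Qed.

End Numeric.

Section InversePower.
Local Open Scope ring_scope.
Context {R : realType} {d : nat}.
Variables (A : inv_method R d) (N Q : 'M[R]_d) (D : 'rV[R]_d) (w0 : 'cV[R]_d).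
Variables (lam l : R).
Hypotheses (Ainv : approx_inversion A) (ND : sdec N Q D).
Hypotheses (D_le : forall i, D 0 i <= lam) (lam_lt : lam < l) (gap_le : l - lam <= 3 / 2).

Let B : 'M[R]_d := invmx (l%:M - N).

Let gap_gt0 : 0 < l - lam. Proof. by rewrite subr_gt0. Qed.
Let lD_gt0 i : 0 < l - D 0 i.
Proof. by rewrite subr_gt0; apply: le_lt_trans lam_lt. Qed.

Lemma sdec_shift : sdec (l%:M - N) Q (\row_i (l - D 0 i)).
Proof.
split; first exact: ND.1.
have -> : diag_mx (\row_i (l - D 0 i)) = l%:M - diag_mx D.
  apply/matrixP => i j; rewrite !mxE; case: (i == j); rewrite ?mulr1n ?mulr0n ?subr0//.
rewrite mulmxBr mulmxBl -ND.2 mul_mx_scalar -scalemxAl (orthogonal_left ND.1).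
by rewrite scalemx1.
Qed.

Lemma shift_posdef : posdef (l%:M - N).
Proof.
split; first exact: sdec_sym sdec_shift.
move=> x x0; rewrite (sdec_quad sdec_shift) lt_def sumr_ge0 ?andbT; last first.
  by move=> i _; rewrite mxE mulr_ge0 ?sqr_ge0 ?ltW.
rewrite psumr_eq0; last by move=> i _; rewrite mxE mulr_ge0 ?sqr_ge0 ?ltW.
apply: contra x0 => /allP h; rewrite -norm2_eq0 -(sdec_norm2 ND) norm2_eq0.
apply/eqP/colP => i; rewrite [RHS]mxE.
have := h i (mem_index_enum i); rewrite mxE mulf_eq0 gt_eqF//= sqrf_eq0.
by move/eqP.
Qed.

Lemma shift_unit : l%:M - N \in unitmx.
Proof.
have S := sdec_shift; rewrite S.2 !unitmx_mul unitmx_tr.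
rewrite (mulmx1_unit ND.1).2 andbT /= unitmxE det_diag unitfE.
by apply/prodf_neq0 => i _; rewrite mxE gt_eqF.
Qed.

Lemma shift_inv_coord (x : 'cV[R]_d) i : (Q^T *m (B *m x)) i 0 = (Q^T *m x) i 0 / (l - D 0 i).
Proof.
have := sdec_mulE sdec_shift (B *m x) i.
rewrite (mulmxA (l%:M - N)) (mulmxV shift_unit) mul1mx [(\row__ _) _ _]mxE mulrC => ->.
by rewrite mulfK// gt_eqF.
Qed.

(** The exact m-th iterate in eigencoordinates, rescaled by (l - lam)^m: coordinates at the
    eigenvalue lam stay those of [w0], the others shrink. *)
Definition damping (m : nat) : 'cV[R]_d :=
  \col_i (((l - lam) / (l - D 0 i)) ^+ m * (Q^T *m w0) i 0).

(* Multiplying by (l - lam)^m makes the top eigencomponent stationary, so that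
   the error of each query is never amplified by more than (3/2)^m. *)
Lemma inv_power_noise (eta : R) m : 0 < eta ->
  exists2 n : 'cV[R]_d, norm2 n <= eta * m%:R * (3 / 2) ^+ m &
    (l - lam) ^+ m *: (Q^T *m inv_power A N w0 l eta m) = damping m + n.
Proof.
move=> eta0; elim: m => [|m [n nle IH]].
  exists 0; first by rewrite norm2_0 mulr0 mul0r.
  by rewrite scale1r addr0; apply/colP => i; rewrite [RHS]mxE expr0 mul1r.
rewrite /inv_power iterS -/(inv_power A N w0 l eta m).
set y := inv_power A N w0 l eta m in IH *.
pose e := A l N y eta - B *m y.
have ele : norm2 e <= eta by apply: Ainv => //; exact: shift_posdef.
have -> : A l N y eta = B *m y + e by rewrite addrC subrK.
(* The old noise passes through factors at most 1; only the error of the new query is rescaled, by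
   (l - lam)^(m+1) <= (3/2)^(m+1). *)
pose n1 : 'cV[R]_d := \col_i ((l - lam) / (l - D 0 i) * n i 0).
exists (n1 + (l - lam) ^+ m.+1 *: (Q^T *m e)).
  have n1le : norm2 n1 <= norm2 n.
    rewrite -(@ler_pXn2r _ 2) ?nnegrE ?norm2_ge0// !norm2_sqE.
    apply: ler_sum => i _; rewrite mxE exprMn ler_piMl ?sqr_ge0//.
    apply: exprn_ile1; first by rewrite divr_ge0 ?ltW.
    by rewrite ler_pdivrMr// mul1r lerD2l lerN2.
  apply: le_trans (norm2D _ _) _.
  rewrite norm2Z (sdec_norm2 ND) ger0_norm ?exprn_ge0 ?(ltW gap_gt0)//.
  have h1 : (l - lam) ^+ m.+1 * norm2 e <= (3 / 2) ^+ m.+1 * eta.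
    by apply: ler_pM; rewrite ?exprn_ge0 ?norm2_ge0 ?(ltW gap_gt0)// ler_exp// ltW.
  have h2 : (3 / 2) ^+ m <= (3 / 2) ^+ m.+1 :> R.
    have : 0 <= (3 / 2) ^+ m :> R by apply: exprn_ge0; lra.
    rewrite exprS; lra.
  have h3 : eta * m%:R * (3 / 2) ^+ m <= eta * m%:R * (3 / 2) ^+ m.+1.
    by rewrite ler_wpM2l// mulr_ge0// ltW.
  rewrite -[m.+1%:R]natr1 mulrDr mulr1 mulrDl [eta * (3 / 2) ^+ _]mulrC.
  by apply: lerD h1; apply: le_trans n1le (le_trans nle h3).
rewrite mulmxDr scalerDr addrA; congr (_ + _); apply/colP => i.
have E : (l - lam) ^+ m * (Q^T *m y) i 0 =
    ((l - lam) / (l - D 0 i)) ^+ m * (Q^T *m w0) i 0 + n i 0.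
  by have := congr1 (fun v : 'cV[R]_d => v i 0) IH; rewrite /= [LHS]mxE [RHS]mxE [damping m i 0]mxE.
rewrite [LHS]mxE shift_inv_coord [RHS]mxE [damping _ i 0]mxE [n1 i 0]mxE.
rewrite [in RHS]exprS -mulrA -mulrDr -E [in LHS]exprS; ring.
Qed.

(** After rescaling by (l - lam)^m the iterate has norm at least c - noise, because of its top
    component, and its part on [S] is at most rho^m + noise. Normalization cancels the unknown scale
    and leaves the quotient. *)
Lemma low_mass (S : pred 'I_d) (eta c rho kappa : R) m :
  0 < eta -> norm2 w0 = 1 -> 0 <= rho ->
  (forall i, S i -> (l - lam) / (l - D 0 i) <= rho) ->
  c <= norm2 (part (fun i => D 0 i == lam) (Q^T *m w0)) ->
  let noise := eta * m%:R * (3 / 2) ^+ m in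
  noise < c -> rho ^+ m + noise <= kappa * (c - noise) ->
  let y := inv_power A N w0 l eta m in
  y != 0 /\ norm2 (part S (Q^T *m normalize y)) <= kappa.
Proof.
move=> eta0 w01 rho0 Srho ctop noise noisec rhok y.
have [n nle yE] := inv_power_noise m eta0; rewrite -/y -/noise in nle yE.
have g0 : 0 < (l - lam) ^+ m by rewrite exprn_gt0.
set g := (l - lam) ^+ m in yE g0.
have lower : c - noise <= g * norm2 y.
  have -> : g * norm2 y = norm2 (damping m + n).
    by rewrite -yE norm2Z (sdec_norm2 ND) gtr0_norm.
  apply: le_trans (part_norm2 (fun i => D 0 i == lam) _).
  rewrite partD; apply: le_trans (norm2_lower _ _).
  apply: lerB; last exact: le_trans (part_norm2 _ _) nle.
  apply: le_trans ctop _; rewrite le_eqVlt; apply/orP; left; apply/eqP.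
  congr norm2; apply/colP => i; rewrite ![part _ _ _ _]mxE; case: eqP => // Di.
  by rewrite [RHS]mxE Di divff ?expr1n ?mul1r// gt_eqF.
have upper : g * norm2 (part S (Q^T *m y)) <= rho ^+ m + noise.
  have -> : g * norm2 (part S (Q^T *m y)) = norm2 (part S (damping m + n)).
    by rewrite -yE partZ norm2Z gtr0_norm.
  rewrite partD; apply: le_trans (norm2D _ _) _.
  apply: lerD; last exact: le_trans (part_norm2 _ _) nle.
  rewrite -(@ler_pXn2r _ 2) ?nnegrE ?norm2_ge0 ?exprn_ge0//.
  rewrite part_norm2_sq; apply: (@le_trans _ _ (\sum_(i | S i) (rho ^+ m) ^+ 2 * (Q^T *m w0) i 0 ^+ 2)).
    apply: ler_sum => i Si; rewrite mxE exprMn ler_wpM2r ?sqr_ge0//.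
    have r0 : 0 <= (l - lam) / (l - D 0 i) by rewrite divr_ge0 ?ltW.
    by rewrite ler_exp ?exprn_ge0// ler_exp// Srho.
  rewrite -big_distrr /= -part_norm2_sq ler_piMr ?sqr_ge0//.
  by rewrite exprn_ile1 ?norm2_ge0// (le_trans (part_norm2 _ _))// (sdec_norm2 ND) w01.
have cn : 0 < c - noise by rewrite subr_gt0.
have y0 : 0 < norm2 y by rewrite -(pmulr_rgt0 _ g0); exact: lt_le_trans lower.
have kappa0 : 0 <= kappa.
  rewrite -(pmulr_lge0 _ cn); apply: le_trans rhok.
  by apply: le_trans upper; rewrite mulr_ge0 ?norm2_ge0 ?ltW.
split; first by rewrite -norm2_gt0.
rewrite /normalize -scalemxAr partZ norm2Z ger0_norm ?invr_ge0 ?(ltW y0)//.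
rewrite mulrC ler_pdivrMr// -(ler_pM2l g0).
apply: le_trans upper _; apply: le_trans rhok _.
by rewrite mulrCA ler_wpM2l.
Qed.

Let beta : R := (l - lam)^-1.

Lemma rayleigh_inverse_le (w : 'cV[R]_d) : norm2 w = 1 -> dotv w (B *m w) <= beta.
Proof.
move=> w1; rewrite -(sdec_dotv ND) dotvE.
apply: (@le_trans _ _ (\sum_i beta * (Q^T *m w) i 0 ^+ 2)).
  apply: ler_sum => i _; rewrite shift_inv_coord mulrA -expr2 mulrC.
  by rewrite ler_wpM2r ?sqr_ge0// lef_pV2 ?posrE// lerD2l lerN2.
by rewrite -big_distrr /= -norm2_sqE (sdec_norm2 ND) w1 expr1n mulr1.
Qed.

(** Outside [S], where mass at least 1 - kappa^2 sits, the inverse has eigenvalues at least rho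
    beta; on [S] its contribution is nonnegative. *)
Lemma rayleigh_inverse_ge (w : 'cV[R]_d) (S : pred 'I_d) (rho kappa : R) :
  norm2 w = 1 -> 0 <= rho ->
  (forall i, ~~ S i -> rho <= (l - lam) / (l - D 0 i)) ->
  norm2 (part S (Q^T *m w)) <= kappa ->
  rho * (1 - kappa ^+ 2) * beta <= dotv w (B *m w).
Proof.
move=> w1 rho0 Srho Sk; rewrite -(sdec_dotv ND) dotvE.
have low : norm2 (part S (Q^T *m w)) ^+ 2 <= kappa ^+ 2.
  by rewrite ler_exp ?norm2_ge0.
have := part_split S (Q^T *m w); rewrite (sdec_norm2 ND) w1 expr1n => tot.
have hi : 1 - kappa ^+ 2 <= norm2 (part (predC S) (Q^T *m w)) ^+ 2 by lra.
apply: (@le_trans _ _ (rho * beta * norm2 (part (predC S) (Q^T *m w)) ^+ 2)).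
  by rewrite mulrAC ler_wpM2l// mulr_ge0// invr_ge0 ltW.
rewrite part_norm2_sq big_distrr /= big_mkcond; apply: ler_sum => i _.
rewrite shift_inv_coord mulrA -expr2 mulrC; case: ifPn => [/= nSi|_].
  rewrite ler_wpM2l ?sqr_ge0//.
  by have := Srho _ nSi; rewrite /beta ler_pdivrMr// mulrC.
by rewrite mulr_ge0 ?sqr_ge0// invr_ge0 ltW.
Qed.

End InversePower.

Section AppxPCACorrect.
Local Open Scope ring_scope.
Context {R : realType} {d : nat}.
Variables (A : inv_method R d) (N Q : 'M[R]_d) (D : 'rV[R]_d) (w0 : 'cV[R]_d).
Variables (lam delta eps p : R).
Hypotheses (Ainv : approx_inversion A) (ND : sdec N Q D).
Hypotheses (D_le : forall i, D 0 i <= lam) (lam0 : 0 < lam) (lam1 : lam <= 1).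
Hypotheses (delta0 : 0 < delta) (delta_le : delta <= 1 / 2).
Hypotheses (eps0 : 0 < eps) (eps1 : eps < 1) (p0 : 0 < p) (p1 : p < 1) (d0 : (0 < d)%N).
Hypothesis (w01 : norm2 w0 = 1).

Local Notation c := (p / (2 * d%:R)).
Hypothesis ctop : c <= norm2 (part (fun i => D 0 i == lam) (Q^T *m w0)).

Ltac slra := have := lam0; have := lam1; have := delta0; have := delta_le;
  have := eps0; have := eps1; have := p0; have := p1; lra.

Let d1 : 1 <= d%:R :> R. Proof. by rewrite ler1n. Qed.
Let dR0 : 0 < d%:R :> R. Proof. by rewrite ltr0n. Qed.
Let c0 : 0 < c. Proof. by rewrite divr_gt0// mulr_gt0. Qed.

Local Notation m1 := (@pca_m1 R d p).
Local Notation m2 := (@pca_m2 R d eps p).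
Local Notation e1 := (@pca_eps1 R d delta p).
Local Notation e2 := (@pca_eps2 R d delta eps p).

Local Notation X1 := (288 * d%:R / p ^+ 2).
Local Notation X2 := (36 * d%:R / (p ^+ 2 * eps)).

Let p2 : p ^+ 2 < 1. Proof. by rewrite expr_lt1// ltW. Qed.
Let p20 : 0 < p ^+ 2. Proof. by rewrite exprn_gt0. Qed.

Let X1_gt1 : 1 < X1.
Proof. rewrite ltr_pdivlMr// mul1r; have := d1; have := p2; slra. Qed.

Let X2_gt1 : 1 < X2.
Proof.
have h : p ^+ 2 * eps < 1 by rewrite mulr_ilt1// ltW.
by rewrite ltr_pdivlMr ?mulr_gt0// mul1r; have := d1; slra.
Qed.

Let m1_gt0 : (0 < m1)%N.
Proof. by apply: absz_ceil_gt0; rewrite mulr_gt0// ln_gt0. Qed.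

Let m2_gt0 : (0 < m2)%N.
Proof. by apply: absz_ceil_gt0; rewrite ln_gt0. Qed.

(** The iteration counts contain p^2 where c contains p, namely 1/X1 = (c/144) p and 1/X2 = (c
    eps/18) p. The spare factor p < 1 is dropped and both constants are relaxed to 12. *)
Let weaken (x : R) m : (12 <= m)%N -> 0 <= x -> x / m%:R * p <= x / 12.
Proof.
move=> m12 x0; apply: (@le_trans _ _ (x / m%:R)).
  by rewrite ler_piMr ?divr_ge0// ltW.
by rewrite ler_wpM2l// lef_pV2 ?posrE ?ltr0n ?ler_nat// (leq_trans _ m12).
Qed.

Let pow_m1 : (3 / 4) ^+ m1 <= c / 12.
Proof.
apply: (@le_trans _ _ X1^-1).
  by apply: pow34_le; [exact: lt_trans X1_gt1|exact: le_absz_ceil].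
have -> : X1^-1 = c / 144 * p by field; rewrite ?gt_eqF.
by apply: weaken; rewrite ?ltW.
Qed.

Let pow_m2 : (1 / 3) ^+ m2 <= c * eps / 12.
Proof.
apply: (@le_trans _ _ X2^-1).
  by apply: pow13_le; [exact: lt_trans X2_gt1|exact: le_absz_ceil].
have -> : X2^-1 = c * eps / 18 * p by field; rewrite ?gt_eqF.
by apply: weaken; rewrite // mulr_ge0 ?ltW.
Qed.

Let e1_gt0 : 0 < e1.
Proof. by rewrite mulr_gt0 ?invr_gt0 ?mulr_gt0 ?ltr0n ?exprn_gt0 ?divr_gt0. Qed.

Let e2_gt0 : 0 < e2.
Proof. by rewrite mulr_gt0 ?divr_gt0 ?mulr_gt0 ?ltr0n ?exprn_gt0 ?divr_gt0. Qed.

Let e1_le : e1 <= 1 / 24.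
Proof.
have h1 : (64 * m1%:R)^-1 <= 1 / 2 :> R.
  rewrite mul1r lef_pV2 ?posrE ?mulr_gt0 ?ltr0n// -natrM ler_nat.
  by rewrite -[2%N]muln1 leq_mul.
have h2 : (delta / 6) ^+ m1 <= 1 / 12.
  rewrite -(prednK m1_gt0) exprS; apply: (@le_trans _ _ (delta / 6 * 1)); last by have := delta_le; lra.
  by apply: ler_wpM2l; [rewrite divr_ge0// ltW|apply: exprn_ile1; have := delta0; have := delta_le; lra].
have -> : 1 / 24 = (1 / 2) * (1 / 12) :> R by field.
by apply: ler_pM h1 h2; [rewrite invr_ge0 mulr_ge0|rewrite exprn_ge0// divr_ge0// ltW].
Qed.

(** The amplification turns (delta/6)^m of the query accuracy into (delta/4)^m, which is below
    (3/4)^m, and below (1/3)^m in [noise2]. Noise and damped low part thus obey the same bound. *)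
Let noise1 : e1 * m1%:R * (3 / 2) ^+ m1 <= c / 12.
Proof.
have -> : e1 * m1%:R * (3 / 2) ^+ m1 = (delta / 4) ^+ m1 / 64.
  have -> : delta / 4 = (delta / 6) * (3 / 2) by field.
  rewrite /pca_eps1 [(_ * (3 / 2)) ^+ _]exprMn.
  have : m1%:R != 0 :> R by rewrite pnatr_eq0 -lt0n m1_gt0.
  by move: (_ ^+ m1) (_ ^+ m1) => x y ?; field.
have dp : 0 <= delta / 4 by rewrite divr_ge0// ltW.
apply: le_trans pow_m1; apply: (@le_trans _ _ ((delta / 4) ^+ m1)).
  by rewrite ler_piMr ?exprn_ge0// invf_le1 ?ler1n.
by apply: ler_exp => //; have := delta_le; lra.
Qed.

Let noise2 : e2 * m2%:R * (3 / 2) ^+ m2 <= c * eps / 12.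
Proof.
have -> : e2 * m2%:R * (3 / 2) ^+ m2 = eps / 8 * (delta / 4) ^+ m2.
  have -> : delta / 4 = (delta / 6) * (3 / 2) by field.
  rewrite /pca_eps2 [(_ * (3 / 2)) ^+ _]exprMn.
  have : m2%:R != 0 :> R by rewrite pnatr_eq0 -lt0n m2_gt0.
  by move: (_ ^+ m2) (_ ^+ m2) => x y ?; field.
have dp : 0 <= delta / 4 by rewrite divr_ge0// ltW.
apply: le_trans pow_m2; apply: (@le_trans _ _ ((delta / 4) ^+ m2)).
  rewrite ler_piMl ?exprn_ge0//; have := eps1; lra.
by apply: ler_exp => //; have := delta_le; lra.
Qed.

Section Pass.
Variable l : R.
Hypotheses (lam_lt : lam < l) (gap_le : l - lam <= 3 / 2).

Let gap_gt0 : 0 < l - lam. Proof. by rewrite subr_gt0. Qed.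

(** The m_1 iterations leave mass at most (1/3)^2 on the eigenvalues whose damping factor is at most
    3/4, so the Rayleigh quotient of the inverse reveals the gap up to a factor 2. Subtracting the
    accuracy from it keeps the estimate on the safe side of 1/(l - lam). *)
Lemma pass_gap :
  [/\ inv_power A N w0 l e1 m1 != 0,
      dotv (pca_w A N delta p w0 l) (pca_v A N delta p w0 l) != e1 &
      (l - lam) / 2 <= pca_gap A N delta p w0 l <= l - lam].
Proof.
pose S : pred 'I_d := fun i => (l - lam) / (l - D 0 i) <= 3 / 4.
have := noise1; set nz := e1 * _ * _ => nzle.
have [] := @low_mass R d A N Q D w0 lam l Ainv ND D_le lam_lt gap_le S e1 c (3 / 4) (1 / 3) m1.
- exact: e1_gt0.
- exact: w01.
- lra.
- by [].
- exact: ctop.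
- apply: le_lt_trans nzle _; have := c0; lra.
- rewrite -/nz; move: c0 pow_m1 nzle; move: (nz) c ((3 / 4) ^+ m1) => x y z *; lra.
move=> y0 low; split => //.
  all: pose w := pca_w A N delta p w0 l; pose v := pca_v A N delta p w0 l.
  all: have w1 : norm2 w = 1 by exact: norm2_normalize.
  all: have ve : norm2 (v - invmx (l%:M - N) *m w) <= e1 by apply: Ainv; [exact: (shift_posdef ND D_le)|exact: e1_gt0].
  all: have up := rayleigh_inverse_le ND D_le lam_lt w1.
  all: have lo := @rayleigh_inverse_ge R d N Q D lam l ND D_le lam_lt w S (3 / 4) (1 / 3) w1.
  all: rewrite -/w -/v.
  all: have wv : `|dotv w v - dotv w (invmx (l%:M - N) *m w)| <= e1.
  1,3: rewrite -dotvBr; apply: le_trans (cauchy_schwarz _ _) _; by rewrite w1 mul1r.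
  all: have {}lo : 3 / 4 * (1 - (1 / 3) ^+ 2) * (l - lam)^-1 <= dotv w (invmx (l%:M - N) *m w).
  1,3: by apply: lo => // i; rewrite /S -ltNge => /ltW.
  all: move: wv up lo; set a := dotv w (_ *m _); set b := (l - lam)^-1.
  all: rewrite ler_norml => /andP[wv1 wv2] up lo.
  all: have bge : 2 / 3 <= b.
  1,3: by rewrite /b -[leLHS]invrK lef_pV2 ?posrE ?invr_gt0//; have := gap_le; lra.
  all: have e1le := e1_le; have e1gt := e1_gt0.
  (* The quotient retains 3/4 (1 - 1/9) = 2/3 of b. The accuracy e1 <= 1/24 is lost twice, once in
     the query and once by subtraction, which costs at most b/6 since b >= 2/3. *)
  all: have key : b / 2 <= dotv w v - e1 by lra.
  by rewrite -subr_eq0 gt_eqF//; lra.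
have kp : 0 < dotv w v - e1 by lra.
have key2 : dotv w v - e1 <= b by lra.
have -> : l - lam = b^-1 by rewrite /b invrK.
have b0 : 0 < b by lra.
rewrite /pca_gap -/w -/v -!invfM; apply/andP; split.
  by rewrite lef_pV2 ?posrE ?mulr_gt0//; lra.
by rewrite lef_pV2 ?posrE ?mulr_gt0//; lra.
Qed.

End Pass.

Local Notation shift s := (pca_shift A N delta p w0 s).

(** Half of an estimate lying between 1/2 and 1 times the distance is subtracted, so the distance is
    multiplied by a factor between 1/2 and 3/4 and stays positive. *)
Lemma shift_invariant s : 0 < shift s - lam <= (3 / 4) ^+ s * (3 / 2).
Proof.
elim: s => [|s /andP[IH1 IH2]]; first by rewrite /pca_shift /= expr0 mul1r; apply/andP; split; slra.
have le1 : (3 / 4) ^+ s <= 1 :> R by apply: exprn_ile1; slra.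
have [] := @pass_gap (shift s) _ _; [slra|slra|] => _ _ /andP[g1 g2].
have -> : shift s.+1 = shift s - pca_gap A N delta p w0 (shift s) / 2 by [].
rewrite exprS; slra.
Qed.

Lemma pass_bounds s :
  [/\ lam < shift s, shift s - lam <= 3 / 2 &
      (shift s - lam) / 2 <= pca_Delta A N delta p w0 s.+1 <= shift s - lam].
Proof.
have /andP[h1 h2] := shift_invariant s.
have le1 : (3 / 4) ^+ s <= 1 :> R by apply: exprn_ile1; slra.
have a : lam < shift s by slra.
have b : shift s - lam <= 3 / 2 by slra.
by have [_ _ h] := pass_gap a b; split.
Qed.

Lemma pca_defined_all s : pca_defined A N delta p w0 s.
Proof.
have [a b _] := pass_bounds s.-1; have [h1 h2 _] := pass_gap a b.
by split.
Qed.

(** The gap estimates tend to 0, while positivity of lam keeps the stopping threshold above delta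
    lam/3. *)
Lemma pca_stops : exists s, (0 < s)%N && pca_stop A N delta p w0 s.
Proof.
have h0 : 0 < delta * lam / 3 / (3 / 2) by have := mulr_gt0 delta0 lam0; lra.
have a34 : 0 <= (3 / 4 : R) < 1 by lra.
have [s hs] := expn_small a34 h0; exists s.+1; rewrite /pca_stop /=.
have [_ _ /andP[_ D1]] := pass_bounds s.
have /andP[_ h] := shift_invariant s.
have [h1 _ _] := pass_bounds s.+1.
apply: le_trans D1 _; apply: le_trans h _; rewrite -ler_pdivlMr//.
apply: le_trans hs _; rewrite ler_pM2r ?invr_gt0//.
by rewrite ler_pM2r ?invr_gt0// ler_pM2l// ltW.
Qed.

Lemma final_power f : (0 < f)%N -> pca_stop A N delta p w0 f ->
  inv_power A N w0 (shift f) e2 m2 != 0 /\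
  norm2 (part (fun i => D 0 i <= (1 - 3 / 2 * delta) * lam)
     (Q^T *m normalize (inv_power A N w0 (shift f) e2 m2))) <= eps.
Proof.
case: f => // f _ stop.
have [a b /andP[D1 D2]] := pass_bounds f.
have [a' b' _] := pass_bounds f.+1.
(* With g the new distance: the old one is at most twice the last estimate, so g is at most 3/2 of
   that estimate, hence at most delta (lam + g)/2 by the stopping rule. As delta <= 1/2, this
   resolves to g <= 2/3 delta lam. *)
have gap : shift f.+1 - lam <= 2 / 3 * (delta * lam).
  have E : shift f.+1 = shift f - pca_Delta A N delta p w0 f.+1 / 2 by [].
  move: stop; rewrite /pca_stop => st.
  have h : shift f.+1 - lam <= 3 / 2 * pca_Delta A N delta p w0 f.+1 by slra.
  have h2 : shift f.+1 - lam <= delta * shift f.+1 / 2 by slra.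
  have h3 : delta * (shift f.+1 - lam) <= 1 / 2 * (shift f.+1 - lam).
    by rewrite ler_wpM2r//; slra.
  slra.
have n2 := noise2; have ce := mulr_gt0 c0 eps0.
have ce1 : c * eps <= c by apply: ler_piMr; exact: ltW.
have c00 := c0; have pm2 := pow_m2.
apply: (@low_mass R d A N Q D w0 lam (shift f.+1) Ainv ND D_le a' b' _ e2 c (1 / 3) eps m2) => //.
(* The damping factor is at most (2/3)/(2/3 + 3/2) = 4/13, below the 1/3 for which m_2 is made. *)
- move=> i Di; have dl := mulr_gt0 delta0 lam0.
  have lD : 0 < shift f.+1 - D 0 i by rewrite subr_gt0; apply: le_lt_trans a'.
  rewrite ler_pdivrMr//; move: gap Di dl lD {n2 ce ce1 c00 pm2 stop D1 D2 b b'}.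
  by move: (shift f.+1) (D 0 i) (lam) (delta) a a' => x y z t *; lra.
- move: n2; set nz := e2 * _ * _ => n2; apply: le_lt_trans n2 _; move: ce1 ce c00 {pm2}; move: (c * eps) c => x y *; lra.
have n0 : 0 <= e2 * m2%:R * (3 / 2) ^+ m2 by rewrite !mulr_ge0 ?exprn_ge0 ?divr_ge0// ltW.
move: n0 n2 ce ce1 c00 pm2; set nz := e2 * _ * _; move: c nz (_ ^+ m2) => x nz y n0 n2 ce ce1 x0 pm2.
have h : eps * nz <= nz by apply: ler_piMl; rewrite // ltW.
rewrite mulrBr; lra.
Qed.

Theorem AppxPCA_correct :
  (exists w, AppxPCA_returns A N delta eps p w0 w) /\
  forall w, AppxPCA_returns A N delta eps p w0 w -> norm2 w = 1 /\
    norm2 (part (fun i => D 0 i <= (1 - 3 / 2 * delta) * lam) (Q^T *m w)) <= eps.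
Proof.
split.
  case: (ex_minnP pca_stops) => f /andP[f0 stop] fmin.
  exists (normalize (inv_power A N w0 (shift f) e2 m2)), f; split => //.
    move=> s /andP[s0 sf]; split; first exact: pca_defined_all.
    apply/idP/eqP => [ss|->//]; apply/eqP; rewrite eqn_leq sf.
    by apply: fmin; rewrite s0.
  exact: (final_power f0 stop).1.
move=> w [f [f0 h y0 ->]]; split; first exact: norm2_normalize.
have [_ st] := h f ltac:(by rewrite f0 leqnn).
by have [] := final_power f0 _; rewrite // st eqxx.
Qed.

End AppxPCACorrect.

(** * Deflation and eigenspaces *)

Section Columns.
Local Open Scope ring_scope.
Context {R : realType}.

Lemma colmx_tr_mul d n (s : seq 'cV[R]_d) x (r : 'I_n) :
  ((colmx n s)^T *m x) r 0 = dotv (nth 0 s r) x.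
Proof. by rewrite dotvE mxE; apply: eq_bigr => i _; rewrite !mxE. Qed.

Lemma colmx_gram d n (s : seq 'cV[R]_d) (i j : 'I_n) :
  ((colmx n s)^T *m colmx n s) i j = dotv (nth 0 s i) (nth 0 s j).
Proof. by rewrite dotvE mxE; apply: eq_bigr => l _; rewrite !mxE. Qed.

Lemma col_orthonormal_tr_le m n (V : 'M[R]_(m, n)) x :
  V^T *m V = 1%:M -> norm2 (V^T *m x) <= norm2 x.
Proof.
move=> VV; have [->|x0] := eqVneq (V^T *m x) 0; first by rewrite norm2_0 norm2_ge0.
rewrite -(ler_pM2l (x := norm2 (V^T *m x))) ?norm2_gt0//.
rewrite -expr2 norm2_sq dotv_mulr trmxK.
by apply: le_trans (dotv_le _ _) _; rewrite (norm2_isometry _ VV).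
Qed.

Lemma wide_mx_kernel m n (A : 'M[R]_(m, n)) : (m < n)%N ->
  exists2 x : 'cV[R]_n, x != 0 & A *m x = 0.
Proof.
move=> mn.
have K0 : kermx A^T != 0.
  rewrite -mxrank_eq0 mxrank_ker mxrank_tr -lt0n subn_gt0.
  exact: leq_ltn_trans (rank_leq_row A) mn.
have [i ri] : exists i, row i (kermx A^T) != 0.
  by apply/existsP; rewrite -negb_forall; apply: contra K0 => /forallP h;
     apply/eqP/row_matrixP => i; rewrite row0; exact/eqP.
exists (row i (kermx A^T))^T.
  by apply: contra_neq ri => /(congr1 trmx); rewrite trmxK trmx0.
by apply: trmx_inj; rewrite trmx_mul trmxK -row_mul mulmx_ker row0 trmx0.
Qed.

End Columns.

Section Deflation.
Local Open Scope ring_scope.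
Context {R : realType} {d : nat}.
Implicit Types (N : 'M[R]_d) (v x : 'cV[R]_d).

Definition defl N v : 'M[R]_d := (1%:M - v *m v^T) *m N *m (1%:M - v *m v^T).

Lemma proj_mulE v x : (1%:M - v *m v^T) *m x = x - dotv v x *: v.
Proof. by rewrite mulmxBl mul1mx mulmx_dotv. Qed.

Lemma proj_sym v : (1%:M - v *m v^T)^T = 1%:M - v *m v^T.
Proof. by rewrite linearB /= trmx1 trmx_mul trmxK. Qed.

Lemma defl_mulE N v x : dotv v x = 0 -> defl N v *m x = N *m x - dotv v (N *m x) *: v.
Proof. by move=> vx; rewrite /defl -!mulmxA (proj_mulE v x) vx scale0r subr0 proj_mulE. Qed.

Lemma defl_quad N v x : dotv x (defl N v *m x) =
  dotv ((1%:M - v *m v^T) *m x) (N *m ((1%:M - v *m v^T) *m x)).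
Proof. by rewrite /defl -!mulmxA dotv_mulr proj_sym. Qed.

Lemma defl_psd N v : psd N -> psd (defl N v).
Proof.
move=> [NT N0]; split; last by move=> x; rewrite defl_quad.
by rewrite /defl !trmx_mul proj_sym NT !mulmxA.
Qed.

Lemma defl_self N v : norm2 v = 1 -> defl N v *m v = 0.
Proof.
by move=> v1; rewrite /defl -!mulmxA (proj_mulE v v) -norm2_sq v1 expr1n scale1r subrr !mulmx0.
Qed.

Lemma proj_norm2 v x : norm2 v = 1 -> norm2 ((1%:M - v *m v^T) *m x) <= norm2 x.
Proof.
move=> v1; rewrite -(@ler_pXn2r _ 2) ?nnegrE ?norm2_ge0// proj_mulE.
have vv : dotv v v = 1 by rewrite -norm2_sq v1 expr1n.
rewrite !norm2_sq !(dotvBl, dotvBr, dotvZl, dotvZr) vv (dotvC x v).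
have := sqr_ge0 (dotv v x); rewrite expr2; lra.
Qed.

Lemma psd_norm_le N c : psd N -> 0 <= c ->
  (forall x, dotv x (N *m x) <= c * norm2 x ^+ 2) -> spectral_norm N <= c.
Proof.
move=> Np c0 h; have [Q [D ND]] := spectral_theorem Np.1.
apply: spectral_norm_le => // x; apply: (sdec_mul_norm _ ND) => // i.
by have := h (col i Q); rewrite (sdec_col_quad ND) (sdec_col_norm ND) expr1n mulr1.
Qed.

Lemma defl_norm N v : psd N -> norm2 v = 1 -> spectral_norm (defl N v) <= spectral_norm N.
Proof.
move=> Np v1; apply: psd_norm_le; [exact: defl_psd|exact: spectral_norm_ge0|] => x.
rewrite defl_quad; apply: le_trans (psd_quad_le _ _) _.
by rewrite ler_wpM2l ?spectral_norm_ge0// ler_exp ?norm2_ge0 ?proj_norm2.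
Qed.

(** Membership in the span of the eigenvectors with eigenvalue at most mu; [high] is its orthogonal
    complement. Vanishing coordinates replace projections. *)
Definition low (Q : 'M[R]_d) (D : 'rV[R]_d) (mu : R) x :=
  forall i, mu < D 0 i -> (Q^T *m x) i 0 = 0.

Definition high (Q : 'M[R]_d) (D : 'rV[R]_d) (mu : R) x :=
  forall i, D 0 i <= mu -> (Q^T *m x) i 0 = 0.

Lemma low_mul_norm N Q D mu x : sdec N Q D -> psd N -> 0 <= mu ->
  low Q D mu x -> norm2 (N *m x) <= mu * norm2 x.
Proof.
move=> ND Np mu0 lx.
rewrite -(@ler_pXn2r _ 2) ?nnegrE ?mulr_ge0 ?norm2_ge0// exprMn.
rewrite -(sdec_norm2 ND) -(sdec_norm2 ND x) !norm2_sqE big_distrr /=.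
apply: ler_sum => i _; rewrite (sdec_mulE ND).
have [Di|Di] := leP (D 0 i) mu; last by rewrite lx// mulr0 expr0n mulr0.
by rewrite exprMn ler_wpM2r ?sqr_ge0// ler_exp ?(sdec_ge0 ND Np).
Qed.

Lemma low_mul N Q D mu x : sdec N Q D -> low Q D mu x -> low Q D mu (N *m x).
Proof. by move=> ND lx i Di; rewrite (sdec_mulE ND) lx// mulr0. Qed.

(** On the high eigenspace N is invertible, with inverse of norm at most 1/mu: coordinates are
    divided by eigenvalues that exceed mu. *)
Lemma high_image N Q D mu z : sdec N Q D -> 0 < mu -> high Q D mu z ->
  exists w, [/\ high Q D mu w, N *m w = z & mu * norm2 w <= norm2 z].
Proof.
move=> ND mu0 hz; pose a : 'cV[R]_d := \col_i ((Q^T *m z) i 0 / D 0 i).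
have aE i : (Q^T *m (Q *m a)) i 0 = (Q^T *m z) i 0 / D 0 i.
  by rewrite (sdec_mulQ ND) mxE.
exists (Q *m a); split.
- by move=> i Di; rewrite aE hz// mul0r.
- apply: (sdec_inj ND); apply/colP => i; rewrite (sdec_mulE ND) aE.
  have [Di|Di] := leP (D 0 i) mu; first by rewrite hz// mul0r mulr0.
  by rewrite mulrCA divff ?mulr1// gt_eqF// (lt_trans mu0).
rewrite -(@ler_pXn2r _ 2) ?nnegrE ?mulr_ge0 ?norm2_ge0 ?(ltW mu0)// exprMn.
rewrite -(sdec_norm2 ND) -(sdec_norm2 ND z) !norm2_sqE big_distrr /=.
apply: ler_sum => i _; rewrite aE.
have [Di|Di] := leP (D 0 i) mu; first by rewrite hz// mul0r expr0n mulr0.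
have D0 := lt_trans mu0 Di.
rewrite exprMn mulrCA ler_piMr ?sqr_ge0// -exprMn exprn_ile1//.
  by rewrite mulr_ge0 ?invr_ge0 ?(ltW mu0) ?(ltW D0).
by rewrite ler_pdivrMr// mul1r ltW.
Qed.

(* Writing z = N' w, <x, z> = <N x, w> - <x, v><v, N w>: a bound kappa for the
   angle between the low space of N and the high space of N' improves to
   (kappa mu + e L) / mu', and the claimed bound is the fixed point. *)
Lemma gap_free_wedin N Q D Q' D' v mu mu' e L :
  psd N -> sdec N Q D -> sdec (defl N v) Q' D' -> norm2 v = 1 ->
  0 <= mu < mu' -> 0 <= e -> 0 <= L -> spectral_norm N <= L ->
  (forall x, low Q D mu x -> `|dotv v x| <= e * norm2 x) ->
  forall x z, low Q D mu x -> high Q' D' mu' z ->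
    `|dotv x z| <= e * L / (mu' - mu) * (norm2 x * norm2 z).
Proof.
move=> Np ND ND' v1 /andP[mu0 mumu'] e0 L0 NL ve x z lx hz.
have mu'0 : 0 < mu' by exact: le_lt_trans mumu'.
have gap : 0 < mu' - mu by rewrite subr_gt0.
pose a := mu / mu'; pose b := e * L / (mu' - mu).
have a0 : 0 <= a by rewrite divr_ge0// ltW.
have a1 : a < 1 by rewrite ltr_pdivrMr// mul1r.
have b0 : 0 <= b by rewrite divr_ge0 ?mulr_ge0// ltW.
(* v lies in the kernel of the symmetric matrix [defl N v], hence is orthogonal to its range. *)
have vhigh w : high Q' D' mu' w -> dotv v w = 0.
  move=> /(high_image ND' mu'0)[y [_ <- _]].
  by rewrite (sym_mxP _ _ (sdec_sym ND')) defl_self// dotv0l.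
(* The trivial bound 1 is improved n times; a^n is what remains of it, and b is reproduced because b
   = a b + e L/mu'. *)
have bound n : forall x z, low Q D mu x -> high Q' D' mu' z ->
    `|dotv x z| <= (a ^+ n + b) * (norm2 x * norm2 z).
  elim: n => [|n IH] {lx hz}x {}z lx hz.
    apply: le_trans (cauchy_schwarz _ _) _.
    by rewrite ler_peMl ?mulr_ge0 ?norm2_ge0// expr0 lerDl.
  have [w [hw <- wz]] := high_image ND' mu'0 hz.
  set zz := defl N v *m w in wz *.
  have zE : zz = N *m w - dotv v (N *m w) *: v by rewrite /zz defl_mulE// vhigh.
  rewrite {1}zE dotvBr dotvZr (sym_mxP _ _ Np.1).
  have h1 : `|dotv (N *m x) w| <= (a ^+ n + b) * (mu * norm2 x * norm2 w).
    apply: le_trans (IH _ _ (low_mul ND lx) hw) _.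
    apply: ler_wpM2l; first by rewrite addr_ge0 ?exprn_ge0.
    by rewrite ler_wpM2r ?norm2_ge0// (low_mul_norm ND).
  have h2 : `|dotv v (N *m w)| <= L * norm2 w.
    apply: le_trans (cauchy_schwarz _ _) _; rewrite v1 mul1r.
    apply: le_trans (spectral_norm_ub _ _) _; exact: ler_wpM2r (norm2_ge0 _) _ _ NL.
  have h3 : `|dotv v (N *m w) * dotv x v| <= L * norm2 w * (e * norm2 x).
    by rewrite normrM ler_pM// dotvC ve.
  apply: le_trans (ler_normB _ _) _; apply: le_trans (lerD h1 h3) _.
  have wz' : norm2 w <= norm2 zz / mu' by rewrite ler_pdivlMr// mulrC.
  have -> : (a ^+ n + b) * (mu * norm2 x * norm2 w) + L * norm2 w * (e * norm2 x) =
     ((a ^+ n + b) * mu + e * L) * norm2 x * norm2 w by ring.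
  apply: (@le_trans _ _ (((a ^+ n + b) * mu + e * L) * norm2 x * (norm2 zz / mu'))).
    by apply: ler_wpM2l wz'; rewrite mulr_ge0 ?norm2_ge0// addr_ge0 ?mulr_ge0// addr_ge0 ?exprn_ge0.
  rewrite le_eqVlt; apply/orP; left; apply/eqP.
  rewrite exprS /a /b; move: (norm2 x) (norm2 zz) ((mu / mu') ^+ n) => X Z Y.
  by field; rewrite !gt_eqF.
apply/ler_addgt0Pr => t t0.
pose K := norm2 x * norm2 z.
have K0 : 0 <= K by rewrite mulr_ge0 ?norm2_ge0.
have [n hn] : exists n, a ^+ n <= t / (K + 1).
  by apply: expn_small; rewrite ?a0 ?divr_gt0// ltr_wpDl.
apply: le_trans (bound n _ _ lx hz) _; rewrite mulrDl addrC lerD2l.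
apply: (@le_trans _ _ (t / (K + 1) * K)); first by rewrite ler_wpM2r.
by rewrite mulrAC ler_pdivrMr ?ltr_wpDl// ler_pM2l// lerDl.
Qed.

End Deflation.

(** * Successive deflations and the low eigenspace of M *)

Section Chain.
Local Open Scope ring_scope.
Context {R : realType} {d : nat}.
Variables (M : 'M[R]_d) (vs : seq 'cV[R]_d) (m : nat).
Local Notation v s := (nth 0 vs s).

(** The matrices M_s indexed by s, for inductions on s. They agree with [deflate] on prefixes by
    [deflateE], and with [compress] for orthonormal vectors by [compressE]. *)
Fixpoint deflated (s : nat) : 'M[R]_d :=
  if s is s'.+1 then defl (deflated s') (v s') else M.

Hypothesis M_psd : psd M.
Hypothesis v_orth : forall r s, (r < m)%N -> (s < m)%N -> dotv (v r) (v s) = (r == s)%:R.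

Let v_unit s : (s < m)%N -> norm2 (v s) = 1.
Proof.
move=> sm; apply/eqP; rewrite -(@eqrXn2 _ 2) ?norm2_ge0//.
by rewrite norm2_sq v_orth// eqxx expr1n.
Qed.

Lemma deflated_psd s : psd (deflated s).
Proof. by elim: s => //= s; exact: defl_psd. Qed.

Lemma deflated_kills r s : (r < s)%N -> (s <= m)%N -> deflated s *m v r = 0.
Proof.
elim: s => // s IH; rewrite ltnS leq_eqVlt => /orP[/eqP->|rs] sm /=.
  by rewrite defl_self// v_unit.
have vsr : dotv (v s) (v r) = 0 by rewrite v_orth ?gtn_eqF// (ltn_trans rs).
by rewrite defl_mulE// IH ?(ltnW sm)// dotv0r scale0r subr0.
Qed.

Lemma deflated_norm s t : (s <= t)%N -> (t <= m)%N ->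
  spectral_norm (deflated t) <= spectral_norm (deflated s).
Proof.
move=> + tm; elim: t tm => [|t IH] tm; first by rewrite leqn0 => /eqP->.
rewrite leq_eqVlt => /orP[/eqP->//|st]; apply: le_trans (IH (ltnW tm) st).
by apply: defl_norm; [exact: deflated_psd|exact: v_unit].
Qed.

Lemma deflated_mul s x y :
  (forall r, (r < s)%N -> dotv (v r) x = 0) -> (forall r, (r < s)%N -> dotv (v r) y = 0) ->
  dotv x (deflated s *m y) = dotv x (M *m y).
Proof.
elim: s => [//|s IH] vx vy /=.
rewrite defl_mulE ?vy// dotvBr dotvZr (dotvC x (v s)) vx// mulr0 subr0.
by apply: IH => r rs; [apply: vx|apply: vy]; exact: ltnW.
Qed.

(** v_r lies in the kernel of M_s, so it has no component on eigenvectors with positive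
    eigenvalue. *)
Lemma high_orth s r y nu Q D : sdec (deflated s) Q D ->
  (s <= m)%N -> (r < s)%N -> 0 <= nu -> high Q D nu y -> dotv (v r) y = 0.
Proof.
move=> ND sm rs nu0 hy; rewrite -(sdec_dotv ND) dotvE big1// => i _.
have [Di|Di] := leP (D 0 i) nu; first by rewrite hy// mulr0.
suff : D 0 i * (Q^T *m v r) i 0 = 0.
  by move/eqP; rewrite mulf_eq0 gt_eqF ?(le_lt_trans nu0)//= => /eqP ->; rewrite mul0r.
by rewrite -(sdec_mulE ND) deflated_kills// mulmx0 mxE.
Qed.

Variables (Qs : nat -> 'M[R]_d) (Ds : nat -> 'rV[R]_d) (delta e : R).
Hypothesis QDs : forall s, sdec (deflated s) (Qs s) (Ds s).
Hypotheses (m0 : (0 < m)%N) (delta01 : 0 < delta < 1) (e0 : 0 <= e).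

Let L := spectral_norm (deflated m.-1).
Let L1 := spectral_norm M.

Hypothesis L0 : 0 < L.
Hypothesis v_mass : forall s, (s < m)%N ->
  norm2 (part (fun i => Ds s 0 i <= (1 - 3 / 4 * delta) * spectral_norm (deflated s))
              ((Qs s)^T *m v s)) <= e.

(** The thresholds rise from (1 - delta) L to (1 - 3/4 delta) L in m equal steps. The norms of the
    M_s decrease, so L is the least of those with s < m and every threshold stays in the range where
    the mass of v_s is controlled. [eta] is the loss of one deflation: e for the component along
    v_s, e L1/step for leaving the low space. *)
Let step := delta * L / (4 * m%:R).
Let mu s := (1 - delta) * L + s%:R * step.
Let eta := e + e * L1 / step.

Let mR : 0 < m%:R :> R. Proof. by rewrite ltr0n. Qed.
Let step_gt0 : 0 < step.
Proof. by case/andP: delta01 => ? ?; rewrite divr_gt0 ?mulr_gt0. Qed.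
Let mu_ge0 s : 0 <= mu s.
Proof.
have /andP[_ d1] := delta01; have Lge := ltW L0.
by rewrite /mu addr_ge0// mulr_ge0// ?subr_ge0 ltW.
Qed.

(** In each deflation the component along v_s is removed, then the part above the next threshold.
    The first is small because the current vector is low and v_s is nearly orthogonal to low
    vectors; the second by [gap_free_wedin], with [step] as gap. *)
Lemma chain x s : (s <= m)%N -> low (Qs 0) (Ds 0) ((1 - delta) * L) x ->
  exists y, [/\ forall r, (r < s)%N -> dotv (v r) y = 0,
    low (Qs s) (Ds s) (mu s) y, norm2 y <= norm2 x &
    norm2 (x - y) <= s%:R * eta * norm2 x].
Proof.
move=> + lx; elim: s => [|s IH] sm.
  exists x; split=> //; last by rewrite subrr norm2_0 mulr0n !mul0r.
  rewrite /mu mulr0n mul0r addr0; exact: lx.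
have [y [vy ly yx xy]] := IH (ltnW sm).
have stp := step_gt0; have eta0 : 0 <= e * L1 / step.
  by apply: divr_ge0; [apply: mulr_ge0 => //; exact: spectral_norm_ge0|exact: ltW].
have muS : mu s.+1 - mu s = step by rewrite /mu -[s.+1%:R]natr1; ring.
have mum : mu s <= (1 - 3 / 4 * delta) * spectral_norm (deflated s).
  apply: (@le_trans _ _ ((1 - 3 / 4 * delta) * L)).
    have h : s%:R * step <= m%:R * step by apply: ler_wpM2r; [exact: ltW|rewrite ler_nat ltnW].
    have h2 : m%:R * step = delta * L / 4 by rewrite /step; field; rewrite gt_eqF.
    rewrite /mu; lra.
  rewrite ler_wpM2l//; first by have /andP[] := delta01; lra.
  by apply: deflated_norm => //; [rewrite -ltnS prednK|exact: leq_pred].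
have v_low z : low (Qs s) (Ds s) (mu s) z -> `|dotv (v s) z| <= e * norm2 z.
  move=> lz; pose S i := Ds s 0 i <= (1 - 3 / 4 * delta) * spectral_norm (deflated s).
  have -> : dotv (v s) z = dotv (part S ((Qs s)^T *m v s)) ((Qs s)^T *m z).
    rewrite -(sdec_dotv (QDs s)) !dotvE; apply: eq_bigr => i _; rewrite [part _ _ _ _]mxE.
    by case: ifPn => //; rewrite -ltNge => Si; rewrite lz ?mulr0// (le_lt_trans mum).
  apply: le_trans (cauchy_schwarz _ _) _; rewrite (sdec_norm2 (QDs s)).
  by rewrite ler_wpM2r ?norm2_ge0// v_mass.
have wed := gap_free_wedin (deflated_psd s) (QDs s) (QDs s.+1 : sdec (defl _ _) _ _) (v_unit sm)
  (mu' := mu s.+1) _ e0 (spectral_norm_ge0 _) (deflated_norm (leq0n s) (ltnW sm)) v_low.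
rewrite muS in wed.
pose y1 := y - dotv (v s) y *: v s.
pose Q := Qs s.+1; pose D := Ds s.+1.
pose S i := D 0 i <= mu s.+1.
pose y' := Q *m part S (Q^T *m y1); pose z := Q *m part (predC S) (Q^T *m y1).
have y1E : y1 = y' + z.
  apply: (sdec_inj (QDs s.+1)); rewrite mulmxDr !(sdec_mulQ (QDs s.+1)).
  by apply/colP => i; rewrite [RHS]mxE ![part _ _ _ _]mxE /=; case: (S i); rewrite ?addr0 ?add0r.
have ly' : low Q D (mu s.+1) y'.
  by move=> i Di; rewrite (sdec_mulQ (QDs s.+1)) mxE /S leNgt Di.
have hz : high Q D (mu s.+1) z.
  by move=> i Di; rewrite (sdec_mulQ (QDs s.+1)) mxE /= /S Di.
have vz r : (r < s.+1)%N -> dotv (v r) z = 0.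
  by move=> rs; exact: (high_orth (QDs s.+1) sm rs (mu_ge0 _) hz).
have vy1 r : (r < s.+1)%N -> dotv (v r) y1 = 0.
  rewrite ltnS leq_eqVlt dotvBr dotvZr => /orP[/eqP->|rs].
    by rewrite v_orth// eqxx mulr1 subrr.
  by rewrite vy// v_orth ?(ltn_trans rs)// ltn_eqF// mulr0 subr0.
(* z is orthogonal to v_s and to the low part y', so |z|^2 = <y, z>, an inner product of a low
   vector of M_s and a high vector of M_(s+1). *)
have zz : norm2 z <= e * L1 / step * norm2 y.
  have [->|z0] := eqVneq z 0; first by rewrite norm2_0 mulr_ge0// norm2_ge0.
  rewrite -(ler_pM2r (x := norm2 z)) ?norm2_gt0// -expr2 norm2_sq.
  have -> : dotv z z = dotv y z.
    have -> : dotv y z = dotv y1 z by rewrite dotvBl dotvZl vz// mulr0 subr0.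
    rewrite y1E dotvDl -(sdec_dotv (QDs s.+1) y') -[LHS]add0r; congr (_ + _).
    rewrite dotvE big1// => i _.
    have [Di|Di] := leP (D 0 i) (mu s.+1); first by rewrite [X in _ * X]hz// mulr0.
    by rewrite [X in X * _]ly'// mul0r.
  apply: le_trans (ler_norm _) _; rewrite -[_ * norm2 y * norm2 z]mulrA; apply: wed => //.
  by rewrite mu_ge0 -subr_gt0 muS.
have y1y : norm2 y1 <= norm2 y by rewrite /y1 -proj_mulE proj_norm2// v_unit.
exists y'; split.
- by move=> r rs; have := vy1 r rs; rewrite y1E dotvDr vz// addr0.
- exact: ly'.
- apply: le_trans yx; apply: le_trans y1y.
  rewrite (norm2_isometry _ (QDs s.+1).1); apply: le_trans (part_norm2 _ _) _.
  by rewrite (sdec_norm2 (QDs s.+1)).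
have -> : x - y' = (x - y) + (dotv (v s) y *: v s + z).
  by rewrite -[y'](addrK z) -y1E /y1; apply/colP => i; rewrite !mxE; ring.
apply: le_trans (norm2D _ _) _; rewrite -[s.+1%:R]natr1 !mulrDl mul1r.
apply: lerD xy _; apply: le_trans (norm2D _ _) _.
rewrite norm2Z v_unit// mulr1 /eta mulrDl; apply: lerD.
  by apply: le_trans (v_low _ ly) _; rewrite ler_wpM2l.
by apply: le_trans zz _; rewrite ler_wpM2l.
Qed.

(** The vector y that [chain] ends with is orthogonal to all v_r, so V^T x = V^T (x - y), and V^T
    does not increase norms. *)
Theorem deflation_low_space x : low (Qs 0) (Ds 0) ((1 - delta) * L) x ->
  norm2 ((colmx m vs)^T *m x) <= m%:R * (e + e * L1 * (4 * m%:R) / (delta * L)) * norm2 x.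
Proof.
move=> /(chain (leqnn m))[y [vy _ _ xy]].
have Vy : (colmx m vs)^T *m y = 0.
  by apply/colP => i; rewrite colmx_tr_mul vy// mxE.
have -> : (colmx m vs)^T *m x = (colmx m vs)^T *m (x - y) by rewrite mulmxBr Vy subr0.
apply: (@le_trans _ _ (norm2 (x - y))).
  apply: col_orthonormal_tr_le; apply/matrixP => i j.
  by rewrite colmx_gram v_orth// mxE.
have -> : e * L1 * (4 * m%:R) / (delta * L) = e * L1 / step.
  by rewrite /step invf_div [RHS]mulrA.
exact: xy.
Qed.

End Chain.

(** * Spectra of the deflated matrices *)

Section Counting.
Local Open Scope ring_scope.
Context {R : realType} {d : nat}.

Definition above (D : 'rV[R]_d) (theta : R) : {set 'I_d} :=
  finset (fun i => theta < D 0 i).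

Lemma in_above D theta i : (i \in above D theta) = (theta < D 0 i).
Proof. by rewrite inE. Qed.

Lemma col_mx_neq0 m n (z : 'cV[R]_(m + n)) : z != 0 ->
  (usubmx z != 0) || (dsubmx z != 0).
Proof.
apply: contra_neqT; rewrite negb_or !negbK => /andP[/eqP z1 /eqP z2].
by rewrite -[z]vsubmxK z1 z2 col_mx0.
Qed.

(** A dimension count: [#|S| + k] unknowns against n linear equations. Nonvanishing is asserted for
    the pair (y, b), since y + V b may be 0. *)
Lemma codim_combo k n (Q U : 'M[R]_d) (S : {set 'I_d}) (V : 'M[R]_(d, k)) :
  Q^T *m Q = 1%:M -> (n < #|S| + k)%N -> exists (y : 'cV[R]_d) (b : 'cV[R]_k),
  [/\ forall i, i \notin S -> (Q^T *m y) i 0 = 0, (y != 0) || (b != 0) &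
      forall j : 'I_d, (j < n)%N -> (U^T *m (y + V *m b)) j 0 = 0].
Proof.
move=> QQ nS.
pose W : 'M[R]_(d, #|S|) := \matrix_(i, j) Q i (enum_val j).
have WW : W^T *m W = 1%:M.
  apply/matrixP => i j; rewrite mxE.
  have /matrixP/(_ (enum_val i) (enum_val j)) := QQ; rewrite !mxE.
  rewrite (inj_eq enum_val_inj) => <-; apply: eq_bigr => l _; by rewrite !mxE.
(* The first n columns of U as rows; [insub] converts an index below n into one below d, with zero
   rows as padding. *)
pose C : 'M[R]_(n, d) := \matrix_(i, j) (if insub (nat_of_ord i) is Some i' then U j i' else 0).
have [z z0 Cz] := wide_mx_kernel (C *m row_mx W V) nS.
exists (W *m usubmx z), (dsubmx z); split.
- move=> i iS; rewrite mulmxA mxE big1// => j _; rewrite mxE.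
  have -> : \sum_l Q^T i l * W l j = (Q^T *m Q) i (enum_val j).
    by rewrite [RHS]mxE; apply: eq_bigr => l _; rewrite !mxE.
  rewrite QQ mxE; case: eqP => [E|_]; last by rewrite mul0r.
  by move: iS; rewrite E enum_valP.
- case/orP: (col_mx_neq0 z0) => h; last by rewrite h orbT.
  by rewrite -norm2_eq0 (norm2_isometry _ WW) norm2_eq0 h.
move=> j jn; have /colP/(_ (Ordinal jn)) := Cz.
rewrite -[z in LHS]vsubmxK -mulmxA mul_row_col mxE [RHS]mxE => <-.
rewrite mxE; apply: eq_bigr => i _; rewrite !mxE insubT//= => jd; congr (U _ _ * _); exact: val_inj.
Qed.

End Counting.

(** * Schatten norms through counting functions of eigenvalues *)

Section Schatten.
Local Open Scope ring_scope.
Context {R : realType} {d : nat}.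
Implicit Types (N Q : 'M[R]_d) (D : 'rV[R]_d).

Lemma char_poly_orthogonal N Q : Q^T *m Q = 1%:M -> char_poly (Q *m N *m Q^T) = char_poly N.
Proof.
move=> QQ; pose P := map_mx polyC Q; pose P' := map_mx polyC Q^T.
have PP : P *m P' = 1%:M by rewrite -map_mxM (orthogonal_left QQ) map_mx1.
have PP' : \det P * \det P' = 1 by rewrite -det_mulmx PP det1.
have E : char_poly_mx (Q *m N *m Q^T) = P *m char_poly_mx N *m P'.
  rewrite /char_poly_mx mulmxBr mulmxBl !map_mxM mul_mx_scalar -scalemxAl PP.
  by rewrite scalemx1.
by rewrite /char_poly E !det_mulmx mulrAC PP' mul1r.
Qed.

Lemma char_poly_diag D : char_poly (diag_mx D) = \prod_(i < d) ('X - (D 0 i)%:P).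
Proof.
rewrite char_poly_trig; last exact: diag_mx_is_trig.
by apply: eq_bigr => i _; rewrite mxE eqxx mulr1n.
Qed.

(** The list chosen by [xget] is unknown, but unique factorization of the characteristic polynomial
    makes it a permutation of the squared eigenvalues, whose roots are the eigenvalues as these are
    nonnegative. *)
Lemma singular_values_sum N Q D (f : R -> R) : sdec N Q D -> psd N ->
  \sum_(x <- singular_values N) f x = \sum_(i < d) f (D 0 i).
Proof.
move=> ND Np; rewrite /singular_values.
set S := [set s | _]%classic.
have SE : S [seq D 0 i ^+ 2 | i <- enum 'I_d].
  rewrite /S /= big_map big_enum /=.
  have -> : N^T *m N = Q *m diag_mx (\row_i (D 0 i ^+ 2)) *m Q^T.
    rewrite (sdec_sym ND) {1}ND.2 -!mulmxA; congr (_ *m _).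
    rewrite {1}ND.2 !mulmxA; congr (_ *m _).
    rewrite -[diag_mx D *m Q^T *m Q]mulmxA ND.1 mulmx1.
    apply/matrixP => i j; rewrite mul_diag_mx !mxE.
    by case: (i == j); rewrite ?mulr1n ?expr2// !mulr0n mulr0.
  rewrite char_poly_orthogonal ?char_poly_diag; last exact: ND.1.
  by apply: eq_bigr => i _; rewrite mxE.
have Sx : S (xget [::] S) by apply: (@xgetPex _ [::] S); exists [seq D 0 i ^+ 2 | i <- enum 'I_d].
have /prod_XsubC_eq pe : \prod_(x <- xget [::] S) ('X - x%:P) =
   \prod_(x <- [seq D 0 i ^+ 2 | i <- enum 'I_d]) ('X - x%:P).
  by rewrite -Sx -SE.
rewrite big_map (perm_big _ pe) big_map big_enum /=.
by apply: eq_bigr => i _; rewrite sqrtr_sqr ger0_norm// (sdec_ge0 ND).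
Qed.

(** Sort the eigenvalues decreasingly, counting positions from 0. If the one at position j exceeded
    theta j, so would all before it, which makes j + 1 of them. *)
Lemma sum_by_counting D (f : R -> R) (theta : nat -> R) :
  (forall x y, 0 <= x -> x <= y -> f x <= f y) -> (forall i, 0 <= D 0 i) ->
  (forall j, (j < d)%N -> (#|above D (theta j)| <= j)%N) ->
  \sum_(i < d) f (D 0 i) <= \sum_(0 <= j < d) f (theta j).
Proof.
move=> fmono D0 cnt.
pose s0 := [seq D 0 i | i <- enum 'I_d]; pose s := sort >=%R s0.
have ss : size s = d by rewrite size_sort size_map size_enum_ord.
have ps : perm_eq s0 s by rewrite perm_sym; apply/permPl/perm_sort.
have -> : \sum_(i < d) f (D 0 i) = \sum_(x <- s) f x.
  by rewrite -(perm_big _ ps) /= big_map big_enum.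
rewrite (big_nth 0) ss big_nat [leRHS]big_nat; apply: ler_sum => j /= jd.
have sj : nth 0 s j \in s0 by rewrite (perm_mem ps) mem_nth// ss.
apply: fmono; first by have /mapP[i _ ->] := sj.
rewrite leNgt; apply/negP => big.
have srt : sorted >=%R s by apply: sort_sorted => x y; exact: ge_total.
have c1 : count (fun x => theta j < x) s = #|above D (theta j)|.
  have /permP -> : perm_eq s s0 by rewrite perm_sym.
  rewrite -sum1_count big_map big_enum_cond /= sum1_card.
  by apply: eq_card => i; rewrite in_above.
have all_big : all (fun x => theta j < x) (take j.+1 s).
  apply/(all_nthP 0) => i; rewrite size_take ss => ij.
  have {}ij : (i < j.+1)%N by move: ij; case: ifP => // /negbT; rewrite -leqNgt => dj /leq_trans; exact.
  rewrite nth_take//; apply: lt_le_trans big _.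
  have tr : transitive (>=%R : rel R) by move=> x y z xy yz; exact: le_trans yz xy.
  have rf : reflexive (>=%R : rel R) by move=> x; exact: lexx.
  by apply: (sorted_leq_nth tr rf 0 srt); rewrite ?unfold_in /= ?ss// (leq_ltn_trans _ jd).
have : leq j.+1 (count (fun x => theta j < x) s).
  rewrite -(cat_take_drop j.+1 s) count_cat.
  move: all_big; rewrite all_count => /eqP ->.
  have -> : size (take j.+1 s) = j.+1 by apply: size_takel; rewrite ss.
  exact: leq_addr.
by rewrite c1 ltnNge cnt.
Qed.

(** Minkowski's inequality in the needed form, from convexity of the q-th power: A l_i + c is the
    convex combination of (A + B) l_i and ((A + B)/B) c with weights A/(A + B) and B/(A + B). *)
Lemma powR_affine_sum (m n : nat) (l : nat -> R) (q A B c L : R) :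
  1 <= q -> 0 < A -> 0 < B -> 0 <= c -> (forall i, 0 <= l i) -> 0 <= L ->
  \sum_(m <= i < n) l i `^ q <= L `^ q -> \sum_(m <= i < n) c `^ q <= (B * L) `^ q ->
  \sum_(m <= i < n) (A * l i + c) `^ q <= ((A + B) * L) `^ q.
Proof.
move=> q1 A0 B0 c0 l0 L0 hl hc.
have AB : 0 < A + B by rewrite addr_gt0.
pose t := A / (A + B).
have t0 : 0 <= t by rewrite divr_ge0// ltW.
have t1 : t <= 1 by rewrite ler_pdivrMr// mul1r lerDl ltW.
have tB : 1 - t = B / (A + B) by rewrite /t; field; rewrite gt_eqF.
have cvx x y : 0 <= x -> 0 <= y -> (t * x + (1 - t) * y) `^ q <= t * x `^ q + (1 - t) * y `^ q.
  move=> x0 y0; apply: (convex_powR q1 (Itv01 t0 t1)) => /=; by rewrite inE/= in_itv/= ?x0 ?y0.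
have term i : (A * l i + c) `^ q <=
    t * (A + B) `^ q * l i `^ q + (1 - t) * ((A + B) / B) `^ q * c `^ q.
  have -> : A * l i + c = t * ((A + B) * l i) + (1 - t) * ((A + B) / B * c).
    by rewrite tB /t; field; rewrite !gt_eqF.
  apply: le_trans (cvx _ _ _ _) _; rewrite ?mulr_ge0 ?invr_ge0 ?(ltW AB) ?(ltW B0)//.
  by rewrite !powRM ?mulr_ge0 ?invr_ge0 ?(ltW AB) ?(ltW B0)// !mulrA.
apply: le_trans (ler_sum _ (fun i _ => term i)) _.
rewrite big_split /= -!big_distrr /=.
have -> : ((A + B) * L) `^ q = t * (A + B) `^ q * L `^ q + (1 - t) * ((A + B) / B) `^ q * (B * L) `^ q.
  rewrite -[(1 - t) * _ * _]mulrA -[in RHS]powRM ?mulr_ge0 ?invr_ge0 ?(ltW AB) ?(ltW B0)//.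
  have -> : (A + B) / B * (B * L) = (A + B) * L by field; rewrite gt_eqF.
  by rewrite powRM ?(ltW AB)//; ring.
apply: lerD; apply: ler_wpM2l => //; rewrite mulr_ge0 ?powR_ge0// subr_ge0.
exact: t1.
Qed.

End Schatten.

(** * The properties (a) to (d) for a fixed output; [l i] is lambda_(i+1) *)

Section LazySVDAnalysis.
Local Open Scope ring_scope.
Context {R : realType} {d : nat}.
Variables (M U : 'M[R]_d) (l : nat -> R) (vs : seq 'cV[R]_d) (k : nat).
Local Notation v s := (nth 0 vs s).
Local Notation lam := (\row_(i < d) l i).
Local Notation N s := (deflated M vs s).

Hypothesis M_psd : psd M.
Hypothesis MU : sdec M U lam.
Hypothesis l_le : forall i j, (i <= j)%N -> l j <= l i.
Hypothesis l_ge0 : forall i, 0 <= l i.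
Hypothesis l_out : forall i, (d <= i)%N -> l i = 0.
Hypothesis v_orth : forall r s, (r < k)%N -> (s < k)%N -> dotv (v r) (v s) = (r == s)%:R.
Hypothesis k_le : (k <= d)%N.

Let gram m : (m <= k)%N -> (colmx m vs)^T *m colmx m vs = 1%:M.
Proof.
move=> mk; apply/matrixP => i j.
by rewrite colmx_gram v_orth ?mxE// (leq_trans _ mk).
Qed.

Let lt_d i : 0 < l i -> (i < d)%N.
Proof. by move=> li; rewrite ltnNge; apply/negP => /l_out E; rewrite E ltxx in li. Qed.

Lemma spectral_norm_top : spectral_norm M <= l 0.
Proof.
apply: spectral_norm_le => // x; apply: (sdec_mul_norm _ MU) => // i.
by rewrite mxE l_le.
Qed.

Lemma deflated_quad m (x : 'cV[R]_d) : (colmx m vs)^T *m x = 0 ->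
  dotv x (N m *m x) = dotv x (M *m x).
Proof.
move=> Vx; have vx r : (r < m)%N -> dotv (v r) x = 0.
  by move=> rm; rewrite -(colmx_tr_mul _ _ (Ordinal rm)) Vx mxE.
exact: deflated_mul.
Qed.

(** The m + 1 leading eigenvectors of M span a nonzero vector orthogonal to v_0, ..., v_(m-1); there
    M_m and M have the same quadratic form. *)
Lemma courant_fischer_lower m : l m <= spectral_norm (N m).
Proof.
have [dm|md] := leqP d m; first by rewrite l_out// spectral_norm_ge0.
pose U1 : 'M[R]_(d, m.+1) := \matrix_(i, j) U i (widen_ord md j).
have [a a0 Va] := wide_mx_kernel ((colmx m vs)^T *m U1) (ltnSn m).
pose x := U1 *m a; have Vx : (colmx m vs)^T *m x = 0 by rewrite mulmxA.
have U1c (j : 'I_d) (i : 'I_m.+1) : (U^T *m U1) j i = (j == widen_ord md i)%:R.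
  have /matrixP/(_ j (widen_ord md i)) := MU.1; rewrite !mxE => <-.
  by apply: eq_bigr => h _; rewrite !mxE.
have xlow (j : 'I_d) : (m < j)%N -> (U^T *m x) j 0 = 0.
  move=> mj; rewrite mulmxA mxE big1// => i _; rewrite U1c.
  case: eqP => [E|_]; last by rewrite mul0r.
  by move: mj; rewrite E /= ltnNge -ltnS ltn_ord.
have U1U1 : U1^T *m U1 = 1%:M.
  apply/matrixP => i j; rewrite [RHS]mxE.
  have := U1c (widen_ord md i) j; rewrite !mxE => E.
  have -> : (i == j) = (widen_ord md i == widen_ord md j) by rewrite -!val_eqE.
  by rewrite -E; apply: eq_bigr => h _; rewrite !mxE.
have x0 : 0 < norm2 x by rewrite (norm2_isometry _ U1U1) norm2_gt0.
rewrite -(ler_pM2r (x := norm2 x ^+ 2)) ?exprn_gt0//.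
apply: le_trans (psd_quad_le _ _).
rewrite deflated_quad// (sdec_quad MU) -(sdec_norm2 MU) norm2_sqE big_distrr /=.
apply: ler_sum => j _; rewrite [lam _ _]mxE.
have [jm|mj] := leqP j m; first by rewrite ler_wpM2r ?sqr_ge0 ?l_le.
by rewrite xlow// expr0n !mulr0.
Qed.

Let high_tr m Q D y : (m <= k)%N -> sdec (N m) Q D -> high Q D 0 y ->
  (colmx m vs)^T *m y = 0.
Proof.
move=> mk ND hy; apply/colP => r; rewrite colmx_tr_mul [RHS]mxE.
exact: (high_orth v_orth ND mk (ltn_ord r) (lexx 0) hy).
Qed.

(** Eigenvectors of M_m with positive eigenvalue are orthogonal to the m vectors v_r, so together
    they are linearly independent. *)
Lemma count_positive m Q D : (m <= k)%N -> sdec (N m) Q D ->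
  (#|above D 0| + m <= d)%N.
Proof.
move=> mk ND; rewrite leqNgt; apply/negP => h.
have [y [b [yS yb0 yb]]] := codim_combo 1%:M (colmx m vs) ND.1 h.
have hz : y + colmx m vs *m b = 0.
  by apply/colP => j; have := yb j (ltn_ord j); rewrite trmx1 mul1mx => ->; rewrite mxE.
have vy : (colmx m vs)^T *m y = 0.
  by apply: (high_tr mk ND) => i Di; apply: yS; rewrite in_above -leNgt.
have b0 : b = 0.
  have := congr1 (mulmx (colmx m vs)^T) hz.
  by rewrite mulmxDr vy add0r mulmxA gram// mul1mx mulmx0.
by move: hz yb0; rewrite b0 mulmx0 addr0 => ->; rewrite !eqxx.
Qed.

(* Some nonzero h = y + V b, with y in the top eigenspace of N_m, is orthogonal
   to u_0, ..., u_(n-1); then |b| = |V^T h| <= E |h|, and comparing y^T M y with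
   h^T M h bounds the eigenvalues of N_m on that eigenspace. *)
Lemma count_large m n Q D theta E : (m <= k)%N -> (n < d)%N -> sdec (N m) Q D ->
  0 <= E < 1 -> 0 <= theta ->
  (forall h, low U lam (l n) h -> norm2 ((colmx m vs)^T *m h) <= E * norm2 h) ->
  l n * (1 + 2 * E) + l 0 * E ^+ 2 <= theta * (1 - E ^+ 2) ->
  (#|above D theta| + m <= n)%N.
Proof.
move=> mk nd ND /andP[E0 E1] t0 hE key; rewrite leqNgt; apply/negP => big.
have [y [b [yS yb0 yb]]] := codim_combo U (colmx m vs) ND.1 big.
set V := colmx m vs in hE yb; set h := y + V *m b in yb.
have VV : V^T *m V = 1%:M by exact: gram.
have yhigh : high Q D theta y by move=> i Di; apply: yS; rewrite in_above -leNgt.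
have Vy : V^T *m y = 0.
  by apply: (high_tr mk ND) => i Di; apply: yhigh; exact: le_trans t0.
have Vh : V^T *m h = b by rewrite mulmxDr Vy add0r mulmxA VV mul1mx.
have hlow : low U lam (l n) h.
  move=> i; rewrite mxE => li; apply: yb; rewrite ltnNge; apply/negP => /l_le.
  by rewrite leNgt li.
have bE : norm2 b <= E * norm2 h by rewrite -Vh; exact: hE.
have hsq : norm2 h ^+ 2 = norm2 y ^+ 2 + norm2 b ^+ 2.
  rewrite !norm2_sq /h dotvDl !dotvDr (dotvC (V *m b) y) !(dotv_mulr V) Vy dotv0l.
  by rewrite -(dotv_mulr V) dotv_isometry// addr0 add0r.
have h0 : 0 < norm2 h.
  rewrite norm2_gt0; apply: contraTneq yb0 => hz; rewrite negb_or !negbK.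
  move: hsq; rewrite hz norm2_0 expr0n /= => /esym/eqP.
  by rewrite paddr_eq0 ?sqr_ge0// !sqrf_eq0 !norm2_eq0.
have bsq : norm2 b ^+ 2 <= E ^+ 2 * norm2 h ^+ 2.
  by rewrite -exprMn ler_exp ?norm2_ge0.
have ysq : (1 - E ^+ 2) * norm2 h ^+ 2 <= norm2 y ^+ 2 by lra.
have y0 : 0 < norm2 y ^+ 2.
  apply: lt_le_trans ysq; rewrite mulr_gt0 ?exprn_gt0// subr_gt0 expr_lt1//.
have Mh : norm2 (M *m h) <= l n * norm2 h by exact: (low_mul_norm MU).
(* Write y = h - V b. The cross terms involve M h, of norm at most l n |h|, so the large eigenvalue
   l 0 enters only through the square of |b| <= E |h|. *)
have up : dotv y (M *m y) <= (l n * (1 + 2 * E) + l 0 * E ^+ 2) * norm2 h ^+ 2.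
  have -> : dotv y (M *m y) = dotv h (M *m h) - 2 * dotv (M *m h) (V *m b)
      + dotv (V *m b) (M *m (V *m b)).
    have -> : y = h - V *m b by rewrite /h addrK.
    rewrite mulmxBr !(dotvBl, dotvBr) (sym_mxP _ _ M_psd.1) (dotvC (V *m b) (M *m h)).
    by rewrite (sym_mxP h _ M_psd.1); ring.
  have t1 : dotv h (M *m h) <= l n * norm2 h ^+ 2.
    apply: le_trans (dotv_le _ _) _; rewrite expr2 mulrCA.
    by rewrite ler_wpM2l ?norm2_ge0.
  have t2 : - dotv (M *m h) (V *m b) <= l n * E * norm2 h ^+ 2.
    apply: le_trans (ler_norm _) _; rewrite normrN; apply: le_trans (cauchy_schwarz _ _) _.
    rewrite (norm2_isometry _ VV) expr2 mulrACA -/(norm2 h).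
    by apply: ler_pM; rewrite ?norm2_ge0.
  have t3 : dotv (V *m b) (M *m (V *m b)) <= l 0 * (E ^+ 2 * norm2 h ^+ 2).
    apply: le_trans (psd_quad_le _ _) _; rewrite (norm2_isometry _ VV).
    by apply: ler_pM; rewrite ?sqr_ge0 ?spectral_norm_ge0 ?spectral_norm_top.
  lra.
have lo : theta * norm2 y ^+ 2 < dotv y (M *m y).
  rewrite -(deflated_quad Vy) (sdec_quad ND) -(sdec_norm2 ND) norm2_sqE big_distrr /=.
  have [i yi] : exists i, (Q^T *m y) i 0 != 0.
    apply/existsP; rewrite -negb_forall; apply: contraTN y0 => /forallP yz.
    rewrite -(sdec_norm2 ND) norm2_sqE big1 ?ltxx// => i _.
    by have /eqP -> := yz i; rewrite expr0n.
  have Di : theta < D 0 i by rewrite ltNge; apply: contra yi => Di; rewrite yhigh.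
  rewrite (bigD1 i)//= [ltRHS](bigD1 i)//=; apply: ltr_leD.
    by rewrite ltr_pM2r// lt_def sqr_ge0 andbT sqrf_eq0.
  apply: ler_sum => j _; have [Dj|Dj] := leP (D 0 j) theta.
    by rewrite yhigh// expr0n !mulr0.
  by rewrite ler_wpM2r ?sqr_ge0// ltW.
have := ler_wpM2l t0 ysq; have := ler_wpM2r (sqr_ge0 (norm2 h)) key; lra.
Qed.

Variables (delta e : R).
Hypotheses (delta01 : 0 < delta < 1) (e0 : 0 <= e).
Hypothesis v_mass : forall s Q D, (s < k)%N -> sdec (N s) Q D ->
  norm2 (part (fun i => D 0 i <= (1 - 3 / 4 * delta) * spectral_norm (N s)) (Q^T *m v s)) <= e.

Let delta0 : 0 < delta. Proof. by case/andP: delta01. Qed.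
Let delta1 : delta < 1. Proof. by case/andP: delta01. Qed.
Let cdelta_gt0 : 0 < 1 - delta. Proof. by rewrite subr_gt0. Qed.

Lemma ratio_ge1 i : 0 < l i -> 1 <= l 0 / l i.
Proof. by move=> li; rewrite ler_pdivlMr// mul1r l_le. Qed.

(** [deflation_low_space] gives m (e + 4 m e |M|/(delta |M_(m-1)|)); the ratio of norms is at most
    r, because |M| <= l 0 and |M_(m-1)| >= l m.-1. *)
Lemma angle_bound m r h : (0 < m <= k)%N -> 0 < l m.-1 -> l 0 / l m.-1 <= r ->
  low U lam ((1 - delta) * spectral_norm (N m.-1)) h ->
  norm2 ((colmx m vs)^T *m h) <= 5 * m%:R ^+ 2 * e * r / delta * norm2 h.
Proof.
move=> /andP[m0 mk] lm lr hlow.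
have /choice[QD QDP] : forall s, exists QD : 'M[R]_d * 'rV[R]_d, sdec (N s) QD.1 QD.2.
  by move=> s; have [Q [D ND]] := spectral_theorem (deflated_psd vs M_psd s).1; exists (Q, D).
(* Any decompositions serve for s > 0; at s = 0 it must be the given one, to which [low U lam]
   refers. *)
pose Qs s := if s is s'.+1 then (QD s).1 else U.
pose Ds s := if s is s'.+1 then (QD s).2 else lam.
have QDs s : sdec (N s) (Qs s) (Ds s) by case: s.
have Lge : l m.-1 <= spectral_norm (N m.-1).
  exact: courant_fischer_lower.
have L0 : 0 < spectral_norm (N m.-1) by exact: lt_le_trans Lge.
have orth r' s : (r' < m)%N -> (s < m)%N -> dotv (v r') (v s) = (r' == s)%:R.
  by move=> rm sm; rewrite v_orth// (leq_trans _ mk).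
have mass s : (s < m)%N -> norm2 (part (fun i : 'I_d => Ds s 0 i <= (1 - 3 / 4 * delta) *
     spectral_norm (N s)) ((Qs s)^T *m v s)) <= e.
  by move=> sm; apply: v_mass => //; exact: leq_trans sm mk.
have := deflation_low_space M_psd orth QDs m0 delta01 e0 L0 mass (x := h) hlow.
move/le_trans; apply; rewrite ler_wpM2r ?norm2_ge0//.
have m1 : 1 <= m%:R :> R by rewrite ler1n.
have r1 : 1 <= r by apply: le_trans lr; exact: ratio_ge1.
have ratio : spectral_norm M / spectral_norm (N m.-1) <= r.
  apply: le_trans lr; apply: ler_pM; rewrite ?invr_ge0 ?spectral_norm_ge0 ?spectral_norm_top//.
  by rewrite lef_pV2 ?posrE.
set q := spectral_norm M / _ in ratio.
have q0 : 0 <= q by rewrite divr_ge0 ?spectral_norm_ge0.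
have -> : e * spectral_norm M * (4 * m%:R) / (delta * spectral_norm (N m.-1)) =
    4 * m%:R * (e / delta) * q by rewrite /q; field; rewrite !gt_eqF.
have ed : e <= e / delta by rewrite ler_pdivlMr// ler_piMr// ltW.
have ed0 : 0 <= e / delta by rewrite divr_ge0// ltW.
have -> : 5 * m%:R ^+ 2 * e * r / delta = m%:R * (m%:R * r * (e / delta) + 4 * m%:R * (e / delta) * r).
  by field; rewrite gt_eqF.
rewrite ler_wpM2l//; apply: lerD.
  by apply: le_trans ed _; rewrite ler_peMl// mulr_ege1.
by rewrite ler_wpM2l// mulr_ge0// mulr_ge0.
Qed.

(** This turns the assumption on epca into smallness of r E for the angle E of [angle_bound]. X is 1
    for (b) and (c), and d^(4/q) for (d). *)
Lemma angle_small m X r : (0 < m)%N -> 1 <= X -> 1 <= r ->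
  e <= delta ^+ 6 / (2 ^+ 28 * m%:R ^+ 4 * X * r ^+ 6) ->
  r * (5 * m%:R ^+ 2 * e * r / delta) <= delta / (16 * X).
Proof.
move=> m0 X1 r1.
have m1 : 1 <= m%:R :> R by rewrite ler1n.
(* 80 = 5 * 16 is what 2^28 has to dominate; from here on it is treated as an abstract K. *)
have K80 : 80 <= 2 ^+ 28 :> R.
  by apply: (@le_trans _ _ (2 ^+ 7)); [rewrite -natrX ler_nat|rewrite ler_eXn2l// ltr1n].
move: (2 ^+ 28) K80 => K K80 he.
have mp : 0 < m%:R :> R by rewrite ltr0n.
have Kp : 0 < K by apply: lt_le_trans K80; rewrite ltr0n.
have Xp : 0 < X by apply: lt_le_trans X1.
have rp : 0 < r by apply: lt_le_trans r1.
have c0 : 0 <= 5 * m%:R ^+ 2 * r ^+ 2 / delta.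
  by rewrite !mulr_ge0 ?exprn_ge0 ?invr_ge0// ltW.
have -> : r * (5 * m%:R ^+ 2 * e * r / delta) = (5 * m%:R ^+ 2 * r ^+ 2 / delta) * e.
  by field; rewrite gt_eqF.
apply: le_trans (ler_wpM2l c0 he) _.
have -> : 5 * m%:R ^+ 2 * r ^+ 2 / delta * (delta ^+ 6 / (K * m%:R ^+ 4 * X * r ^+ 6)) =
   delta / (16 * X) * (delta ^+ 4 * (80 / (K * (m%:R ^+ 2 * r ^+ 4)))).
  by field; rewrite !gt_eqF.
apply: ler_piMr; first by rewrite divr_ge0 ?mulr_ge0// ltW.
have mr : 1 <= m%:R ^+ 2 * r ^+ 4 by rewrite mulr_ege1// exprn_ege1.
have p0 : 0 < K * (m%:R ^+ 2 * r ^+ 4) by rewrite mulr_gt0// (lt_le_trans _ mr).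
apply: mulr_ile1.
- by rewrite exprn_ge0// ltW.
- by rewrite divr_ge0// ltW.
- by apply: exprn_ile1; exact: ltW.
rewrite ler_pdivrMr// mul1r; apply: le_trans K80 _.
by rewrite ler_peMr// ltW.
Qed.

(** The angle bound covers only eigenvalues of M up to (1 - delta)|M_(m-1)|. If l n lies above that,
    then |M_m| <= |M_(m-1)| < l n/(1 - delta) <= theta, and no eigenvalue of M_m exceeds theta. For
    n >= d the rank of M_m decides. *)
Lemma eigen_count m n X theta Q D : (0 < m <= k)%N -> (m <= n)%N -> 0 < l m -> 1 <= X ->
  e <= delta ^+ 6 / (2 ^+ 28 * m%:R ^+ 4 * X * (l 0 / l m) ^+ 6) ->
  sdec (N m) Q D -> l n / (1 - delta) <= theta ->
  (forall E, 0 <= E < 1 -> l 0 / l m * E <= delta / (16 * X) ->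
     l n * (1 + 2 * E) + l 0 * E ^+ 2 <= theta * (1 - E ^+ 2)) ->
  (#|above D theta| + m <= n)%N.
Proof.
move=> /andP[m0 mk] mn lm X1 he ND lt key.
have t0 : 0 <= theta by apply: le_trans lt; rewrite divr_ge0// ltW.
have [nd|nd] := leqP d n.
  apply: leq_trans nd; apply: leq_trans (count_positive mk ND).
  rewrite leq_add2r; apply: subset_leq_card; apply/fintype.subsetP => i.
  by rewrite !in_above; exact: le_lt_trans.
have mp : (m.-1 < m)%N by rewrite prednK.
have [small|large] := leP (l n) ((1 - delta) * spectral_norm (N m.-1)); last first.
  suff -> : above D theta = finset.set0 by rewrite cards0.
  apply/setP => i; rewrite in_above inE; apply/negbTE; rewrite -leNgt.
  apply: le_trans lt; rewrite ler_pdivlMr// mulrC.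
  apply: le_trans (ltW large); rewrite ler_wpM2l//; first exact: ltW.
  apply: le_trans (sdec_le_norm i ND) _.
  exact: (deflated_norm M_psd v_orth (leq_pred m) mk).
have r1 := ratio_ge1 lm.
have lm1 : l m <= l m.-1 by apply: l_le; exact: leq_pred.
have lmr : l 0 / l m.-1 <= l 0 / l m.
  by rewrite ler_wpM2l// lef_pV2 ?posrE// (lt_le_trans lm).
have rE := angle_small m0 X1 r1 he.
pose E := 5 * m%:R ^+ 2 * e * (l 0 / l m) / delta.
have E0 : 0 <= E by rewrite /E !mulr_ge0 ?invr_ge0// ltW.
have E1 : E < 1.
  apply: (@le_lt_trans _ _ (l 0 / l m * E)); first by rewrite ler_peMl.
  apply: le_lt_trans rE _; rewrite ltr_pdivrMr ?mulr_gt0 ?(lt_le_trans _ X1)//.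
  by apply: lt_le_trans delta1 _; rewrite mul1r mulr_ege1// ler1n.
have E01 : 0 <= E < 1 by rewrite E0.
apply: (count_large mk nd ND E01 t0 _ (key E E01 rE)) => h hlow.
apply: angle_bound => //; first by rewrite m0.
  exact: lt_le_trans lm1.
by move=> i Di; apply: hlow; exact: le_lt_trans Di.
Qed.

(** a/(1 - delta) pays for a (1 + 2 E). As a may be far smaller than l 0, the extra delta b/X is
    there to pay for l 0 E^2 = b (l 0/b E) E. *)
Lemma theta_key (a b E X : R) : 0 <= a -> 0 < b -> 1 <= X -> 1 <= l 0 / b ->
  0 <= E < 1 -> l 0 / b * E <= delta / (16 * X) ->
  a * (1 + 2 * E) + l 0 * E ^+ 2 <= (a / (1 - delta) + delta * b / X) * (1 - E ^+ 2).
Proof.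
move=> a0 b0 X1 r1 /andP[E0 E1] rE.
have Xp : 0 < X by apply: lt_le_trans X1.
have X16 : 0 < 16 * X by rewrite mulr_gt0.
have Er : E <= l 0 / b * E by rewrite ler_peMl.
have EX : E <= delta / (16 * X) by exact: le_trans rE.
have E16 : E <= delta / 16.
  by apply: le_trans EX _; rewrite ler_pM2l// lef_pV2 ?posrE// ler_peMr.
have EE : E ^+ 2 <= E by rewrite expr2 ler_piMl// ltW.
rewrite [leRHS]mulrDl; apply: lerD.
  rewrite mulrAC ler_pdivlMr// -!mulrA ler_wpM2l//.
  have := delta0; have := delta1; nra.
have -> : l 0 * E ^+ 2 = b * (l 0 / b * E * E) by field; rewrite gt_eqF.
have -> : delta * b / X * (1 - E ^+ 2) = b * (delta / X * (1 - E ^+ 2)) by field; rewrite gt_eqF.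
rewrite ler_pM2l//.
apply: (@le_trans _ _ (delta / (16 * X) * E)); first by rewrite ler_wpM2r.
have -> : delta / (16 * X) = delta / X * (1 / 16) by field; rewrite gt_eqF.
rewrite -mulrA ler_pM2l ?divr_gt0//.
have := delta1; lra.
Qed.

(** When the eigenvalue is b itself, l 0 E^2 is at most b (delta/16) E and fits into the slack of
    b/(1 - delta), so that (b) carries no additive error. *)
Lemma theta_key_exact (b E : R) : 0 < b -> 1 <= l 0 / b ->
  0 <= E < 1 -> l 0 / b * E <= delta / (16 * 1) ->
  b * (1 + 2 * E) + l 0 * E ^+ 2 <= b / (1 - delta) * (1 - E ^+ 2).
Proof.
move=> b0 r1 /andP[E0 E1] rE.
have Er : E <= l 0 / b * E by rewrite ler_peMl.
have EE : E ^+ 2 <= E by rewrite expr2 ler_piMl// ltW.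
have -> : l 0 * E ^+ 2 = b * (l 0 / b * E * E) by field; rewrite gt_eqF.
have rEE : l 0 / b * E * E <= delta / 16 * E by rewrite ler_wpM2r//; rewrite mulr1 in rE.
rewrite -mulrDr -[leRHS]mulrA ler_pM2l// [leRHS]mulrC ler_pdivlMr//.
move: rE rEE Er; set w := l 0 / b * E; set z := w * E => rE rEE Er.
have := delta0; have := delta1; nra.
Qed.

(** [eigen_count] with n = m and X = 1 leaves room for no eigenvalue of M_m above the bound. *)
Lemma norm_upper m : (0 < m <= k)%N -> 0 < l m ->
  e <= delta ^+ 6 / (2 ^+ 28 * m%:R ^+ 4 * (l 0 / l m) ^+ 6) ->
  spectral_norm (N m) <= l m / (1 - delta).
Proof.
move=> mk lm he; have [Q [D ND]] := spectral_theorem (deflated_psd vs M_psd m).1.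
have d0 : (0 < d)%N by exact: leq_ltn_trans (lt_d lm).
have [i <-] := sdec_norm_attained ND (deflated_psd vs M_psd m) d0.
have := @eigen_count m m 1 (l m / (1 - delta)) Q D mk (leqnn m) lm (lexx 1) _ ND (lexx _) _.
rewrite mulr1 => /(_ he) /(_ (fun E => theta_key_exact lm (ratio_ge1 lm))).
rewrite -[X in (_ <= X)%N]add0n leq_add2r leqn0 cards_eq0 => /eqP A0.
by rewrite leNgt -in_above A0 inE.
Qed.

Lemma norm_bounds : (0 < k)%N -> 0 < l k ->
  e <= delta ^+ 6 / (2 ^+ 28 * k%:R ^+ 4 * (l 0 / l k) ^+ 6) ->
  l k <= spectral_norm (N k) <= l k / (1 - delta).
Proof. by move=> k0 lk he; rewrite courant_fischer_lower//= norm_upper// k0/=. Qed.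

(** v_k is orthogonal to its predecessors, so M may be replaced by M_(k-1). Below: all but
    (delta/16)^2 of the mass lies above (1 - 3/4 delta)|M_(k-1)|, and |M_(k-1)| >= lambda_k. Above:
    [norm_upper] for m = k - 1. *)
Lemma rayleigh_bounds : (0 < k)%N -> 0 < l k ->
  e <= delta ^+ 6 / (2 ^+ 28 * k%:R ^+ 4 * (l 0 / l k) ^+ 6) ->
  (1 - delta) * l k.-1 <= dotv (v k.-1) (M *m v k.-1) <= (1 - delta)^-1 * l k.-1.
Proof.
move=> k0 lk he.
have pk : (k.-1 < k)%N by rewrite prednK.
have lk1 : l k <= l k.-1 by apply: l_le; exact: leq_pred.
have lkp : 0 < l k.-1 by exact: lt_le_trans lk1.
have v1 : norm2 (v k.-1) = 1.
  by apply/eqP; rewrite -(@eqrXn2 _ 2) ?norm2_ge0// norm2_sq v_orth// eqxx expr1n.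
have vr r : (r < k.-1)%N -> dotv (v r) (v k.-1) = 0.
  by move=> rk; rewrite v_orth ?ltn_eqF// (ltn_trans rk).
rewrite -(deflated_mul M vr vr).
apply/andP; split.
  have [Q [D ND]] := spectral_theorem (deflated_psd vs M_psd k.-1).1.
  have mass := v_mass pk ND.
  set c := 1 - 3 / 4 * delta in mass; set Ln := spectral_norm _ in mass.
  have LnL : l k.-1 <= Ln := courant_fischer_lower _.
  have c0 : 0 < c by have := delta1; rewrite /c; lra.
  set S := (fun i : 'I_d => D 0 i <= c * Ln) in mass.
  have e16 : e <= delta / 16.
    have rr := ratio_ge1 lk.
    have X1 : 1 <= (1 : R) by [].
    have he' : e <= delta ^+ 6 / (2 ^+ 28 * k%:R ^+ 4 * 1 * (l 0 / l k) ^+ 6) by rewrite mulr1.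
    have := angle_small k0 X1 rr he'; rewrite mulr1; apply: le_trans.
    set r := l 0 / l k in rr *.
    have k1 : 1 <= k%:R :> R by rewrite ler1n.
    have -> : r * (5 * k%:R ^+ 2 * e * r / delta) = (5 * (k%:R ^+ 2 * r ^+ 2) / delta) * e.
      by field; rewrite gt_eqF.
    rewrite ler_peMl// ler_pdivlMr// mul1r; apply: (@le_trans _ _ 1); first exact: ltW.
    by rewrite mulr_ege1 ?ler1n// mulr_ege1// exprn_ege1.
  have split_ := part_split S (Q^T *m v k.-1).
  rewrite (sdec_norm2 ND) v1 expr1n in split_.
  have m2 : norm2 (part S (Q^T *m v k.-1)) ^+ 2 <= (delta / 16) ^+ 2.
    by rewrite ler_exp ?norm2_ge0// (le_trans mass).
  rewrite (sdec_quad ND).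
  apply: (@le_trans _ _ (c * Ln * norm2 (part (predC S) (Q^T *m v k.-1)) ^+ 2)); last first.
    rewrite part_norm2_sq big_distrr /= big_mkcond; apply: ler_sum => i _.
    case: ifPn => [/=|_].
      by rewrite /S -ltNge => Di; rewrite ler_wpM2r ?sqr_ge0// ltW.
    by rewrite mulr_ge0 ?sqr_ge0// (sdec_ge0 ND (deflated_psd vs M_psd _)).
  apply: (@le_trans _ _ (c * Ln * (1 - (delta / 16) ^+ 2))); last first.
    rewrite ler_wpM2l ?mulr_ge0 ?spectral_norm_ge0//; [exact: ltW|lra].
  rewrite mulrAC; apply: ler_pM => //; first exact: ltW.
  by rewrite /c; have := delta0; have := delta1; nra.
apply: le_trans (psd_quad_le _ _) _; rewrite v1 expr1n mulr1 mulrC.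
(* For k = 1 the matrix is M itself, of norm at most lambda_1. Otherwise the assumption on epca
   passes from k and lambda_(k+1) to k - 1 and lambda_k, which only weakens it. *)
have [k1|k1] := posnP k.-1.
  rewrite k1 /=; apply: le_trans spectral_norm_top _.
  rewrite ler_pdivlMr// ler_piMr//; have := delta0; lra.
apply: norm_upper => //; first by rewrite k1 ltnW.
apply: le_trans he _; rewrite ler_wpM2l ?exprn_ge0// ?(ltW delta0)//.
have pos i j : (0 < i)%N -> 0 < l j -> 0 < 2 ^+ 28 * i%:R ^+ 4 * (l 0 / l j) ^+ 6.
  move=> i0 lj; rewrite mulr_gt0// ?exprn_gt0//; last by rewrite divr_gt0// (lt_le_trans lj)// l_le.
  by rewrite mulr_gt0 ?exprn_gt0// ltr0n.
rewrite lef_pV2 ?posrE ?pos//.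
apply: ler_pM; rewrite ?mulr_ge0 ?exprn_ge0 ?divr_ge0 ?invr_ge0//.
  by rewrite ler_wpM2l ?exprn_ge0// ler_exp// ler_nat leq_pred.
apply: ler_exp; first by rewrite divr_ge0.
by rewrite ler_wpM2l// lef_pV2 ?posrE.
Qed.

(** Orthonormality settles eps >= 1. For eps < 1, eps^4 is eps times a factor at most 1, and 2^12
    dominates the constant 5 of [angle_bound]. *)
Lemma low_angle eps : (0 < k)%N -> 0 < l k.-1 -> 0 < eps ->
  e <= eps ^+ 4 * delta ^+ 2 / (2 ^+ 12 * k%:R ^+ 4 * (l 0 / l k.-1) ^+ 2) ->
  forall h, low U lam ((1 - delta) * spectral_norm (N k.-1)) h ->
  norm2 ((colmx k vs)^T *m h) <= eps * norm2 h.
Proof.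
move=> k0 lk eps0 he h hlow.
have [eps1|eps1] := leP 1 eps.
  apply: le_trans (col_orthonormal_tr_le _ (gram (leqnn k))) _.
  by rewrite ler_peMl ?norm2_ge0.
have kk : (0 < k <= k)%N by rewrite k0/=.
apply: le_trans (angle_bound kk lk (lexx _) hlow) _.
rewrite ler_wpM2r ?norm2_ge0//.
have := ratio_ge1 lk; set r := l 0 / _ in he * => r1.
have K5 : 5 <= 2 ^+ 12 :> R.
  by apply: (@le_trans _ _ (2 ^+ 3)); [rewrite -natrX ler_nat|rewrite ler_eXn2l// ltr1n].
move: (2 ^+ 12) K5 he => K K5 he.
have m1 : 1 <= k%:R :> R by rewrite ler1n.
have mp : 0 < k%:R :> R by rewrite ltr0n.
have Kp : 0 < K by apply: lt_le_trans K5; rewrite ltr0n.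
have rp : 0 < r by apply: lt_le_trans r1.
have c0 : 0 <= 5 * k%:R ^+ 2 * r / delta.
  by rewrite !mulr_ge0 ?exprn_ge0 ?invr_ge0// ltW.
have -> : 5 * k%:R ^+ 2 * e * r / delta = (5 * k%:R ^+ 2 * r / delta) * e.
  by field; rewrite gt_eqF.
apply: le_trans (ler_wpM2l c0 he) _.
have -> : 5 * k%:R ^+ 2 * r / delta * (eps ^+ 4 * delta ^+ 2 / (K * k%:R ^+ 4 * r ^+ 2)) =
   eps * (eps ^+ 3 * delta * (5 / (K * (k%:R ^+ 2 * r)))).
  by field; rewrite !gt_eqF.
apply: ler_piMr; first exact: ltW.
have mr : 1 <= k%:R ^+ 2 * r by rewrite mulr_ege1// exprn_ege1.
have p0 : 0 < K * (k%:R ^+ 2 * r) by rewrite mulr_gt0// (lt_le_trans _ mr).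
apply: mulr_ile1.
- by rewrite mulr_ge0 ?exprn_ge0// ltW.
- by rewrite divr_ge0// ltW.
- by apply: mulr_ile1; rewrite ?exprn_ge0 ?(ltW eps0) ?(ltW delta0) ?(ltW delta1)// exprn_ile1 ?(ltW eps0) ?(ltW eps1).
rewrite ler_pdivrMr// mul1r; apply: le_trans K5 _.
by rewrite ler_peMr// ltW.
Qed.

Lemma schatten_bound q : (0 < k)%N -> 0 < l k -> 1 <= q ->
  e <= delta ^+ 6 / (2 ^+ 28 * k%:R ^+ 4 * d%:R `^ (4 / q) * (l 0 / l k) ^+ 6) ->
  schatten_norm q (N k) <= (1 + delta) ^+ 2 / (1 - delta) ^+ 2 *
    (\sum_(k <= i < d) l i `^ q) `^ q^-1.
Proof.
move=> k0 lk q1 he.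
have kd := lt_d lk.
have d1 : 1 <= d%:R :> R by rewrite ler1n; exact: leq_ltn_trans (leq0n k) kd.
have q0 : 0 < q by apply: lt_le_trans q1.
have q00 : q != 0 by rewrite gt_eqF.
have X1 : 1 <= d%:R `^ (4 / q).
  by rewrite -[leLHS](powRr0 d%:R) ler_powR// divr_ge0// ltW.
set X := d%:R `^ _ in he X1.
have Xp : 0 < X by apply: lt_le_trans X1.
have Np := deflated_psd vs M_psd k.
have [Q [D ND]] := spectral_theorem Np.1.
have D0 := sdec_ge0 ND Np.
rewrite /schatten_norm (singular_values_sum _ ND Np).
pose c := delta * l k / X.
have c0 : 0 <= c by rewrite divr_ge0 ?mulr_ge0// ltW.
(* Bound for the eigenvalue of M_k at position j, counted from 0: [theta_key] for l (j + k), and 0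
   once j + k reaches d, by the rank. *)
pose theta j := if (j + k < d)%N then (1 - delta)^-1 * l (j + k)%N + c else 0.
have cnt j : (j < d)%N -> (#|above D (theta j)| <= j)%N.
  move=> jd; rewrite -(leq_add2r k) /theta; case: ifPn => [jkd|]; last first.
    by rewrite -leqNgt => djk; apply: leq_trans djk; exact: (count_positive (leqnn k) ND).
  have kk : (0 < k <= k)%N by rewrite k0 /=.
  apply: (eigen_count kk (leq_addl j k) lk X1 he ND).
    by rewrite mulrC lerDl.
  move=> E E01 rE; rewrite [_^-1 * _]mulrC.
  exact: (theta_key (l_ge0 _) lk X1 (ratio_ge1 lk) E01 rE).
have fmono x y : 0 <= x -> x <= y -> x `^ q <= y `^ q.
  by move=> x0 xy; apply: (ge0_ler_powR (ltW q0)); rewrite ?nnegrE// (le_trans x0).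
have sum1 := sum_by_counting fmono D0 cnt.
set S := \sum_(k <= i < d) l i `^ q.
pose L := S `^ q^-1.
have S0 : 0 <= S by apply: sumr_ge0 => i _; exact: powR_ge0.
have LS : L `^ q = S by rewrite /L -powRrM mulVf// powRr1.
have L0 : 0 <= L by exact: powR_ge0.
have lkL : l k <= L.
  rewrite -[leLHS](powRr1 (l_ge0 k)) -(mulfV q00) powRrM.
  apply: ge0_ler_powR; rewrite ?nnegrE ?powR_ge0 ?invr_ge0 ?(ltW q0)//.
  by rewrite /S big_ltn// lerDl sumr_ge0// => i _; exact: powR_ge0.
have sum2 : \sum_(0 <= j < d) theta j `^ q =
    \sum_(k <= i < d) ((1 - delta)^-1 * l i + c) `^ q.
  rewrite (big_cat_nat (n := (d - k)%N))//=; last exact: leq_subr.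
  rewrite [X in _ + X = _]big1_seq ?addr0; last first.
    move=> j /andP[_]; rewrite mem_index_iota => /andP[dkj _].
    by rewrite /theta ltnNge addnC -leq_subLR dkj /= powR0.
  rewrite -[k in RHS]add0n big_addn; apply: eq_big_nat => j /= jdk.
  by rewrite /theta (_ : (j + k < d)%N) // addnC -ltn_subRL.
(* The purpose of d^(4/q): its q-th power d^4 outweighs the number of slack terms c^q, at most d. *)
have csum : \sum_(k <= i < d) c `^ q <= (delta * L) `^ q.
  rewrite sumr_const_nat -mulr_natl.
  have Xq : X `^ q = d%:R ^+ 4.
    by rewrite /X -powRrM mulrAC mulfK// powR_mulrn.
  have -> : c `^ q = (delta * l k) `^ q / d%:R ^+ 4.
    rewrite /c powRM ?mulr_ge0 ?invr_ge0 ?(ltW delta0) ?(ltW Xp)//; congr (_ * _).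
    by rewrite -powR_inv1 ?(ltW Xp)// -powRrM mulrC powRrM Xq powR_inv1// exprn_ge0.
  apply: (@le_trans _ _ ((delta * l k) `^ q)).
    rewrite mulrCA ler_piMr ?powR_ge0// ler_pdivrMr ?exprn_gt0 ?(lt_le_trans _ d1)// mul1r.
    apply: (@le_trans _ _ d%:R); first by rewrite ler_nat leq_subr.
    by rewrite -[leLHS]expr1 ler_weXn2l.
  by apply: fmono; [rewrite mulr_ge0// ltW|rewrite ler_wpM2l// ltW].
have SL : S <= L `^ q by rewrite LS.
have inv0 : 0 < (1 - delta)^-1 by rewrite invr_gt0.
have fin := powR_affine_sum q1 inv0 delta0 c0 l_ge0 L0 SL csum.
have AB0 : 0 <= ((1 - delta)^-1 + delta) * L by rewrite mulr_ge0// addr_ge0// ltW.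
apply: (@le_trans _ _ (((1 - delta)^-1 + delta) * L)).
  have -> : ((1 - delta)^-1 + delta) * L = ((((1 - delta)^-1 + delta) * L) `^ q) `^ q^-1.
    by rewrite -powRrM mulfV// powRr1.
  apply: ge0_ler_powR; rewrite ?nnegrE ?powR_ge0 ?invr_ge0 ?(ltW q0)//.
    by apply: sumr_ge0 => i _; exact: powR_ge0.
  by apply: le_trans sum1 _; rewrite sum2.
rewrite ler_wpM2r// ler_pdivlMr ?exprn_gt0//.
have -> : ((1 - delta)^-1 + delta) * (1 - delta) ^+ 2 =
    (1 - delta) + delta * (1 - delta) ^+ 2 by field; rewrite gt_eqF.
have := delta0; have := delta1; nra.
Qed.

End LazySVDAnalysis.

(** * Good starting vectors and runs of LazySVD *)

Section GoodStart.
Local Open Scope ring_scope.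
Context {R : realType} {d : nat}.
Implicit Types (N Q : 'M[R]_d) (D : 'rV[R]_d) (w : 'cV[R]_d).

Definition mxpow N n : 'M[R]_d := iter n (mulmx N) 1%:M.

(* For N psd with top eigenspace projection Pi this says |Pi w| >= c, but in
   terms of countably many polynomial inequalities in N and w. *)
Definition good_start (c : R) N w := forall n m : nat,
  (c ^+ 2) ^+ m * \tr (mxpow N m) ^+ (2 * n) <=
  (norm2 (mxpow N n *m w) ^+ 2) ^+ m * d%:R ^+ (2 * n).

Lemma mxpow_coord N Q D n (x : 'cV[R]_d) i : sdec N Q D ->
  (Q^T *m (mxpow N n *m x)) i 0 = D 0 i ^+ n * (Q^T *m x) i 0.
Proof.
move=> ND; elim: n => [|n IH]; first by rewrite /mxpow /= mul1mx expr0 mul1r.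
by rewrite /mxpow iterS -mulmxA (sdec_mulE ND) IH exprS mulrA.
Qed.

Lemma mxpow_trace N Q D m : sdec N Q D -> \tr (mxpow N m) = \sum_i D 0 i ^+ m.
Proof.
move=> ND; have -> : mxpow N m = Q *m diag_mx (\row_i D 0 i ^+ m) *m Q^T.
  apply: mxP_dotv => x; apply: (sdec_inj ND); apply/colP => i.
  rewrite (mxpow_coord _ _ _ ND) !mulmxA ND.1 mul1mx -mulmxA mul_diag_mx.
  by rewrite [RHS]mxE [(\row__ _) _ _]mxE.
rewrite mxtrace_mulC mulmxA ND.1 mul1mx mxtrace_diag.
by apply: eq_bigr => i _; rewrite mxE.
Qed.

(** Up to powers, the inequality compares c lam^n <= |N^n w|, which is seen by testing against q,
    with the trace bound tr (N^m) <= d lam^m. The latter accounts for the factor d^(2n) in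
    [good_start]. *)
Lemma good_start_intro c N w q : psd N -> 0 <= c -> norm2 q = 1 ->
  N *m q = spectral_norm N *: q -> c <= `|dotv q w| -> good_start c N w.
Proof.
move=> Np c0 q1 Nq cq n m; have [Q [D ND]] := spectral_theorem Np.1.
set lam := spectral_norm N in Nq.
have lam0 : 0 <= lam by exact: spectral_norm_ge0.
have D0 := sdec_ge0 ND Np.
have tr_le : 0 <= \tr (mxpow N m) <= d%:R * lam ^+ m.
  rewrite (mxpow_trace _ ND); apply/andP; split.
    by apply: sumr_ge0 => i _; rewrite exprn_ge0.
  apply: (@le_trans _ _ (\sum_(i < d) lam ^+ m)).
    by apply: ler_sum => i _; rewrite ler_exp// (sdec_le_norm i ND).
  by rewrite sumr_const card_ord mulr_natl.
have pw : c * lam ^+ n <= norm2 (mxpow N n *m w).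
  have E : dotv q (mxpow N n *m w) = lam ^+ n * dotv q w.
    elim: n => [|n IH]; first by rewrite /mxpow /= mul1mx mul1r.
    rewrite /mxpow iterS -mulmxA (sym_mxP _ _ Np.1) Nq dotvZl IH exprS mulrA.
    by [].
  apply: le_trans (_ : `|dotv q (mxpow N n *m w)| <= _); last first.
    by apply: le_trans (cauchy_schwarz _ _) _; rewrite q1 mul1r.
  rewrite E normrM ger0_norm ?exprn_ge0// mulrC ler_wpM2l// exprn_ge0//.
have /andP[t0 t1] := tr_le.
apply: (@le_trans _ _ ((c ^+ 2) ^+ m * (d%:R * lam ^+ m) ^+ (2 * n))).
  by rewrite ler_wpM2l ?exprn_ge0 ?sqr_ge0// ler_exp.
have -> : (c ^+ 2) ^+ m * (d%:R * lam ^+ m) ^+ (2 * n) =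
   ((c * lam ^+ n) ^+ 2) ^+ m * d%:R ^+ (2 * n).
  rewrite [(d%:R * _) ^+ _]exprMn [(c * _) ^+ 2]exprMn [(c ^+ 2 * _) ^+ m]exprMn -mulrA.
  congr (_ * _); rewrite mulrC; congr (_ * _); rewrite -!exprM; congr (_ ^+ _).
  lia.
rewrite ler_wpM2r ?exprn_ge0// ler_exp ?sqr_ge0// ler_exp// mulr_ge0// exprn_ge0//.
Qed.

(** Suppose the top component a is below c. For n large, |N^n w|^2 <= lam^(2n) beta with beta < c^2,
    since the other eigenvalues die out. With n fixed and m growing, tr (N^m) >= lam^m then
    contradicts [good_start], as d^(2n) is a constant against (c^2/beta)^m. *)
Lemma good_start_top c N w Q D : sdec N Q D -> psd N -> 0 < spectral_norm N -> 0 < c ->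
  good_start c N w -> c <= norm2 (part (fun i => D 0 i == spectral_norm N) (Q^T *m w)).
Proof.
move=> ND Np; set lam := spectral_norm N => lam0 c0 good.
set top := (fun i : 'I_d => _); set a := norm2 _; rewrite leNgt; apply/negP => ac.
have a0 : 0 <= a by exact: norm2_ge0.
have D0 := sdec_ge0 ND Np; have Dle i : D 0 i <= lam by exact: sdec_le_norm ND.
have d0 : (0 < d)%N.
  rewrite lt0n; apply/eqP => d0; move: lam0; rewrite /lam; suff -> : spectral_norm N = 0 by rewrite ltxx.
  apply/eqP; rewrite eq_le spectral_norm_ge0 andbT; apply: spectral_norm_le => // x.
  have -> : N *m x = 0 by apply/colP => i; have := ltn_ord i; rewrite {2}d0.
  by rewrite norm2_0 mul0r.
have a2c2 : a ^+ 2 < c ^+ 2 by rewrite ltr_pXn2r ?nnegrE// ltW.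
pose t := (c ^+ 2 - a ^+ 2) / 2; have t0 : 0 < t by rewrite /t; lra.
pose K := norm2 w ^+ 2 + 1; have K0 : 0 < K by rewrite ltr_wpDl ?sqr_ge0.
have /choice[f fP] : forall i : 'I_d, exists n, D 0 i < lam -> (D 0 i / lam) ^+ n <= t / K.
  move=> i; have [Di|Di] := ltP (D 0 i) lam; last by exists 0%N.
  have [|n hn] := @expn_small R (D 0 i / lam) (t / K) _ (divr_gt0 t0 K0); last by exists n.
  by rewrite divr_ge0 ?ltr_pdivrMr ?mul1r// ltW.
pose n := (\max_i f i)%N.
have rn i : D 0 i < lam -> (D 0 i / lam) ^+ (n * 2) <= t / K.
  move=> Di; apply: le_trans (fP i Di).
  have x0 : 0 <= D 0 i / lam by rewrite divr_ge0// ltW.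
  have x1 : D 0 i / lam <= 1 by rewrite ler_pdivrMr// mul1r.
  apply: ler_wiXn2l => //.
  by apply: leq_trans (leq_pmulr _ _) => //; exact: leq_bigmax.
pose beta := a ^+ 2 + t.
have bc : beta < c ^+ 2 by rewrite /beta /t; lra.
have b0 : 0 <= beta by rewrite addr_ge0 ?sqr_ge0// ltW.
have wn : norm2 (mxpow N n *m w) ^+ 2 <= lam ^+ (n * 2) * beta.
  rewrite -(sdec_norm2 ND) -(part_split top) mulrDr; apply: lerD.
    rewrite /a !part_norm2_sq big_distrr /=; apply: ler_sum => i /eqP Di.
    by rewrite (mxpow_coord _ _ _ ND) exprMn Di -exprM.
  rewrite part_norm2_sq; apply: (@le_trans _ _
      (\sum_(i | predC top i) lam ^+ (n * 2) * (t / K) * (Q^T *m w) i 0 ^+ 2)).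
    apply: ler_sum => i ntop; rewrite (mxpow_coord _ _ _ ND) exprMn ler_wpM2r ?sqr_ge0//.
    have Di : D 0 i < lam by rewrite lt_neqAle Dle andbT.
    have := rn i Di; rewrite expr_div_n ler_pdivrMr ?exprn_gt0// -exprM mulrC.
    by [].
  rewrite -big_distrr /= -mulrA ler_wpM2l ?exprn_ge0 ?(ltW lam0)//.
  rewrite -part_norm2_sq mulrAC ler_pdivrMr// ler_wpM2l ?(ltW t0)//.
  have := part_norm2 (predC top) (Q^T *m w); rewrite (sdec_norm2 ND) => h.
  apply: (@le_trans _ _ (norm2 w ^+ 2)); first by rewrite ler_exp ?norm2_ge0.
  by rewrite lerDl.
have dn0 : 0 < d%:R ^+ (2 * n) :> R by rewrite exprn_gt0// ltr0n.
have main m : (c ^+ 2) ^+ m <= beta ^+ m * d%:R ^+ (2 * n).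
  have trm : lam ^+ m <= \tr (mxpow N m).
    rewrite (mxpow_trace _ ND); have [i Di] := sdec_norm_attained ND Np d0.
    by rewrite /lam -Di (bigD1 i)//= lerDl sumr_ge0// => j _; rewrite exprn_ge0.
  have lm0 : 0 < lam ^+ (m * (2 * n)) by rewrite exprn_gt0.
  rewrite -(ler_pM2r lm0).
  apply: (@le_trans _ _ ((c ^+ 2) ^+ m * \tr (mxpow N m) ^+ (2 * n))).
    rewrite exprM ler_wpM2l ?exprn_ge0 ?(ltW c0)//.
    by rewrite ler_exp ?exprn_ge0 ?(ltW lam0).
  apply: le_trans (good n m) _.
  apply: (@le_trans _ _ ((lam ^+ (n * 2) * beta) ^+ m * d%:R ^+ (2 * n))).
    by apply: ler_wpM2r; [exact: ltW|apply: ler_exp => //; exact: sqr_ge0].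
  rewrite exprMn -exprM mulnC [(n * 2)%N]mulnC.
  by rewrite le_eqVlt; apply/orP; left; apply/eqP; ring.
have q01 : 0 <= beta / c ^+ 2 < 1.
  by rewrite divr_ge0 ?sqr_ge0//= ltr_pdivrMr ?exprn_gt0// mul1r.
have s0 : 0 < (2 * d%:R ^+ (2 * n))^-1 :> R by rewrite invr_gt0 mulr_gt0.
have [m hm] := expn_small q01 s0.
have := main m; have cm : 0 < (c ^+ 2) ^+ m by rewrite !exprn_gt0.
move: hm; rewrite expr_div_n ler_pdivrMr// => hm hc.
have : beta ^+ m * d%:R ^+ (2 * n) <= (c ^+ 2) ^+ m / 2.
  apply: le_trans (ler_wpM2r (ltW dn0) hm) _.
  by rewrite invfM mulrAC mulfVK ?gt_eqF// mulrC.
lra.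
Qed.

End GoodStart.

(** * The Gram-Schmidt step and the two forms of deflation *)

Section Link.
Local Open Scope ring_scope.
Context {R : realType} {d : nat}.
Implicit Types (M N : 'M[R]_d) (vs : seq 'cV[R]_d).

Lemma colmx_take n vs : colmx n (take n vs) = colmx n vs.
Proof. by apply/matrixP => i j; rewrite !mxE nth_take. Qed.

Lemma deflateE M vs s : (s <= size vs)%N -> deflate M (take s vs) = deflated M vs s.
Proof.
elim: s => [|s IH] sv; first by rewrite take0.
by rewrite (take_nth 0)// /deflate foldl_rcons -/(deflate M _) IH// ltnW.
Qed.

Lemma colmx_outerS n vs : colmx n.+1 vs *m (colmx n.+1 vs)^T =
  colmx n vs *m (colmx n vs)^T + nth 0 vs n *m (nth 0 vs n)^T.
Proof.
apply/matrixP => i j; rewrite !mxE big_ord_recr /= big_ord1 !mxE; congr (_ + _).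
by apply: eq_bigr => l _; rewrite !mxE.
Qed.

Lemma colmx_outer_mul n vs x : (forall r, (r < n)%N -> dotv (nth 0 vs r) x = 0) ->
  colmx n vs *m (colmx n vs)^T *m x = 0.
Proof.
move=> vx; rewrite -mulmxA; suff -> : (colmx n vs)^T *m x = 0 by rewrite mulmx0.
by apply/colP => r; rewrite colmx_tr_mul vx// mxE.
Qed.

Section Orthonormal.
Variables (vs : seq 'cV[R]_d) (k : nat).
Hypothesis v_orth : forall r s, (r < k)%N -> (s < k)%N ->
  dotv (nth 0 vs r) (nth 0 vs s) = (r == s)%:R.

(** Orthogonality of v_s to its predecessors kills the cross term, so the complementary projections
    multiply; [compressE] follows by induction. *)
Lemma complementS s : (s < k)%N ->
  1%:M - colmx s.+1 vs *m (colmx s.+1 vs)^T =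
  (1%:M - nth 0 vs s *m (nth 0 vs s)^T) *m (1%:M - colmx s vs *m (colmx s vs)^T).
Proof.
move=> sk; rewrite colmx_outerS mulmxBl mul1mx mulmxBr mulmx1.
set v := nth 0 vs s; set W := colmx s vs *m _.
have -> : v *m v^T *m W = 0.
  have WT : W^T = W by rewrite /W trmx_mul trmxK.
  apply: trmx_inj; rewrite trmx0 trmx_mul WT trmx_mul trmxK mulmxA.
  rewrite /W colmx_outer_mul ?mul0mx// => r rs.
  by rewrite v_orth ?ltn_eqF// (ltn_trans rs).
by rewrite subr0 opprD addrA addrAC.
Qed.

Lemma compressE M s : (s <= k)%N -> compress M (colmx s vs) = deflated M vs s.
Proof.
elim: s => [|s IH] sk.
  have -> : colmx 0 vs = 0 by apply/matrixP => i [].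
  by rewrite /compress mul0mx subr0 mul1mx mulmx1.
have T (W : 'M[R]_d) : W^T = W -> (1%:M - W)^T = 1%:M - W by move=> WT; rewrite linearB /= trmx1 WT.
have oT n (V : 'M[R]_(d, n)) : (V *m V^T)^T = V *m V^T by rewrite trmx_mul trmxK.
have E := complementS sk; have := congr1 trmx E; rewrite trmx_mul !T// => E'.
rewrite /= /defl -IH 1?ltnW// /compress {1}E E' !mulmxA.
by [].
Qed.

End Orthonormal.

Lemma gram_orth vs k : (colmx k vs)^T *m colmx k vs = 1%:M ->
  forall r s, (r < k)%N -> (s < k)%N -> dotv (nth 0 vs r) (nth 0 vs s) = (r == s)%:R.
Proof.
move=> /matrixP VV r s rk sk; have := VV (Ordinal rk) (Ordinal sk).
by rewrite colmx_gram mxE.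
Qed.

Lemma orth_gram vs k : (forall r s, (r < k)%N -> (s < k)%N ->
  dotv (nth 0 vs r) (nth 0 vs s) = (r == s)%:R) -> (colmx k vs)^T *m colmx k vs = 1%:M.
Proof. by move=> h; apply/matrixP => i j; rewrite colmx_gram h// mxE. Qed.

Lemma complement_orth vs n x : (colmx n vs)^T *m colmx n vs = 1%:M ->
  forall r, (r < n)%N -> dotv (nth 0 vs r) ((1%:M - colmx n vs *m (colmx n vs)^T) *m x) = 0.
Proof.
move=> VV r rn; rewrite -(colmx_tr_mul _ _ (Ordinal rn)) mulmxA mulmxBr mulmx1 mulmxA VV mul1mx.
by rewrite subrr mul0mx mxE.
Qed.

Lemma gram_step vs n x : (colmx n vs)^T *m colmx n vs = 1%:M ->
  let r := (1%:M - colmx n vs *m (colmx n vs)^T) *m x in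
  r != 0 -> nth 0 vs n = normalize r -> (colmx n.+1 vs)^T *m colmx n.+1 vs = 1%:M.
Proof.
move=> VV r r0 vn; apply: orth_gram => i j.
have orth := gram_orth VV; have c := complement_orth x VV.
have vv : dotv (nth 0 vs n) (nth 0 vs n) = 1.
  by rewrite -norm2_sq vn norm2_normalize// expr1n.
have iv i' : (i' < n)%N -> dotv (nth 0 vs i') (nth 0 vs n) = 0.
  by move=> ii; rewrite vn /normalize dotvZr c// mulr0.
rewrite !ltnS leq_eqVlt => /orP[/eqP->|iin]; rewrite leq_eqVlt => /orP[/eqP->|jin].
- by rewrite vv eqxx.
- by rewrite dotvC iv// gtn_eqF.
- by rewrite iv// ltn_eqF.
- exact: orth.
Qed.

Section Mass.
Variables (M : 'M[R]_d) (vs : seq 'cV[R]_d) (s : nat) (Q : 'M[R]_d) (D : 'rV[R]_d).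
Hypotheses (M_psd : psd M) (VV : (colmx s vs)^T *m colmx s vs = 1%:M).
Hypothesis ND : sdec (deflated M vs s) Q D.
Variables (x : 'cV[R]_d) (thr e : R).
Hypotheses (x1 : norm2 x = 1) (thr0 : 0 <= thr) (e0 : 0 <= e) (e1 : e < 1).
Hypothesis mass : norm2 (part (fun i => D 0 i <= thr) (Q^T *m x)) <= e.

Let S i := D 0 i <= thr.
Let P := 1%:M - colmx s vs *m (colmx s vs)^T.
Let r := P *m x.

(* Deflation only removes low-eigenvalue mass, since the span of v_1, ..., v_s
   lies in the kernel of M_s. *)
Lemma projected_mass : r != 0 /\ norm2 (part S (Q^T *m normalize r)) <= e.
Proof.
pose g := Q *m part S (Q^T *m x); pose h := Q *m part (predC S) (Q^T *m x).
have orth := gram_orth VV.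
have xE : x = g + h.
  apply: (sdec_inj ND); rewrite mulmxDr !(sdec_mulQ ND).
  by apply/colP => i; rewrite [RHS]mxE ![part _ _ _ _]mxE /=; case: (S i); rewrite ?addr0 ?add0r.
have hh : high Q D thr h by move=> i Di; rewrite (sdec_mulQ ND) mxE /= /S Di.
have PT : P^T = P by rewrite /P linearB /= trmx1 trmx_mul trmxK.
have Ph y : high Q D thr y -> P *m y = y.
  move=> hy; rewrite /P mulmxBl mul1mx colmx_outer_mul ?subr0// => j js.
  exact: (high_orth orth ND (leqnn s) js thr0 hy).
(* The projection fixes the high part h and acts on the low part g alone, without leaving the low
   space. *)
have rE : r = P *m g + h by rewrite -[X in _ + X](Ph h hh) -mulmxDr -xE.
have gn : norm2 g = norm2 (part S (Q^T *m x)) by rewrite (norm2_isometry _ ND.1).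
have hn : norm2 h = norm2 (part (predC S) (Q^T *m x)) by rewrite (norm2_isometry _ ND.1).
have tot : norm2 g ^+ 2 + norm2 h ^+ 2 = 1.
  by rewrite gn hn part_split (sdec_norm2 ND) x1 expr1n.
have ge : norm2 g ^+ 2 <= e ^+ 2 by rewrite ler_exp ?norm2_ge0// gn.
have Pglow i : ~~ S i -> (Q^T *m (P *m g)) i 0 = 0.
  move=> Si.
  have colE (y : 'cV[R]_d) : (Q^T *m y) i 0 = dotv (col i Q) y.
    by rewrite -(sdec_dotv ND) dotvE (bigD1 i)//= (sdec_col_coord ND) eqxx mul1r big1 ?addr0// => j ji;
       rewrite (sdec_col_coord ND) (negbTE ji) mul0r.
  rewrite colE dotv_mulr PT Ph.
    by rewrite -colE (sdec_mulQ ND) mxE (negbTE Si).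
  move=> j Dj; rewrite (sdec_col_coord ND); case: eqP => // E.
  by move: Si; rewrite /S -E Dj.
have pr : part S (Q^T *m r) = Q^T *m (P *m g).
  apply/colP => i; rewrite [LHS]mxE rE mulmxDr [X in if _ then X else _]mxE.
  case: ifPn => Si; last by rewrite Pglow.
  by rewrite /h (sdec_mulQ ND) [part (predC S) _ _ _]mxE /= Si addr0.
have Pgh : dotv (P *m g) h = 0.
  rewrite dotvC dotv_mulr PT (Ph h hh) -(sdec_dotv ND) dotvE big1// => i _.
  by rewrite /h /g !(sdec_mulQ ND) ![part _ _ _ _]mxE /=; case: (S i); rewrite ?mulr0 ?mul0r.
have rsq : norm2 r ^+ 2 = norm2 (P *m g) ^+ 2 + norm2 h ^+ 2.
  by rewrite !norm2_sq rE dotvDl !dotvDr (dotvC h) Pgh addr0 add0r.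
have Pgn : norm2 (P *m g) ^+ 2 <= norm2 g ^+ 2.
  have PP : P *m P = P.
    have WW : colmx s vs *m (colmx s vs)^T *m (colmx s vs *m (colmx s vs)^T) =
        colmx s vs *m (colmx s vs)^T.
      by rewrite mulmxA -(mulmxA (colmx s vs) _ (colmx s vs)) VV mulmx1.
    by rewrite /P mulmxBr mulmx1 mulmxBl mul1mx WW subrr subr0.
  have : dotv (P *m g) (P *m g) <= norm2 g * norm2 (P *m g).
    by rewrite dotv_mulr PT mulmxA PP dotvC; exact: dotv_le.
  rewrite -norm2_sq => hP; have [->|n0] := eqVneq (norm2 (P *m g)) 0.
    by rewrite expr0n sqr_ge0.
  apply: ler_exp; first exact: norm2_ge0.
  have n1 : 0 < norm2 (P *m g) by rewrite lt_def n0 norm2_ge0.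
  by rewrite -(ler_pM2r n1) -expr2.
have e21 : e ^+ 2 < 1 by rewrite expr_lt1.
have x0 : 0 <= norm2 (P *m g) ^+ 2 by exact: sqr_ge0.
have r0 : 0 < norm2 r.
  rewrite lt_def norm2_ge0 andbT; apply/eqP => rz.
  by move: rsq; rewrite rz expr0n /=; lra.
split; first by rewrite -norm2_gt0.
rewrite /normalize -scalemxAr partZ norm2Z ger0_norm ?invr_ge0 ?(ltW r0)// pr (sdec_norm2 ND).
(* With Y = |P g|^2 <= G = |g|^2 <= e^2 and |h|^2 = 1 - G, the claim is Y <= e^2 (Y + 1 - G):
   shrinking the low part can only lower its share. *)
rewrite mulrC ler_pdivrMr// -(@ler_pXn2r _ 2) ?nnegrE ?mulr_ge0 ?norm2_ge0 ?(ltW r0)// exprMn rsq.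
have -> : norm2 h ^+ 2 = 1 - norm2 g ^+ 2 by lra.
move: ge e21 Pgn x0; set G := norm2 g ^+ 2; set E := e ^+ 2; set Y := norm2 (P *m g) ^+ 2.
move=> ge e21 Pgn x0.
have E0 : 0 <= E by exact: sqr_ge0.
have : Y * (1 - E) <= G * (1 - E) by rewrite ler_wpM2r// subr_ge0 ltW.
lra.
Qed.

End Mass.

End Link.

(** * A total functional version of LazySVD and its agreement with runs *)

Section Runs.
Local Open Scope ring_scope.
Context {R : realType} {d : nat}.
Variables (A : inv_method R d) (M : 'M[R]_d) (k : nat) (delta e p : R) (w : nat -> 'cV[R]_d).

(** The stopping test holds at pass f and at no earlier one, so f is determined. *)
Lemma AppxPCA_returns_unique N dl ep p' w0 x y :
  AppxPCA_returns A N dl ep p' w0 x -> AppxPCA_returns A N dl ep p' w0 y -> x = y.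
Proof.
move=> [f [f0 hf _ ->]] [g [g0 hg _ ->]]; suff -> : f = g by [].
have [fg|gf|//] := ltngtP f g.
  have [_] := hf f ltac:(by rewrite f0 leqnn); rewrite eqxx => stf.
  have [_] := hg f ltac:(by rewrite f0 ltnW); rewrite stf => /esym/eqP E.
  by rewrite E ltnn in fg.
have [_] := hg g ltac:(by rewrite g0 leqnn); rewrite eqxx => stg.
have [_] := hf g ltac:(by rewrite g0 ltnW); rewrite stg => /esym/eqP E.
by rewrite E ltnn in gf.
Qed.

Definition pca_fun (N : 'M[R]_d) (w0 : 'cV[R]_d) : 'cV[R]_d :=
  xget 0 [set x | AppxPCA_returns A N (delta / 2) e (p / k%:R) w0 x]%classic.

Lemma pca_funE N w0 x : AppxPCA_returns A N (delta / 2) e (p / k%:R) w0 x ->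
  pca_fun N w0 = x.
Proof.
move=> h; apply: (AppxPCA_returns_unique _ h).
by apply: (@xgetPex _ 0 [set x | AppxPCA_returns A N (delta / 2) e (p / k%:R) w0 x]%classic); exists x.
Qed.

(** Where a call returns nothing, [pca_fun] yields 0 and the recursion continues, so the deflated
    matrices are defined at every sample point; on actual runs they are the true ones
    ([run_lazy_seq]). *)
Fixpoint lazy_seq (s : nat) : seq 'cV[R]_d :=
  if s is s'.+1 then
    let vs := lazy_seq s' in
    let V := colmx s' vs in
    rcons vs (normalize ((1%:M - V *m V^T) *m pca_fun (deflate M vs) (w s')))
  else [::].

Lemma size_lazy_seq s : size (lazy_seq s) = s.
Proof. by elim: s => //= s IH; rewrite size_rcons IH. Qed.

Lemma take_lazy_seq s t : (s <= t)%N -> take s (lazy_seq t) = lazy_seq s.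
Proof.
elim: t => [|t IH]; first by rewrite leqn0 => /eqP->.
rewrite leq_eqVlt => /orP[/eqP->|st]; first by rewrite take_oversize// size_lazy_seq.
by rewrite /= -cats1 takel_cat ?size_lazy_seq// IH.
Qed.

Local Notation run vs := (LazySVD_returns A M delta e p (fun s : 'I_k => w s) vs).

Lemma run_gram vs m : run vs -> (m <= k)%N -> (colmx m vs)^T *m colmx m vs = 1%:M.
Proof.
move=> [sz h]; elim: m => [|m IH] mk; first by apply/matrixP => -[].
have [v' [_ r0 vE]] := h (Ordinal mk).
exact: (gram_step (IH (ltnW mk)) r0 vE).
Qed.

Lemma run_lazy_seq vs s : run vs -> (s <= k)%N -> take s vs = lazy_seq s.
Proof.
move=> [sz h]; elim: s => [|s IH] sk; first by rewrite take0.
have [v' [ret _ vE]] := h (Ordinal sk).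
rewrite (take_nth 0) ?sz//= IH 1?ltnW//; congr rcons.
rewrite /= in vE ret; rewrite vE -(colmx_take s vs) IH 1?ltnW//.
by rewrite IH 1?ltnW// in ret; rewrite (pca_funE ret).
Qed.

Hypotheses (A_inv : approx_inversion A) (M_psd : psd M) (M1 : spectral_norm M <= 1).
Hypotheses (delta01 : 0 < delta < 1) (e01 : 0 < e < 1) (p01 : 0 < p < 1).
Hypotheses (k0 : (0 < k)%N) (d0 : (0 < d)%N) (w1 : forall s, (s < k)%N -> norm2 (w s) = 1).

Let c : R := p / k%:R / (2 * d%:R).

Let pk01 : 0 < p / k%:R < 1.
Proof.
have /andP[p0 p1] := p01; rewrite divr_gt0 ?ltr0n//= ltr_pdivrMr ?ltr0n// mul1r.
by apply: lt_le_trans p1 _; rewrite ler1n.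
Qed.

Let c0 : 0 < c.
Proof. by have /andP[h _] := pk01; rewrite divr_gt0// mulr_gt0// ltr0n. Qed.

Lemma pca_step N s : psd N -> 0 < spectral_norm N <= 1 -> (s < k)%N -> good_start c N (w s) ->
  (exists x, AppxPCA_returns A N (delta / 2) e (p / k%:R) (w s) x) /\
  forall x, AppxPCA_returns A N (delta / 2) e (p / k%:R) (w s) x -> norm2 x = 1 /\
    forall Q D, sdec N Q D ->
    norm2 (part (fun i => D 0 i <= (1 - 3 / 4 * delta) * spectral_norm N) (Q^T *m x)) <= e.
Proof.
move=> Np /andP[N0 N1] sk good.
have /andP[dl0 dl1] := delta01; have /andP[e0 e1] := e01; have /andP[p0 p1] := pk01.
have dl2 : 0 < delta / 2 by rewrite divr_gt0.
have dl3 : delta / 2 <= 1 / 2 by rewrite ler_pM2r// ltW.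
(* The call receives delta/2, whence the recurring 3/4. *)
have thr : 1 - 3 / 2 * (delta / 2) = 1 - 3 / 4 * delta by field.
have all Q D (ND : sdec N Q D) := AppxPCA_correct A_inv ND
  (fun i => sdec_le_norm i ND) N0 N1 dl2 dl3 e0 e1 p0 p1 d0 (w1 sk)
  (good_start_top ND Np N0 c0 good).
split.
  have [Q [D ND]] := spectral_theorem Np.1.
  exact: (all Q D ND).1.
move=> x ret; split.
  have [Q [D ND]] := spectral_theorem Np.1.
  exact: ((all Q D ND).2 x ret).1.
by move=> Q D ND; have := ((all Q D ND).2 x ret).2; rewrite thr.
Qed.

Variables (U : 'M[R]_d) (l : nat -> R).
Hypothesis MU : sdec M U (\row_(i < d) l i).
Hypothesis l_le : forall i j, (i <= j)%N -> l j <= l i.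
Hypothesis l_ge0 : forall i, 0 <= l i.
Hypothesis l_out : forall i, (d <= i)%N -> l i = 0.
Hypothesis lk : 0 < l k.-1.

(** lambda_k > 0 keeps the input of every call nonzero; on the zero matrix the loop of [AppxPCA]
    need not stop. *)
Lemma deflated_norm_pos vs s : (s < k)%N -> (colmx s vs)^T *m colmx s vs = 1%:M ->
  0 < spectral_norm (deflated M vs s) <= 1.
Proof.
move=> sk VV; have orth := gram_orth VV; apply/andP; split.
  apply: (lt_le_trans _ (courant_fischer_lower vs MU l_le l_out s)).
  by apply: lt_le_trans lk _; apply: l_le; rewrite -ltnS prednK.
exact: le_trans (deflated_norm M_psd orth (leq0n s) (leqnn s)) M1.
Qed.

Let thr_ge0 (N : 'M[R]_d) : 0 <= (1 - 3 / 4 * delta) * spectral_norm N.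
Proof. by rewrite mulr_ge0 ?spectral_norm_ge0//; have /andP[_ ?] := delta01; lra. Qed.

Lemma run_mass vs : run vs ->
  (forall s, (s < k)%N -> good_start c (deflate M (lazy_seq s)) (w s)) ->
  forall s Q D, (s < k)%N -> sdec (deflated M vs s) Q D ->
  norm2 (part (fun i => D 0 i <= (1 - 3 / 4 * delta) * spectral_norm (deflated M vs s))
              (Q^T *m nth 0 vs s)) <= e.
Proof.
move=> rn good s Q D sk ND; have /andP[e0 e1] := e01.
have VV := run_gram rn (ltnW sk).
have NE : deflate M (take s vs) = deflated M vs s by rewrite deflateE// rn.1 ltnW.
have [v' [ret r0 vE]] := rn.2 (Ordinal sk).
have gd := good s sk; rewrite -(run_lazy_seq rn (ltnW sk)) NE in gd.
rewrite /= NE in ret.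
have [_ /(_ _ ret)[v1 mass]] := pca_step (deflated_psd vs M_psd s) (deflated_norm_pos sk VV) sk gd.
rewrite [nth 0 vs s]vE /=.
exact: (projected_mass VV ND v1 (thr_ge0 _) (ltW e0) e1 (mass Q D ND)).2.
Qed.

(** A good start makes the call return, and [projected_mass] makes the Gram-Schmidt division
    legitimate. The latter needs the preceding vectors to be orthonormal, so both are obtained along
    one induction. *)
Lemma run_exists : (forall s, (s < k)%N -> good_start c (deflate M (lazy_seq s)) (w s)) ->
  run (lazy_seq k).
Proof.
move=> good; have /andP[e0 e1] := e01.
have step s : (s < k)%N -> (colmx s (lazy_seq s))^T *m colmx s (lazy_seq s) = 1%:M ->
    let V := colmx s (lazy_seq s) in
    let N := deflate M (lazy_seq s) in
    AppxPCA_returns A N (delta / 2) e (p / k%:R) (w s) (pca_fun N (w s)) /\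
    (1%:M - V *m V^T) *m pca_fun N (w s) != 0.
  move=> sk VV V N.
  have NE : N = deflated M (lazy_seq s) s.
    by rewrite -deflateE ?size_lazy_seq// take_oversize// size_lazy_seq.
  have gd := good s sk; rewrite -/N NE in gd.
  have [[x ret] /(_ x ret)[x1 mass]] :=
    pca_step (deflated_psd (lazy_seq s) M_psd s) (deflated_norm_pos sk VV) sk gd.
  rewrite -NE in ret; rewrite (pca_funE ret); split => //.
  have [Q [D ND]] := spectral_theorem (deflated_psd (lazy_seq s) M_psd s).1.
  exact: (projected_mass VV ND x1 (thr_ge0 _) (ltW e0) e1 (mass Q D ND)).1.
have gram s : (s <= k)%N -> (colmx s (lazy_seq s))^T *m colmx s (lazy_seq s) = 1%:M.
  elim: s => [|s IH] sk; first by apply/matrixP => -[].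
  have VV := IH (ltnW sk); have [_ r0] := step s sk VV.
  have E : colmx s (lazy_seq s.+1) = colmx s (lazy_seq s).
    by rewrite -[RHS](congr1 (colmx s) (take_lazy_seq (leqnSn s))) colmx_take.
  apply: (@gram_step R d (lazy_seq s.+1) s (pca_fun (deflate M (lazy_seq s)) (w s))); rewrite ?E//.
  by rewrite /= nth_rcons size_lazy_seq ltnn eqxx.
split; first exact: size_lazy_seq.
move=> s; have sk := ltn_ord s; exists (pca_fun (deflate M (lazy_seq s)) (w s)).
have [ret r0] := step s sk (gram s (ltnW sk)).
have T := take_lazy_seq (ltnW sk).
have E : colmx s (lazy_seq k) = colmx s (lazy_seq s) by rewrite -T colmx_take.
rewrite /= T E; split => //.
have -> : nth 0 (lazy_seq k) s = nth 0 (lazy_seq s.+1) s by rewrite -(take_lazy_seq sk) nth_take.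
by rewrite /= nth_rcons size_lazy_seq ltnn eqxx.
Qed.

End Runs.

(** * Measurability *)

Section BorelMatrix.
Import numFieldNormedType.Exports.
Local Open Scope classical_set_scope.
Local Open Scope ring_scope.
Context {R : realType} {dT : measure_display} {T : measurableType dT}.

Lemma measurable_entry m n (i : 'I_m) (j : 'I_n) :
  measurable_fun setT (fun N : borelM R m n => (N : 'M[R]_(m, n)) i j).
Proof.
move=> _ B mB; rewrite setTI; apply: sub_sigma_algebra.
by exists i, j, B.
Qed.

Lemma measurable_mxP m n (f : T -> 'M[R]_(m, n)) :
  measurable_fun setT (f : T -> borelM R m n) <->
  (forall i j, measurable_fun setT (fun t => f t i j)).
Proof.
split=> [mf i j|mf].
  exact: (measurableT_comp (measurable_entry i j) mf).
apply: (@measurability _ _ _ (borelM R m n) setT f (@entry_sets R m n)) => //.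
move=> _ [_ [i [j [B mB ->]]] <-].
by rewrite setTI; have := mf i j measurableT B mB; rewrite setTI.
Qed.

Lemma measurable_set_bool (b : T -> bool) :
  measurable_fun setT b -> measurable [set t | b t].
Proof. by move=> mb; have := mb measurableT [set true] I; rewrite setTI. Qed.

Lemma measurable_neqr (f g : T -> R) : measurable_fun setT f -> measurable_fun setT g ->
  measurable [set t | f t != g t].
Proof.
move=> mf mg; have -> : [set t | f t != g t] = ~` [set t | f t == g t].
  by apply/seteqP; split => t /= /negP.
by apply: measurableC; apply: measurable_set_bool; exact: measurable_fun_eqr.
Qed.

Lemma measurable_invr (f : T -> R) :
  measurable_fun setT f -> measurable_fun setT (fun t => (f t)^-1).
Proof.
(* Written with a real power of a nonnegative base; at f t = 0 both sides are 0. *)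
move=> mf; have -> : (fun t => (f t)^-1) = (fun t => f t * (f t ^+ 2) `^ (- 1)).
  apply/funext => t; rewrite powR_inv1 ?sqr_ge0//.
  have [->|f0] := eqVneq (f t) 0; first by rewrite invr0 mul0r.
  by rewrite expr2 invfM mulrA divff// mul1r.
apply: measurable_funM => //.
exact: (measurableT_comp (measurable_powR (- 1)) (measurable_funX 2 mf)).
Qed.

Lemma measurable_sqrt (f : T -> R) : (forall t, 0 <= f t) ->
  measurable_fun setT f -> measurable_fun setT (fun t => Num.sqrt (f t)).
Proof.
move=> f0 mf; have -> : (fun t => Num.sqrt (f t)) = (fun t => f t `^ 2^-1).
  by apply/funext => t; rewrite powR12_sqrt.
exact: (measurableT_comp (measurable_powR 2^-1) mf).
Qed.

Notation mmx f := (measurable_fun setT (f : T -> borelM R _ _)).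

Lemma measurable_mx_cst m n (N : 'M[R]_(m, n)) : mmx (fun=> N).
Proof. by apply/measurable_mxP => i j; exact: measurable_cst. Qed.

Lemma measurable_mulmx m n q (f : T -> 'M[R]_(m, n)) (g : T -> 'M[R]_(n, q)) :
  mmx f -> mmx g -> mmx (fun t => f t *m g t).
Proof.
move=> /measurable_mxP mf /measurable_mxP mg; apply/measurable_mxP => i j.
under eq_fun do rewrite mxE.
by apply: measurable_sum => l; apply: measurable_funM.
Qed.

Lemma measurable_subm m n (f g : T -> 'M[R]_(m, n)) :
  mmx f -> mmx g -> mmx (fun t => f t - g t).
Proof.
move=> /measurable_mxP mf /measurable_mxP mg; apply/measurable_mxP => i j.
by under eq_fun do rewrite !mxE; apply: measurable_funB.
Qed.

Lemma measurable_scalem m n (a : T -> R) (f : T -> 'M[R]_(m, n)) :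
  measurable_fun setT a -> mmx f -> mmx (fun t => a t *: f t).
Proof.
move=> ma /measurable_mxP mf; apply/measurable_mxP => i j.
by under eq_fun do rewrite !mxE; apply: measurable_funM.
Qed.

Lemma measurable_trmx m n (f : T -> 'M[R]_(m, n)) : mmx f -> mmx (fun t => (f t)^T).
Proof.
move=> /measurable_mxP mf; apply/measurable_mxP => i j.
by under eq_fun do rewrite mxE; exact: mf.
Qed.

Lemma measurable_dotv n (f g : T -> 'cV[R]_n) :
  mmx f -> mmx g -> measurable_fun setT (fun t => dotv (f t) (g t)).
Proof.
move=> mf mg; have /measurable_mxP := measurable_mulmx (measurable_trmx mf) mg.
exact.
Qed.

Lemma measurable_norm2 n (f : T -> 'cV[R]_n) :
  mmx f -> measurable_fun setT (fun t => norm2 (f t)).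
Proof.
move=> mf; have -> : (fun t => norm2 (f t)) = (fun t => Num.sqrt (dotv (f t) (f t))).
  by apply/funext => t; rewrite -norm2_sq sqrtr_sqr ger0_norm ?norm2_ge0.
apply: measurable_sqrt => [t|]; first exact: dotv_ge0.
exact: measurable_dotv.
Qed.

Lemma measurable_normalize n (f : T -> 'cV[R]_n) :
  mmx f -> mmx (fun t => normalize (f t)).
Proof.
by move=> mf; apply: measurable_scalem => //; apply: measurable_invr; exact: measurable_norm2.
Qed.

Lemma measurable_neq0 n (f : T -> 'cV[R]_n) : mmx f -> measurable [set t | f t != 0].
Proof.
move=> mf; have -> : [set t | f t != 0] = [set t | 0 < norm2 (f t)].
  by apply/seteqP; split => t /=; rewrite norm2_gt0.
apply: measurable_set_bool; apply: measurable_fun_ltr; first exact: measurable_cst.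
exact: measurable_norm2.
Qed.

Lemma measurable_mxpow n (f : T -> 'M[R]_n) j : mmx f -> mmx (fun t => mxpow (f t) j).
Proof.
move=> mf; elim: j => [|j IH]; first exact: measurable_mx_cst.
exact: measurable_mulmx.
Qed.

Lemma measurable_trace n (f : T -> 'M[R]_n) : mmx f -> measurable_fun setT (fun t => \tr (f t)).
Proof. by move=> /measurable_mxP mf; apply: measurable_sum => i; exact: mf. Qed.

(** Here the form of [good_start] pays off: a countable intersection of inequalities between
    polynomials in the entries, with no choice of eigenvectors. *)
Lemma measurable_good_start n c (N : T -> 'M[R]_n) (w : T -> 'cV[R]_n) :
  mmx N -> mmx w -> measurable [set t | good_start c (N t) (w t)].
Proof.
move=> mN mw.
have -> : [set t | good_start c (N t) (w t)] = \bigcap_(i in [set: nat]) \bigcap_(j in [set: nat])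
    [set t | (c ^+ 2) ^+ j * \tr (mxpow (N t) j) ^+ (2 * i) <=
      (norm2 (mxpow (N t) i *m w t) ^+ 2) ^+ j * n%:R ^+ (2 * i)].
  apply/seteqP; split => t /=; first by move=> h i _ j _; exact: h.
  by move=> h i j; exact: h.
apply: bigcap_measurable => // i _; apply: bigcap_measurable => // j _.
apply: measurable_set_bool; apply: measurable_fun_ler; apply: measurable_funM; try exact: measurable_cst.
  by apply: measurable_funX; apply: measurable_trace; exact: measurable_mxpow.
do 2 apply: measurable_funX; apply: measurable_norm2; apply: measurable_mulmx => //.
exact: measurable_mxpow.
Qed.

End BorelMatrix.

Section MeasurableRun.
Import numFieldNormedType.Exports.
Local Open Scope classical_set_scope.
Local Open Scope ring_scope.
Context {R : realType} {dT : measure_display} {T : measurableType dT}.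
Notation mmx f := (measurable_fun setT (f : T -> borelM R _ _)).

(** The pieces will be the events that the loop of [AppxPCA] ends at pass f; on each the output is
    an explicit composition of queries, and elsewhere the default 0. *)
Lemma measurable_piecewise m n (F : nat -> set T) (g : nat -> T -> 'M[R]_(m, n)) (h : T -> 'M[R]_(m, n)) :
  (forall f, measurable (F f)) -> (forall f, mmx (g f)) ->
  (forall f t, F f t -> h t = g f t) -> (forall t, (forall f, ~ F f t) -> h t = 0) -> mmx h.
Proof.
move=> mF mg hg h0 _ B mB; rewrite setTI.
have -> : (h : T -> borelM R m n) @^-1` B = (\bigcup_f (F f `&` (g f : T -> borelM R m n) @^-1` B)) `|`
    ((~` \bigcup_f F f) `&` ((fun=> 0) : T -> borelM R m n) @^-1` B).
  apply/seteqP; split => t /=.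
    move=> Bt; have [[f _ Ft]|nF] := pselect ((\bigcup_f F f) t).
      by left; exists f => //; split => //=; rewrite -(hg f t Ft).
    right; split => //=; rewrite -(h0 t) //.
    by move=> f Ft; apply: nF; exists f.
  case=> [[f _ [Ft /=]]|[nF /=]]; first by rewrite (hg f t Ft).
  by rewrite h0// => f Ft; apply: nF; exists f.
apply: measurableU.
  apply: bigcup_measurable => f _; apply: measurableI => //.
  by have := mg f measurableT B mB; rewrite setTI.
apply: measurableI.
  by apply: measurableC; apply: bigcup_measurable.
by have := @measurable_mx_cst R dT T m n 0 measurableT B mB; rewrite setTI.
Qed.

Variables (d : nat) (dZ : measure_display) (Z : measurableType dZ) (A : Z -> inv_method R d).
Hypothesis A_meas : measurable_method A.
Variables (z : T -> Z).
Hypothesis z_meas : measurable_fun setT z.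

Lemma measurable_query (l : T -> R) (N : T -> 'M[R]_d) (b : T -> 'cV[R]_d) (eta : R) :
  measurable_fun setT l -> mmx N -> mmx b -> mmx (fun t => A (z t) (l t) (N t) (b t) eta).
Proof.
move=> ml mN mb.
pose q (t : T) : Z * R * borelM R d d * borelM R d 1 * R := (z t, l t, N t, b t, eta).
have mq : measurable_fun setT q.
  do 4 apply: measurable_fun_pair => //.
exact: (measurableT_comp A_meas mq).
Qed.

Section Call.
Variables (N : T -> 'M[R]_d) (w0 : T -> 'cV[R]_d) (delta e p : R).
Hypotheses (N_meas : mmx N) (w_meas : mmx w0).

Lemma measurable_inv_power (l : T -> R) eta m : measurable_fun setT l ->
  mmx (fun t => inv_power (A (z t)) (N t) (w0 t) (l t) eta m).
Proof.
move=> ml; elim: m => [//|m IH].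
exact: (measurable_query eta ml N_meas IH).
Qed.

Lemma measurable_pca_w (l : T -> R) : measurable_fun setT l ->
  mmx (fun t => pca_w (A (z t)) (N t) delta p (w0 t) (l t)).
Proof. by move=> ml; apply: measurable_normalize; exact: measurable_inv_power. Qed.

Lemma measurable_pca_dot (l : T -> R) : measurable_fun setT l ->
  measurable_fun setT (fun t => dotv (pca_w (A (z t)) (N t) delta p (w0 t) (l t))
                                     (pca_v (A (z t)) (N t) delta p (w0 t) (l t))).
Proof.
move=> ml; have mw := measurable_pca_w ml; apply: measurable_dotv => //.
exact: measurable_query.
Qed.

Lemma measurable_pca_gap (l : T -> R) : measurable_fun setT l ->
  measurable_fun setT (fun t => pca_gap (A (z t)) (N t) delta p (w0 t) (l t)).
Proof.
move=> ml; apply: measurable_funM; first exact: measurable_cst.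
apply: measurable_invr; apply: measurable_funB; last exact: measurable_cst.
exact: measurable_pca_dot.
Qed.

Lemma measurable_pca_shift s :
  measurable_fun setT (fun t => pca_shift (A (z t)) (N t) delta p (w0 t) s).
Proof.
elim: s => [|s IH]; first exact: measurable_cst.
apply: measurable_funB => //; apply: measurable_funM; last exact: measurable_cst.
exact: measurable_pca_gap.
Qed.

Lemma measurable_pca_stop s :
  measurable_fun setT (fun t => pca_stop (A (z t)) (N t) delta p (w0 t) s).
Proof.
apply: measurable_fun_ler; first exact: measurable_pca_gap (measurable_pca_shift _).
apply: measurable_funM; last exact: measurable_cst.
by apply: measurable_funM; [exact: measurable_cst|exact: measurable_pca_shift].
Qed.

Lemma measurable_pca_defined s :
  measurable [set t | pca_defined (A (z t)) (N t) delta p (w0 t) s].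
Proof.
apply: measurableI; first exact: measurable_neq0 (measurable_inv_power _ _ (measurable_pca_shift _)).
apply: measurable_neqr; last exact: measurable_cst.
exact: measurable_pca_dot (measurable_pca_shift _).
Qed.

Let valid f t := [/\ (0 < f)%N,
  forall s, (0 < s <= f)%N -> pca_defined (A (z t)) (N t) delta p (w0 t) s /\
     pca_stop (A (z t)) (N t) delta p (w0 t) s = (s == f) &
  inv_power (A (z t)) (N t) (w0 t) (pca_shift (A (z t)) (N t) delta p (w0 t) f)
    (@pca_eps2 R d delta e p) (@pca_m2 R d e p) != 0].

Lemma measurable_valid f : measurable [set t | valid f t].
Proof.
have [f0|f0] := boolP (0 < f)%N; last first.
  suff -> : [set t | valid f t] = set0 by [].
  by apply/seteqP; split => t //= [h]; rewrite h in f0.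
have -> : [set t | valid f t] = (\bigcap_(s in [set s | (0 < s <= f)%N])
    ([set t | pca_defined (A (z t)) (N t) delta p (w0 t) s] `&`
     [set t | pca_stop (A (z t)) (N t) delta p (w0 t) s = (s == f)])) `&`
   [set t | inv_power (A (z t)) (N t) (w0 t) (pca_shift (A (z t)) (N t) delta p (w0 t) f)
    (@pca_eps2 R d delta e p) (@pca_m2 R d e p) != 0].
  by apply/seteqP; split => t /= => [[_ h1 h2]|[h1 h2]]; split => // s hs; exact: h1.
apply: measurableI; last exact: measurable_neq0 (measurable_inv_power _ _ (measurable_pca_shift _)).
apply: bigcap_measurable => [|s _]; first by exists f; rewrite /= f0 /=.
apply: measurableI; first exact: measurable_pca_defined.
by have mst := measurable_pca_stop s; have := mst measurableT [set s == f] I; rewrite setTI.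
Qed.

Lemma measurable_AppxPCA (h : T -> 'cV[R]_d) :
  (forall t, h t = xget 0 [set x | AppxPCA_returns (A (z t)) (N t) delta e p (w0 t) x]) -> mmx h.
Proof.
move=> hE; apply: (@measurable_piecewise _ _ (fun f => [set t | valid f t])
  (fun f t => normalize (inv_power (A (z t)) (N t) (w0 t)
     (pca_shift (A (z t)) (N t) delta p (w0 t) f) (@pca_eps2 R d delta e p) (@pca_m2 R d e p)))).
- exact: measurable_valid.
- by move=> f; apply: measurable_normalize; apply: measurable_inv_power; exact: measurable_pca_shift.
- move=> f t /= [f0 h1 h2]; rewrite hE; set S := [set x | _].
  have Sx : S (normalize (inv_power (A (z t)) (N t) (w0 t)
     (pca_shift (A (z t)) (N t) delta p (w0 t) f) (@pca_eps2 R d delta e p) (@pca_m2 R d e p))) by exists f.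
  have := @xgetPex _ 0 S (ex_intro _ _ Sx); rewrite {1}/S /= => ret.
  exact: AppxPCA_returns_unique ret Sx.
move=> t nv; rewrite hE; apply: xgetPN => x [f [f0 h1 h2 _]].
by apply: (nv f).
Qed.

End Call.

Section State.
Variables (M : 'M[R]_d) (k : nat) (delta e p : R) (w : nat -> T -> 'cV[R]_d).

Let st t s := lazy_seq (A (z t)) M k delta e p (fun s => w s t) s.

(** The deflated matrix and V V^T are all that the next step reads from the past, and unlike the
    list they have a fixed matrix type. Both are carried through the induction together. *)
Lemma measurable_state s : (forall r, (r < s)%N -> mmx (w r)) ->
  mmx (fun t => deflate M (st t s)) /\
  mmx (fun t => colmx s (st t s) *m (colmx s (st t s))^T).
Proof.
elim: s => [|s IH] mw.
  split; first exact: measurable_mx_cst.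
  have -> : (fun t => colmx 0 (st t 0) *m (colmx 0 (st t 0))^T) = (fun=> 0).
    by apply/funext => t; apply/matrixP => i j; rewrite !mxE big_ord0.
  exact: measurable_mx_cst.
have [mN mV] := IH (fun r rs => mw r (ltnW rs)).
have mone : mmx (fun=> 1%:M : 'M[R]_d) by exact: measurable_mx_cst.
pose v t := normalize ((1%:M - colmx s (st t s) *m (colmx s (st t s))^T) *m
  pca_fun (A (z t)) k delta e p (deflate M (st t s)) (w s t)).
have mv : mmx v.
  apply: measurable_normalize; apply: measurable_mulmx; first exact: measurable_subm.
  by apply: (measurable_AppxPCA mN (mw s (ltnSn s))) => t.
have mvv : mmx (fun t => v t *m (v t)^T).
  by apply: measurable_mulmx => //; exact: measurable_trmx.
have mP : mmx (fun t => 1%:M - v t *m (v t)^T) by exact: measurable_subm.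
split.
  have -> : (fun t => deflate M (st t s.+1)) =
      (fun t => (1%:M - v t *m (v t)^T) *m deflate M (st t s) *m (1%:M - v t *m (v t)^T)).
    by apply/funext => t; rewrite /st /= /deflate foldl_rcons.
  by apply: measurable_mulmx => //; exact: measurable_mulmx.
have -> : (fun t => colmx s.+1 (st t s.+1) *m (colmx s.+1 (st t s.+1))^T) =
   (fun t => colmx s (st t s) *m (colmx s (st t s))^T - (0 - v t *m (v t)^T)).
  apply/funext => t; rewrite colmx_outerS sub0r opprK.
  have sz : size (st t s) = s by exact: size_lazy_seq.
  have -> : nth 0 (st t s.+1) s = v t by rewrite /= nth_rcons sz ltnn eqxx.
  have -> : colmx s (st t s.+1) = colmx s (st t s).
    by apply/matrixP => i j; rewrite !mxE /st /= nth_rcons -/(st t s) sz ltn_ord.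
  by [].
apply: measurable_subm => //; apply: measurable_subm => //; exact: measurable_mx_cst.
Qed.

Lemma measurable_good s c : (forall r, (r < s)%N -> mmx (w r)) -> mmx (w s) ->
  measurable [set t | good_start c (deflate M (st t s)) (w s t)].
Proof. by move=> mw ms; apply: measurable_good_start => //; exact: (measurable_state mw).1. Qed.

End State.

End MeasurableRun.

(** * Anti-concentration on the sphere *)

Section Grid.
Local Open Scope ring_scope.
Context {R : realType}.

(** The first and the last hit of an arithmetic progression with difference z are at most 2 r apart,
    which bounds the number of indices between them. *)
Lemma card_ap_hits (N : nat) (y z r : R) (S : pred 'I_N) : z != 0 -> 0 <= r ->
  (forall b, S b -> `|y + z * (nat_of_ord b)%:R| <= r) -> #|S|%:R <= 2 * r / `|z| + 1.
Proof.
move=> z0 r0 hS; have z1 : 0 < `|z| by rewrite normr_gt0.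
have [/eqP S0|] := boolP (#|S| == 0)%N; first by rewrite S0 addr_ge0// divr_ge0// mulr_ge0.
rewrite -lt0n => /card_gt0P[b0 Sb0]; rewrite unfold_in in Sb0.
pose lo := [arg min_(b < b0 | S b) nat_of_ord b].
pose hi := [arg max_(b > b0 | S b) nat_of_ord b].
have [Slo lomin] : S lo /\ forall b, S b -> (lo <= b)%N.
  by rewrite /lo; case: arg_minnP.
have [Shi himax] : S hi /\ forall b, S b -> (b <= hi)%N.
  by rewrite /hi; case: arg_maxnP.
have card : (#|S| <= (hi - lo).+1)%N.
  rewrite cardE -(size_map val) -(size_iota lo (hi - lo).+1).
  apply: uniq_leq_size; first by rewrite map_inj_uniq ?enum_uniq//; exact: val_inj.
  move=> _ /mapP[b + ->]; rewrite mem_enum unfold_in => Sb.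
  rewrite mem_iota; have := lomin b Sb; have := himax b Sb; rewrite /=; lia.
apply: (@le_trans _ _ ((hi - lo)%N%:R + 1)); first by rewrite natr1 ler_nat.
rewrite lerD2r ler_pdivlMr// natrB; last exact: lomin.
have h1 := hS _ Shi; have h2 := hS _ Slo.
rewrite -[(nat_of_ord hi)%:R - _]ger0_norm ?subr_ge0 ?ler_nat ?lomin// -normrM.
have -> : (hi%:R - lo%:R) * z = (y + z * hi%:R) - (y + z * lo%:R) by ring.
by apply: le_trans (ler_normB _ _) _; rewrite mulr_natl mulr2n lerD.
Qed.

Variables (d N : nat).
Hypotheses (d0 : (0 < d)%N) (N0 : (0 < N)%N).

(** Coordinates run over 1/N, ..., 1; starting above 0 keeps every grid point nonzero, so that it
    can be normalized. *)
Definition grid (a : {ffun 'I_d -> 'I_N}) : 'cV[R]_d := \col_i ((a i).+1%:R / N%:R).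

Lemma grid_norm a : norm2 (grid a) ^+ 2 <= d%:R.
Proof.
rewrite norm2_sqE; apply: (@le_trans _ _ (\sum_(i < d) 1)).
  apply: ler_sum => i _; rewrite mxE exprn_ile1 ?divr_ge0// ler_pdivrMr ?ltr0n// mul1r ler_nat.
  by [].
by rewrite sumr_const card_ord.
Qed.

Lemma grid_neq0 a : grid a != 0.
Proof.
apply/eqP => /colP/(_ (Ordinal d0)); rewrite !mxE; apply/eqP.
by rewrite mulf_neq0 ?invr_neq0// pnatr_eq0 // -lt0n.
Qed.

(* Replacing the i-th coordinate of a by b and remembering the old one is an
   involution, so the i-th coordinate can be averaged separately. *)
Lemma sum_update (i : 'I_d) (F : {ffun 'I_d -> 'I_N} -> R) :
  N%:R * \sum_a F a = \sum_(a : {ffun 'I_d -> 'I_N}) \sum_(b : 'I_N) F [ffun j => if j == i then b else a j].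
Proof.
pose upd (x : {ffun 'I_d -> 'I_N} * 'I_N) : {ffun 'I_d -> 'I_N} * 'I_N :=
  ([ffun j => if j == i then x.2 else x.1 j], x.1 i).
have updK : involutive upd.
  move=> [a b]; rewrite /upd /=; congr (_, _); last by rewrite ffunE eqxx.
  by apply/ffunP => j; rewrite !ffunE; case: eqP => [->|].
transitivity (\sum_x F (upd x).1); last by rewrite pair_bigA.
rewrite (reindex_inj (inv_inj updK)).
under [RHS]eq_bigr => x _ do rewrite updK.
rewrite -(pair_bigA _ (fun a _ => F a)) /= big_distrr /=.
by apply: eq_bigr => a _; rewrite sumr_const card_ord mulr_natl.
Qed.

(** Grid points have norm at most sqrt d, which explains the threshold. Some coordinate of x is at
    least 1/sqrt d in absolute value; along it the inner products form progressions with difference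
    at least 1/(N sqrt d), so at most 2 c d N + 1 of every N points are hit. *)
Lemma grid_hits (x : 'cV[R]_d) (c : R) : norm2 x = 1 -> 0 <= c ->
  \sum_(a : {ffun 'I_d -> 'I_N}) (`|dotv (grid a) x| <= c * Num.sqrt d%:R)%R%:R <=
  (2 * c * d%:R + N%:R^-1) * #|{: {ffun 'I_d -> 'I_N}}|%:R.
Proof.
move=> x1 c0.
have dR : 0 < d%:R :> R by rewrite ltr0n.
have NR : 0 < N%:R :> R by rewrite ltr0n.
have sd0 : 0 < Num.sqrt d%:R :> R by rewrite sqrtr_gt0.
have [i xi] : exists i, 1 <= Num.sqrt d%:R * `|x i 0|.
  apply/existsP; apply: contraT; rewrite negb_exists => /forallP h.
  have : norm2 x ^+ 2 < 1.
    rewrite norm2_sqE; apply: (@lt_le_trans _ _ (\sum_(i < d) d%:R^-1)); last first.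
      by rewrite sumr_const card_ord -[X in X <= _]mulr_natl divff// gt_eqF.
    apply: ltr_sum; first by apply/hasP; exists (Ordinal d0); rewrite ?mem_index_enum.
    move=> j _; have := h j; rewrite -ltNge => hj.
    rewrite -[X in _ < X]mul1r ltr_pdivlMr// -[x j 0 ^+ 2]real_normK ?num_real//.
    have -> : d%:R = Num.sqrt d%:R ^+ 2 :> R by rewrite sqr_sqrtr// ltW.
    by rewrite mulrC -exprMn expr_lt1// mulr_ge0// ltW.
  by rewrite x1 expr1n ltxx.
rewrite -(ler_pM2l NR) (sum_update i).
have -> : N%:R * ((2 * c * d%:R + N%:R^-1) * #|{: {ffun 'I_d -> 'I_N}}|%:R) =
    \sum_(a : {ffun 'I_d -> 'I_N}) (2 * c * d%:R * N%:R + 1).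
  by rewrite sumr_const -[RHS]mulr_natl mulrA mulrDr mulfV ?gt_eqF//; ring.
apply: ler_sum => a _.
pose y := \sum_(j | j != i) (a j).+1%:R / N%:R * x j 0 + x i 0 / N%:R.
have gE b : dotv (grid [ffun j => if j == i then b else a j]) x = y + x i 0 / N%:R * b%:R.
  rewrite dotvE (bigD1 i)//= /y mxE ffunE eqxx -[b.+1%:R]natr1.
  under eq_bigr => j ji do rewrite mxE ffunE (negbTE ji).
  by field; rewrite gt_eqF.
have z0 : x i 0 / N%:R != 0.
  rewrite mulf_neq0 ?invr_neq0 ?(gt_eqF NR)//; apply/eqP => xi0.
  by move: xi; rewrite xi0 normr0 mulr0 ler10.
have := @card_ap_hits N y (x i 0 / N%:R) (c * Num.sqrt d%:R)
  (fun b => `|dotv (grid [ffun j => if j == i then b else a j]) x| <= c * Num.sqrt d%:R) z0 _ _.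
rewrite -sum1_card natr_sum big_mkcond /= => H.
apply: le_trans (_ : _ <= 2 * (c * Num.sqrt d%:R) / `|x i 0 / N%:R| + 1) _.
  apply: le_trans (H _ _); last 2 first.
  - by rewrite mulr_ge0// ltW.
  - by move=> b; rewrite gE.
  by apply: ler_sum => b _; rewrite unfold_in; case: ifP.
rewrite lerD2r normrM normfV [`|N%:R|]ger0_norm ?ler0n// ler_pdivrMr.
  have -> : 2 * c * d%:R * N%:R * (`|x i 0| / N%:R) = 2 * c * d%:R * `|x i 0| by field; rewrite gt_eqF.
  have -> : 2 * c * d%:R * `|x i 0| = 2 * (c * Num.sqrt d%:R) * (Num.sqrt d%:R * `|x i 0|).
    have {1}-> : d%:R = Num.sqrt d%:R ^+ 2 :> R by rewrite sqr_sqrtr// ltW.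
    ring.
  by rewrite ler_peMr// !mulr_ge0// ltW.
by rewrite divr_gt0// normr_gt0; apply: contraTneq xi => ->; rewrite normr0 mulr0 ler10.
Qed.

End Grid.

Section SmallBall.
Import numFieldNormedType.Exports.
Local Open Scope classical_set_scope.
Local Open Scope ring_scope.
Context {R : realType} {d : nat} {dT : measure_display} {T : measurableType dT}.
Variables (P : probability T R) (X : T -> 'cV[R]_d).
Hypotheses (d0 : (0 < d)%N) (X_unif : uniform_unit_vector P X).

Let slab (q : 'cV[R]_d) (c : R) : set (borelM R d 1) := [set x | `|dotv q x| < c].

Lemma measurable_slab q c : measurable (slab q c).
Proof.
apply: measurable_set_bool; apply: measurable_fun_ltr; last exact: measurable_cst.
have m : measurable_fun setT (fun x : borelM R d 1 => dotv q x).
  by apply: measurable_dotv; [exact: measurable_mx_cst|exact: measurable_id].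
exact: (measurableT_comp (@normr_measurable R setT) m).
Qed.

Lemma measurable_slab_pre q c : measurable [set t | `|dotv q (X t)| < c].
Proof.
have [mX _ _] := X_unif.
by have := mX measurableT _ (measurable_slab q c); rewrite setTI.
Qed.

(** The reflection taking q to q' is symmetric, so <q', X> = <q, H X>, and H X has the law of X. *)
Lemma slab_invariant q q' c : norm2 q = 1 -> norm2 q' = 1 ->
  P [set t | `|dotv q (X t)| < c] = P [set t | `|dotv q' (X t)| < c].
Proof.
move=> q1 q1'; have [mX _ inv] := X_unif.
have [H [HH HT Hq]] : exists H : 'M[R]_d, [/\ H^T *m H = 1%:M, H^T = H & H *m q = q'].
  by apply: householder; rewrite q1 q1'.
have := inv H HH (slab q c) (measurable_slab q c); rewrite /slab /= => <-.
by congr (P _); apply/seteqP; split => t /=; rewrite -Hq (sym_mxP _ _ HT).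
Qed.

(** All slabs have the same probability, so it equals the expected proportion of grid directions
    that are hit, which [grid_hits] bounds pointwise. The term 1/N disappears as the grid is
    refined. *)
Lemma small_ball (q : 'cV[R]_d) (c : R) : norm2 q = 1 -> 0 <= c ->
  (P [set t | (`|dotv q (X t)| < c)%R] <= (2 * c * d%:R)%:E)%E.
Proof.
move=> q1 c0; have [_ X1 _] := X_unif.
set r := P _; have rfin : r \is a fin_num by apply: fin_num_measure; exact: measurable_slab_pre.
have key N : (0 < N)%N -> fine r <= 2 * c * d%:R + N%:R^-1.
  move=> N0; pose G := {ffun 'I_d -> 'I_N}.
  have sd0 : 0 < Num.sqrt d%:R :> R by rewrite sqrtr_gt0 ltr0n.
  pose S (a : G) : set T := [set t | `|dotv (normalize (@grid R d N a)) (X t)| < c].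
  have mS a : measurable (S a) by exact: measurable_slab_pre.
  have PS a : P (S a) = r.
    by apply: slab_invariant => //; apply: norm2_normalize; exact: grid_neq0.
  have hit a t : S a t -> `|dotv (@grid R d N a) (X t)| <= c * Num.sqrt d%:R.
    have g0 : 0 < norm2 (@grid R d N a) by rewrite norm2_gt0 grid_neq0.
    rewrite /S /= dotvZl normrM [X in X * _ < _]ger0_norm ?invr_ge0 ?norm2_ge0//.
    rewrite mulrC ltr_pdivrMr// => /ltW h.
    apply: le_trans h _; rewrite ler_wpM2l// -(@ler_pXn2r _ 2%N) ?nnegrE ?norm2_ge0 ?sqrtr_ge0//.
    by rewrite [X in _ <= X]sqr_sqrtr ?ler0n// grid_norm.
  have G0 : 0 < #|{: G}|%:R :> R.
    rewrite ltr0n; apply/card_gt0P; exists [ffun=> Ordinal N0]; by [].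
  have : (\sum_(a : G) P (S a) <= ((2 * c * d%:R + N%:R^-1) * #|{: G}|%:R)%:E)%E.
    have -> : (\sum_(a : G) P (S a) = \int[P]_t (\sum_(a : G) (\1_(S a) t)%:E))%E.
      rewrite ge0_integral_sum//.
      - by apply: eq_bigr => a _; rewrite integral_indic// setIT.
      - by move=> a; apply/measurable_EFinP; exact: measurable_indic.
    apply: (@le_trans _ _ (\int[P]_t (cst ((2 * c * d%:R + N%:R^-1) * #|{: G}|%:R)%:E t))%E).
      apply: ge0_le_integral => //.
      - by move=> t _; apply: sume_ge0 => a _; rewrite lee_fin.
      - by apply: emeasurable_sum => a; apply/measurable_EFinP; exact: measurable_indic.
      - move=> t _; rewrite sumEFin lee_fin.
        apply: le_trans (grid_hits d0 N0 (X1 t) c0); apply: ler_sum => a _.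
        rewrite indicE; have [/set_mem h|] := boolP (t \in S a); last by rewrite ler0n.
        by rewrite (hit a t h).
    by rewrite integral_cst// [X in (_ * X)%E]probability_setT mule1.
  under eq_bigr => a _ do rewrite PS.
  rewrite -(fineK rfin) sumEFin lee_fin sumr_const -[X in X <= _]mulr_natr.
  by rewrite ler_pM2r.
rewrite -(fineK rfin) lee_fin; apply/ler_addgt0Pr => x x0.
have [N /= hN] : exists N : nat, x^-1 <= N.+1%:R.
  by exists (Num.bound x^-1); rewrite ltW// (lt_le_trans (archi_boundP _)) ?invr_ge0 ?(ltW x0) ?ler_nat.
apply: le_trans (key N.+1 _) _ => //; rewrite lerD2l.
by rewrite -[x]invrK lef_pV2 ?posrE ?invr_gt0 ?ltr0n.
Qed.

End SmallBall.

(** * Independence and the good event *)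

Section IndependentSections.
Local Open Scope classical_set_scope.
Local Open Scope ring_scope.
Local Open Scope ereal_scope.
Context {R : realType} {dT d1 d2 : measure_display} {T : measurableType dT}
  {T1 : measurableType d1} {T2 : measurableType d2}.
Variables (P : probability T R) (X : T -> T1) (Y : T -> T2).
Hypotheses (mX : measurable_fun setT X) (mY : measurable_fun setT Y).
Hypothesis indep : forall A B, measurable A -> measurable B ->
  P (X @^-1` A `&` Y @^-1` B) = P (X @^-1` A) * P (Y @^-1` B).

HB.instance Definition _ := isMeasurableFun.Build _ _ _ _ X mX.
HB.instance Definition _ := isMeasurableFun.Build _ _ _ _ Y mY.
Let XY t := (X t, Y t).
Let mXY : measurable_fun setT XY.
Proof. exact: measurable_fun_pair. Qed.
HB.instance Definition _ := isMeasurableFun.Build _ _ _ _ XY mXY.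

(** By independence the joint law is the product of the two laws, and the product measure integrates
    the measures of the sections. *)
Lemma independent_section_le (S : set (T1 * T2)) (r : R) : measurable S ->
  (forall x, P [set t | S (x, Y t)] <= r%:E) -> P [set t | S (X t, Y t)] <= r%:E.
Proof.
move=> mS hS.
have E : (distribution P X \x distribution P Y) S = distribution P XY S.
  apply: product_measure_unique mS => A B mA mB; rewrite /distribution /pushforward.
  exact: indep.
have -> : P [set t | S (X t, Y t)] = distribution P XY S by [].
rewrite -E /product_measure1.
have r0 : 0 <= r%:E.
  by apply: le_trans (hS (X point)).
apply: (@le_trans _ _ (\int[distribution P X]_x (cst r%:E x))).
  apply: ge0_le_integral => //.
  - exact: measurable_fun_xsection.
  - move=> x _ /=; apply: le_trans (hS x); rewrite /distribution /pushforward.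
    rewrite le_eqVlt; apply/orP; left; apply/eqP; congr (P _).
    by apply/seteqP; split => t; rewrite /= /xsection /= in_setE.
by rewrite integral_cst// [X in _ * X]probability_setT mule1.
Qed.

End IndependentSections.

Section Past.
Import numFieldNormedType.Exports.
Local Open Scope classical_set_scope.
Local Open Scope ring_scope.
Context {R : realType} {d k : nat} {dT dZ : measure_display} {T : measurableType dT}
  {Z : measurableType dZ}.
Variables (P : probability T R) (xi : T -> Z) (w : 'I_k -> T -> 'cV[R]_d).
Hypotheses (xi_meas : measurable_fun setT xi)
  (w_meas : forall s, measurable_fun setT (w s : T -> borelM R d 1))
  (w_indep : mutually_independent P xi w).

Definition past_sets (s : nat) : set (set T) :=
  [set F | exists2 C : set Z, measurable C & exists2 B : 'I_k -> set (borelM R d 1),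
     (forall r, measurable (B r)) /\ (forall r : 'I_k, (s <= r)%N -> B r = setT) &
     F = [set t | C (xi t) /\ forall r, B r (w r t)]].

(** The sample space with the coarser sigma-algebra of xi and w_0, ..., w_(s-1). Dependence on the
    past thus becomes ordinary measurability on another type with the same points. *)
Definition past s := g_sigma_algebraType (past_sets s).

Lemma past_sets_measurable s : past_sets s `<=` measurable.
Proof.
move=> _ [C mC [B [mB _] ->]].
have -> : [set t | C (xi t) /\ forall r, B r (w r t)] =
    xi @^-1` C `&` \bigcap_(r in [set: 'I_k]) (w r) @^-1` (B r).
  by apply/seteqP; split => t /= [h1 h2]; split => // r; [move=> _; exact: h2|exact: (h2 r I)].
apply: measurableI; first by have := xi_meas measurableT mC; rewrite setTI.
apply: fin_bigcap_measurable => [|r _]; first exact: finite_finset.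
by have mw := w_meas r; have := mw measurableT _ (mB r); rewrite setTI.
Qed.

Lemma past_measurable s (F : set T) : measurable (F : set (past s)) -> measurable F.
Proof.
move=> mF; have := smallest_sub (@sigma_algebra_measurable _ T) (@past_sets_measurable s).
exact.
Qed.

Lemma measurable_past_xi s : measurable_fun setT (xi : past s -> Z).
Proof.
move=> _ C mC; rewrite setTI; apply: sub_sigma_algebra.
exists C => //; exists (fun=> setT) => //.
by apply/seteqP; split => t //= [].
Qed.

Lemma measurable_past_w s (r : 'I_k) : (r < s)%N ->
  measurable_fun setT (w r : past s -> borelM R d 1).
Proof.
move=> rs _ B mB; rewrite setTI; apply: sub_sigma_algebra.
exists setT => //; exists (fun r' => if r' == r then B else setT).
  split=> [r'|r' sr']; first by case: eqP.
  by case: eqP => // E; move: sr'; rewrite E leqNgt rs.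
apply/seteqP; split => t /=.
  by move=> Bt; split => // r'; case: eqP => // ->.
by move=> [_ /(_ r)]; rewrite eqxx.
Qed.

Lemma past_sets_setI s : setI_closed (past_sets s).
Proof.
move=> _ _ [C mC [B [mB Bs] ->]] [C' mC' [B' [mB' Bs'] ->]].
exists (C `&` C'); first exact: measurableI.
exists (fun r => B r `&` B' r).
  by split=> r; [exact: measurableI|move=> sr; rewrite Bs// Bs'// setTI].
apply/seteqP; split => t /=; first by move=> [[h1 h2] [h3 h4]]; split.
by move=> [[h1 h2] h3]; split; split => // r; have [] := h3 r.
Qed.

(** Uniqueness of measures on a pi-system: F |-> P (F and W) and F |-> P F * P W are finite measures
    that agree on the generating rectangles. *)
Lemma past_independent (s : 'I_k) (F : set T) (B : set (borelM R d 1)) :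
  measurable (F : set (past s)) -> measurable B ->
  (P (F `&` w s @^-1` B) = P F * P (w s @^-1` B))%E.
Proof.
move=> mF mB.
have mW : measurable (w s @^-1` B).
  by have mw := w_meas s; have := mw measurableT _ mB; rewrite setTI.
have wfin : P (w s @^-1` B) \is a fin_num by exact: fin_num_measure.
pose a : {nonneg R} := NngNum (fine_ge0 (measure_ge0 P (w s @^-1` B))).
have aE : (a%:num)%:E = P (w s @^-1` B) by exact: fineK.
suff : mrestr P mW F = mscale a P F by rewrite /mscale /mrestr aE muleC.
apply: (@g_sigma_algebra_measure_unique _ R T (past_sets s) (@past_sets_measurable s)
  (fun=> setT) _ _ (mrestr P mW) (mscale a P) (@past_sets_setI s)) => //.
- move=> _; exists setT => //; exists (fun=> setT) => //.
  by apply/seteqP; split.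
- by apply/seteqP; split => // t _; exists 0%N.
- move=> _ [C mC [B' [mB' Bs'] ->]].
  (* A rectangle of the past leaves slot s free, so B can be inserted there and mutual independence
     applied to the result. *)
  pose B2 r := if r == s then B else B' r.
  have mB2 r : measurable (B2 r) by rewrite /B2; case: eqP.
  rewrite /= /mscale /mrestr aE muleC.
  have -> : [set t | C (xi t) /\ forall r, B' r (w r t)] `&` w s @^-1` B =
      [set t | C (xi t) /\ forall r, B2 r (w r t)].
    apply/seteqP; split => t /=.
      by move=> [[h1 h2] h3]; split => // r; rewrite /B2; case: eqP => [->|].
    move=> [h1 h2]; split; last by have := h2 s; rewrite /B2 eqxx.
    split=> // r; have := h2 r; rewrite /B2; case: eqP => // -> _.
    by rewrite Bs'.
  rewrite w_indep// [X in _ = (X * _)%E]w_indep// (bigD1 s)//= [in RHS](bigD1 s)//= Bs'//.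
  have -> : P [set t | setT (w s t)] = 1%E by exact: probability_setT.
  rewrite mul1e /B2 eqxx -muleA; congr (_ * _)%E; rewrite muleC; congr (_ * _)%E.
  by apply: eq_bigr => r /negbTE ->.
- move=> _; rewrite /= /mrestr setTI; apply: le_lt_trans (probability_le1 P mW) _; exact: ltry.
Qed.

End Past.

Section GoodEvent.
Import numFieldNormedType.Exports.
Local Open Scope classical_set_scope.
Local Open Scope ring_scope.
Context {R : realType} {d k : nat} {dT dZ : measure_display} {T : measurableType dT}
  {Z : measurableType dZ}.
Variables (A : Z -> inv_method R d) (M : 'M[R]_d) (delta e p : R)
  (P : probability T R) (xi : T -> Z) (w0 : 'I_k -> T -> 'cV[R]_d).
Hypotheses (A_meas : measurable_method A) (M_psd : psd M)
  (d0 : (0 < d)%N) (k0 : (0 < k)%N) (p0 : 0 <= p)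
  (xi_meas : measurable_fun setT xi)
  (w0_unif : forall s, uniform_unit_vector P (w0 s))
  (w0_indep : mutually_independent P xi w0).

Definition starts (s : nat) (t : T) : 'cV[R]_d :=
  if insub s is Some i then w0 i t else 0.

Lemma startsE (s : 'I_k) t : starts s t = w0 s t.
Proof. by rewrite /starts valK. Qed.

Definition history s t := lazy_seq (A (xi t)) M k delta e p (fun r => starts r t) s.

Let c : R := p / k%:R / (2 * d%:R).

Definition good_set (s : nat) : set T :=
  [set t | good_start c (deflate M (history s t)) (starts s t)].

Let c0 : 0 <= c.
Proof. by rewrite !divr_ge0 ?mulr_ge0. Qed.

Lemma top_eigenvector (N : 'M[R]_d) : psd N ->
  exists2 q, norm2 q = 1 & N *m q = spectral_norm N *: q.
Proof.
move=> Np; have [Q [D ND]] := spectral_theorem Np.1.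
have [i Di] := sdec_norm_attained ND Np d0.
by exists (col i Q); [exact: (sdec_col_norm ND)|rewrite (sdec_col_eigen ND) Di].
Qed.

(** For a fixed matrix one top eigenvector q suffices: a bad start forces |<q, w_0>| < c, and 2 c d
    = p/k. *)
Lemma bad_start_le (N : 'M[R]_d) (s : 'I_k) : psd N ->
  (P [set t | ~ good_start c N (w0 s t)] <= (p / k%:R)%:E)%E.
Proof.
move=> Np; have [q q1 Nq] := top_eigenvector Np.
have [mw _ _] := w0_unif s.
apply: (@le_trans _ _ (P [set t | (`|dotv q (w0 s t)| < c)%R])).
  apply: le_measure; rewrite ?inE.
  - have := measurable_good_start c (measurable_mx_cst N) mw.
    exact: measurableC.
  - exact: measurable_slab_pre.
  move=> t /= bad; rewrite ltNge; apply/negP => h; apply: bad.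
  exact: (good_start_intro Np c0 q1 Nq h).
apply: le_trans (small_ball d0 (w0_unif s) q1 c0) _; rewrite lee_fin /c.
by rewrite le_eqVlt; apply/orP; left; apply/eqP; field; rewrite ?gt_eqF ?ltr0n.
Qed.

Lemma starts_measurable s : measurable_fun setT (starts s : T -> borelM R d 1).
Proof.
rewrite /starts; case: insubP => [i _ _|_]; last exact: measurable_mx_cst.
by have [] := w0_unif i.
Qed.

Lemma good_set_measurable s : measurable (good_set s).
Proof. by apply: measurable_good => // [r _|]; exact: starts_measurable. Qed.

Lemma history_psd s t : psd (deflate M (history s t)).
Proof.
have -> : history s t = take s (history s t) by rewrite take_oversize// size_lazy_seq.
by rewrite deflateE ?size_lazy_seq//; exact: deflated_psd.
Qed.

(* history s is a function of xi and of the starting vectors drawn before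
   step s, hence independent of the one drawn at step s. *)
Lemma good_set_prob (s : 'I_k) : (P (~` good_set s) <= (p / k%:R)%:E)%E.
Proof.
pose w_meas r : measurable_fun setT (w0 r : T -> borelM R d 1) := let: And3 h _ _ := w0_unif r in h.
pose S : set (past xi w0 s * borelM R d 1) :=
  [set x | ~ good_start c (deflate M (history s x.1)) x.2].
have mS : measurable S.
  apply: measurableC; apply: measurable_good_start; last exact: measurable_snd.
  have mh : measurable_fun setT (fun t : past xi w0 s => deflate M (history s t) : borelM R d d).
    have past_starts r : (r < s)%N ->
        measurable_fun setT (starts r : past xi w0 s -> borelM R d 1).
      move=> rs; rewrite /starts insubT ?(ltn_trans rs)// => rk.
      exact: (@measurable_past_w _ _ _ _ _ _ _ xi w0 s (Ordinal rk)).
    have [] := @measurable_state R _ (past xi w0 s) d dZ Z A A_meas xi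
      (@measurable_past_xi _ _ _ _ _ _ _ xi w0 s)
      M k delta e p starts s past_starts.
    move=> h _; exact h.
  exact: (measurableT_comp mh measurable_fst).
have -> : ~` good_set s = [set t | S (t, w0 s t)].
  by apply/seteqP; split => t; rewrite /good_set /S /= startsE.
(* The identity, seen as a random variable with values in the coarser space: it plays the part of
   the past. *)
pose I : T -> past xi w0 s := fun t => t.
have mI : measurable_fun setT I.
  by move=> _ F mF; rewrite setTI; exact: (past_measurable xi_meas w_meas mF).
have indepI (F : set (past xi w0 s)) (B : set (borelM R d 1)) : measurable F -> measurable B ->
    (P (I @^-1` F `&` w0 s @^-1` B) = P (I @^-1` F) * P (w0 s @^-1` B))%E.
  by move=> mF mB; exact: (past_independent xi_meas w_meas w0_indep mF mB).
apply: (independent_section_le mI (w_meas s) indepI mS) => t.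
exact: (bad_start_le s (history_psd s t)).
Qed.

Lemma good_event_prob : ((1 - p)%:E <= P (\bigcap_(s in `I_k) good_set s))%E.
Proof.
have mG : measurable (\bigcap_(s in `I_k) good_set s).
  by apply: bigcap_measurable => [|s _]; [exists 0%N|exact: good_set_measurable].
have : (P (~` \bigcap_(s in `I_k) good_set s) <= p%:E)%E.
  rewrite setC_bigcap bigcup_mkord.
  apply: le_trans (Boole_inequality P (A := fun s => ~` good_set s) _) _ => [s _|].
    by apply: measurableC; exact: good_set_measurable.
  apply: le_trans (_ : (\sum_(s < k) (p / k%:R)%:E <= _)%E).
    by apply: lee_sum => s _; exact: good_set_prob.
  by rewrite sumEFin sumr_const card_ord lee_fin -[X in X <= _]mulr_natr divfK// gt_eqF// ltr0n.
have Gfin : P (\bigcap_(s in `I_k) good_set s) \is a fin_num by exact: fin_num_measure.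
by rewrite probability_setC// leeBlDr// EFinB leeBlDr// addeC.
Qed.

End GoodEvent.

(** * The theorem *)

Section Eigenbasis.
Local Open Scope ring_scope.
Context {R : realType} {d : nat}.
Variables (M : 'M[R]_d) (lam : d.-tuple R) (u : d.-tuple 'cV[R]_d).
Hypotheses (u_orth : forall i j, dotv (tnth u i) (tnth u j) = (i == j)%:R)
  (u_eigen : forall i, M *m tnth u i = tnth lam i *: tnth u i)
  (lam_sorted : sorted >=%R lam) (lam_ge0 : forall i, 0 <= tnth lam i).

Lemma nth_orth r s : (r < d)%N -> (s < d)%N ->
  dotv (nth 0 u r) (nth 0 u s) = (r == s)%:R.
Proof.
move=> rd sd; have := u_orth (Ordinal rd) (Ordinal sd).
by rewrite !(tnth_nth 0).
Qed.

Lemma eigenbasis_sdec : sdec M (colmx d u) (\row_(i < d) nth 0 lam i).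
Proof.
have UU : (colmx d u)^T *m colmx d u = 1%:M by apply: orth_gram; exact: nth_orth.
split => //; suff <- : M *m colmx d u = colmx d u *m diag_mx (\row_(i < d) nth 0 lam i).
  by rewrite -mulmxA orthogonal_left// mulmx1.
apply/matrixP => i j; rewrite mul_mx_diag [RHS]mxE [X in _ * X]mxE [X in X * _]mxE.
have /colP/(_ i) := u_eigen j; rewrite !(tnth_nth 0) [RHS]mxE mulrC => <-.
by rewrite !mxE; apply: eq_bigr => r _; rewrite mxE.
Qed.

Lemma nth_sorted_le i j : (i <= j)%N -> nth 0 lam j <= nth 0 lam i.
Proof.
have lam0 n : 0 <= nth 0 lam n.
  have [nd|dn] := ltnP n d; last by rewrite nth_default ?size_tuple.
  by have := lam_ge0 (Ordinal nd); rewrite (tnth_nth 0).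
move=> ij; have [jd|dj] := ltnP j d; last by rewrite nth_default ?size_tuple.
have ge_tr : transitive (>=%R : rel R) by move=> x y z yx xz; apply: le_trans xz yx.
have id : (i < d)%N by exact: leq_ltn_trans jd.
by apply: (sorted_leq_nth ge_tr (@lexx _ R) 0 lam_sorted) ij; rewrite inE size_tuple.
Qed.

Lemma eigenbasis_psd : psd M.
Proof.
have MU := eigenbasis_sdec; split; first exact: (sdec_sym MU).
move=> x; rewrite (sdec_quad MU); apply: sumr_ge0 => i _.
by rewrite mulr_ge0 ?sqr_ge0// mxE -tnth_nth.
Qed.

(** Since the eigenvalues are sorted, all from the first one at most mu onwards are at most mu. If
    there is none, [find] returns d and the matrix has no columns. *)
Lemma tail_low mu (x : 'cV[R]_(d - find (fun l => l <= mu) lam)) :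
  let j := find (fun l => l <= mu) lam in
  let h := colmx (d - j) (drop j u) *m x in
  low (colmx d u) (\row_(i < d) nth 0 lam i) mu h /\ norm2 h = norm2 x.
Proof.
move=> j h; have jr (r : 'I_(d - j)) : (j + r < d)%N by rewrite -ltn_subRL.
split=> [i|]; last first.
  apply: norm2_isometry; apply: orth_gram => r s rd sd.
  by rewrite !nth_drop nth_orth ?eqn_add2l// -ltn_subRL.
rewrite mxE => li; rewrite /h mulmxA mxE big1// => r _.
rewrite mxE.
have -> : \sum_(l < d) (colmx d u)^T i l * colmx (d - j) (drop j u) l r =
    dotv (nth 0 u i) (nth 0 u (j + r)).
  by rewrite dotvE; apply: eq_bigr => l _; rewrite !mxE nth_drop.
rewrite nth_orth//; case: eqP => [E|]; last by rewrite mul0r.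
move: li; rewrite E ltNge => /negP[]; apply: le_trans (nth_sorted_le (leq_addr r j)) _.
have jd : (j < d)%N by apply: leq_ltn_trans (jr r); exact: leq_addr.
by apply: (@nth_find _ 0 (fun l => l <= mu)); rewrite has_find size_tuple.
Qed.

End Eigenbasis.

Theorem theorem4p1 (R : realType) (d k : nat) (M : 'M[R]_d)
    (lam : d.-tuple R) (u : d.-tuple 'cV[R]_d) (delta epca p : R)
    (dZ : measure_display) (Z : measurableType dZ) (A : Z -> inv_method R d)
    (dT : measure_display) (T : measurableType dT) (P : probability T R)
    (xi : T -> Z) (w0 : 'I_k -> T -> 'cV[R]_d)
    (M_sym : M^T = M)
    (lam_sorted : sorted >=%R lam)
    (lam01 : forall i, 0 <= tnth lam i <= 1)
    (u_orthonormal : forall i j, dotv (tnth u i) (tnth u j) = (i == j)%:R)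
    (u_eigen : forall i, M *m tnth u i = tnth lam i *: tnth u i)
    (k_range : (0 < k <= d)%N)
    (delta01 : 0 < delta < 1) (epca01 : 0 < epca < 1) (p01 : 0 < p < 1)
    (A_meas : measurable_method A)
    (A_inv : forall z, approx_inversion (A z))
    (xi_meas : measurable_fun setT xi)
    (w0_unif : forall s, uniform_unit_vector P (w0 s))
    (xi_w0_indep : mutually_independent P xi w0) :
  let run t vs :=
    LazySVD_returns (A (xi t)) M delta epca p (fun s => w0 s t) vs in
  let lam1 := nth 0 lam 0 in
  let lamk := nth 0 lam k.-1 in
  let lamk1 := nth 0 lam k in
  (forall t vs, run t vs -> (colmx k vs)^T *m colmx k vs = 1%:M) /\
  exists2 E : set T, measurable E /\ ((1 - p)%:E <= P E)%E &
  forall t, E t ->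
    (0 < lamk -> exists vs, run t vs) /\
    forall vs, run t vs ->
      let Vk := colmx k vs in
      let Vk1 := colmx k.-1 vs in
      let vk := nth 0 vs k.-1 in
      let Mk := compress M Vk in
      let Mk1 := compress M Vk1 in
      [/\ forall eps : R, 0 < eps -> 0 < lamk ->
            epca <= eps ^+ 4 * delta ^+ 2 /
                      (2 ^+ 12 * k%:R ^+ 4 * (lam1 / lamk) ^+ 2) ->
            let j := find (fun l => l <= (1 - delta) * spectral_norm Mk1) lam in
            let U := colmx (d - j) (drop j u) in
            spectral_norm (Vk^T *m U) <= eps,
          0 < lamk1 ->
            epca <= delta ^+ 6 /
                      (2 ^+ 28 * k%:R ^+ 4 * (lam1 / lamk1) ^+ 6) ->
            lamk1 <= spectral_norm Mk <= lamk1 / (1 - delta),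
          0 < lamk1 ->
            epca <= delta ^+ 6 /
                      (2 ^+ 28 * k%:R ^+ 4 * (lam1 / lamk1) ^+ 6) ->
            (1 - delta) * lamk <= dotv vk (M *m vk) <= (1 - delta)^-1 * lamk &
          forall q : R, 1 <= q -> 0 < lamk1 ->
            epca <= delta ^+ 6 /
                      (2 ^+ 28 * k%:R ^+ 4 * d%:R `^ (4 / q) *
                       (lam1 / lamk1) ^+ 6) ->
            schatten_norm q Mk <=
              (1 + delta) ^+ 2 / (1 - delta) ^+ 2 *
              (\sum_(k <= i < d) nth 0 lam i `^ q) `^ q^-1].
Proof.
have /andP[k0 kd] := k_range; have d0 := leq_trans k0 kd.
have lam_ge0 i : 0 <= tnth lam i by have /andP[] := lam01 i.
move=> run lam1 lamk lamk1.
have runE t vs : run t vs =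
    LazySVD_returns (A (xi t)) M delta epca p (fun s : 'I_k => starts w0 s t) vs.
  by rewrite /run; congr LazySVD_returns; apply/funext => s; rewrite startsE.
split=> [t vs|]; first by rewrite runE => rn; exact: (run_gram (w := fun s => starts w0 s t) rn (leqnn k)).
have MU := eigenbasis_sdec u_orthonormal u_eigen.
have M_psd := eigenbasis_psd u_orthonormal u_eigen lam_ge0.
pose l := nth 0 lam.
have l_le i j : (i <= j)%N -> l j <= l i by exact: nth_sorted_le.
have l_ge0 i : 0 <= l i.
  have [id|di] := ltnP i d; last by rewrite /l nth_default ?size_tuple.
  by have := lam_ge0 (Ordinal id); rewrite (tnth_nth 0).
have l_out i : (d <= i)%N -> l i = 0 by move=> di; rewrite /l nth_default ?size_tuple.
have M1 : spectral_norm M <= 1.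
  apply: le_trans (spectral_norm_top M_psd MU l_le l_ge0) _.
  by have /andP[_] := lam01 (Ordinal d0); rewrite (tnth_nth 0).
have /andP[p0 p1] := p01; have /andP[e0 _] := epca01.
exists (\bigcap_(s in `I_k) good_set A M delta epca p xi w0 s)%classic.
  split; last exact: (good_event_prob delta epca A_meas M_psd d0 k0 (ltW p0) xi_meas w0_unif xi_w0_indep).
  apply: bigcap_measurable => [|s _]; first by exists 0%N; rewrite /=.
  exact: good_set_measurable A_meas xi_meas w0_unif s.
move=> t good.
have w1 s : (s < k)%N -> norm2 (starts w0 s t) = 1.
  move=> sk; have [_ w1 _] := w0_unif (Ordinal sk).
  by rewrite (startsE w0 (Ordinal sk)) w1.
split=> [lk|vs].
  exists (lazy_seq (A (xi t)) M k delta epca p (fun s => starts w0 s t) k); rewrite runE.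
  exact: (run_exists (A_inv (xi t)) M_psd M1 delta01 epca01 p01 k0 d0 w1 MU l_le l_out lk good).
rewrite runE => rn Vk Vk1 vk Mk Mk1.
have v_orth := gram_orth (run_gram (w := fun s => starts w0 s t) rn (leqnn k)).
have -> : Mk = deflated M vs k by exact: (compressE v_orth).
have -> : Mk1 = deflated M vs k.-1 by apply: (compressE v_orth); exact: leq_pred.
(* The mass bound needs lambda_k > 0, so that no call meets a zero matrix. Property (a) assumes it;
   in (b), (c) and (d) it follows from lambda_(k+1) > 0. *)
have mass (lk : 0 < l k.-1) s Q D :=
  @run_mass _ _ _ _ _ _ _ _ (fun s => starts w0 s t) (A_inv (xi t)) M_psd M1 delta01 epca01 p01 k0 d0 w1 _ _
    MU l_le l_out lk _ rn good s Q D.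
have lk : 0 < lamk1 -> 0 < l k.-1.
  by move=> h; apply: lt_le_trans h _; apply: l_le; exact: leq_pred.
split.
- move=> eps eps0 lamk0 he; apply: (spectral_norm_le (ltW eps0)) => x.
  have [hlow hx] := tail_low u_orthonormal lam_sorted lam_ge0 x.
  rewrite -mulmxA -hx.
  exact: (low_angle M_psd MU l_le l_ge0 l_out v_orth delta01 (ltW e0) (mass lamk0) k0 lamk0 eps0 he).
- move=> h he.
  exact: (norm_bounds M_psd MU l_le l_ge0 l_out v_orth delta01 (ltW e0) (mass (lk h)) k0 h he).
- move=> h he.
  exact: (rayleigh_bounds M_psd MU l_le l_ge0 l_out v_orth delta01 (ltW e0) (mass (lk h)) k0 h he).
- move=> q q1 h he.
  exact: (schatten_bound M_psd MU l_le l_ge0 l_out v_orth delta01 (ltW e0) (mass (lk h)) k0 h q1 he).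
Qed.
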